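(* Let $Y$ be a non-negative, non-degenerate random variable and let $Y_1,Y_2,\dots$ be i.i.d. copies of $Y$. Let $\mathcal{X}$ be the class of non-degenerate random variables $X$ with $E|X|<\infty$. For $X\in\mathcal{X}$ let $X_1,X_2,\dots$ be i.i.d. copies of $X$, independent of $\{Y_i\}_{i\ge1}$, and set $$T_n=\frac{\sum_{i=1}^{n}X_iY_i}{\sum_{i=1}^{n}Y_i}\qquad(0/0:=0).$$ Then the following are equivalent: (1) for every $X\in\mathcal{X}$, every subsequential distributional limit of $(T_n)_{n\ge 1}$ (i.e. every law that is the limit in distribution of $T_{n'}$ along some subsequence $\{n'\}$ of $\{n\}$) is continuous; (2) $Y\in\mathcal{F}_c$, i.e. $Y$ is in the centered Feller class.
   Context: A distribution on $\mathbb{R}$ is continuous if its cumulative distribution function is continuous (it has no atoms). Feller class: a random variable $Y$ is in the Feller class $\mathcal{F}$ if there exist norming constants $a_n>0$ with $a_n\to\infty$ and centering constants $b_n\in\mathbb{R}$ such that, for $Y_1,Y_2,\dots$ i.i.d. copies of $Y$, every subsequence of $\{n\}$ contains a further subsequence $\{n'\}$ along which $a_{n'}^{-1}\{\sum_{i=1}^{n'}Y_i-b_{n'}\}$ converges in distribution to some non-degenerate random variable $W$ (which may depend on the subsequence). $Y$ is in the centered Feller class, $Y\in\mathcal{F}_c$, if this holds with the choice $b_n=0$ for all $n\ge1$. *)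

(* Defs.v *)
From HB Require Import structures.
From mathcomp Require Import all_boot all_order all_algebra finmap.
From mathcomp Require Import all_classical all_reals all_analysis measurable_realfun.

Set Implicit Arguments.
Unset Strict Implicit.
Unset Printing Implicit Defensive.

Import Order.TTheory GRing.Theory Num.Theory.
Import numFieldNormedType.Exports.

Local Open Scope classical_set_scope.
Local Open Scope ring_scope.

Lemma measurable_invr (R : realType) : measurable_fun [set: R] (@GRing.inv R).
Proof.
rewrite -(setvU [set 0 : R]).
apply/measurable_funU => //; first exact: measurableC.
split; last exact: measurable_fun_set1.
apply: open_continuous_measurable_fun.
  by rewrite openC; exact: closed_eq.
by move=> x; rewrite inE => /eqP; exact: inv_continuous.
Qed.

Definition non_degenerate d (T : measurableType d) (R : realType)
    (P : probability T R) (X : {RV P >-> R}) : Prop :=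
  ~ exists c : R, P (X @^-1` [set c]) = 1%E.

Definition same_distribution d (T : measurableType d) d' (T' : measurableType d')
    (R : realType) (P : probability T R) (P' : probability T' R)
    (X : {RV P >-> R}) (X' : {RV P' >-> R}) : Prop :=
  forall A : set R, measurable A -> distribution P X A = distribution P' X' A.

Definition mutually_independent d (T : measurableType d) (R : realType)
    (P : probability T R) (Z : nat -> {RV P >-> R}) : Prop :=
  forall (J : {fset nat}) (A : nat -> set R), (forall i, measurable (A i)) ->
    P (\bigcap_(i in [set` J]) (Z i @^-1` A i)) =
    (\prod_(i <- J) P (Z i @^-1` A i))%E.

Definition iid_copies d (T : measurableType d) d' (T' : measurableType d')
    (R : realType) (P : probability T R) (P' : probability T' R)
    (Z : nat -> {RV P >-> R}) (Y : {RV P' >-> R}) : Prop :=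
  mutually_independent Z /\ forall i, same_distribution (Z i) Y.

Definition sigma_algebra_of d (T : measurableType d) (R : realType)
    (P : probability T R) (Z : nat -> {RV P >-> R}) : set (set T) :=
  <<s \bigcup_i preimage_set_system [set: T] (Z i) (@measurable _ R) >>.

Definition independent_sequences d (T : measurableType d) (R : realType)
    (P : probability T R) (X Y : nat -> {RV P >-> R}) : Prop :=
  forall E F, sigma_algebra_of X E -> sigma_algebra_of Y F ->
    P (E `&` F) = (P E * P F)%E.

Definition cvg_in_distribution d (T : measurableType d)
    d' (T' : measurableType d') (R : realType)
    (P : probability T R) (Q : probability T' R)
    (U : nat -> {RV P >-> R}) (W : {RV Q >-> R}) : Prop :=
  forall x : R, {for x, continuous (cdf W)} ->
    cdf (U n) x @[n --> \oo] --> cdf W x.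

Section sums.
Context d (T : measurableType d) (R : realType) (P : probability T R).
Variables X Y : nat -> {RV P >-> R}.

Definition normed_sum (a b : R^nat) (n : nat) : T -> R :=
  fun w => (a n)^-1 * (\sum_(i < n) Y i w - b n).

Lemma measurable_normed_sum a b n :
  measurable_fun [set: T] (normed_sum a b n).
Proof.
apply: measurable_funM; first exact: measurable_cst.
apply: measurable_funB; last exact: measurable_cst.
by apply: measurable_sum => i; exact: measurable_funPT.
Qed.

HB.instance Definition _ a b n :=
  isMeasurableFun.Build _ _ _ _ (normed_sum a b n)
    (measurable_normed_sum a b n).

(* Division by zero yields 0 in a realType, hence the convention 0/0 := 0. *)
Definition weighted_mean (n : nat) : T -> R :=
  fun w => (\sum_(i < n) X i w * Y i w) / (\sum_(i < n) Y i w).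

Lemma measurable_weighted_mean n :
  measurable_fun [set: T] (weighted_mean n).
Proof.
apply: measurable_funM.
  apply: measurable_sum => i.
  by apply: measurable_funM; exact: measurable_funPT.
apply: (measurableT_comp (@measurable_invr R)).
by apply: measurable_sum => i; exact: measurable_funPT.
Qed.

HB.instance Definition _ n :=
  isMeasurableFun.Build _ _ _ _ (weighted_mean n) (measurable_weighted_mean n).

End sums.

(* Everything here depends only on the law of [Y], so the copies of [Y] range
   over all i.i.d. sequences with that law, on any probability space. The index
   0 of the sequences is immaterial. *)
Definition feller_norming d (T : measurableType d) (R : realType)
    (P : probability T R) (Y : {RV P >-> R}) (a b : R^nat) : Prop :=
  [/\ forall n, 0 < a n,
      a n @[n --> \oo] --> +oo &
      forall d1 (T1 : measurableType d1) (P1 : probability T1 R)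
        (Ys : nat -> {RV P1 >-> R}), iid_copies Ys Y ->
      forall phi : nat -> nat, increasing_seq phi ->
      exists2 psi : nat -> nat, increasing_seq psi &
      exists d2 (T2 : measurableType d2) (Q : probability T2 R)
        (W : {RV Q >-> R}), non_degenerate W /\
        cvg_in_distribution
          (fun k => normed_sum Ys a b (phi (psi k)) : {RV P1 >-> R}) W].

Definition feller_class d (T : measurableType d) (R : realType)
    (P : probability T R) (Y : {RV P >-> R}) : Prop :=
  exists a b : R^nat, feller_norming Y a b.

Definition centered_feller_class d (T : measurableType d) (R : realType)
    (P : probability T R) (Y : {RV P >-> R}) : Prop :=
  exists a : R^nat, feller_norming Y a (fun=> 0).

Definition continuous_distribution d (T : measurableType d) (R : realType)
    (P : probability T R) (W : {RV P >-> R}) : Prop :=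
  continuous (cdf W).

Definition subsequential_limit d (T : measurableType d)
    d' (T' : measurableType d') (R : realType)
    (P : probability T R) (Q : probability T' R)
    (U : nat -> {RV P >-> R}) (W : {RV Q >-> R}) : Prop :=
  exists2 phi : nat -> nat, increasing_seq phi &
    cvg_in_distribution (U \o phi) W.

(* Main.v *)
(* Write G(x) = E[min(Y/x, 1)] and p(x) = P(Y > x), and call the tail of Y regular if, for large x,
   c G(x) <= p(c x) and G(2x) <= rho G(x) for some constants c > 0 and rho < 1. Both conditions of
   the theorem are equivalent to regularity.

   If the tail is regular and n G(a_n) is of order 1, then S_n / a_n is tight and, for every K, with
   high probability at least K of the weights Y_i / S_n exceed a fixed constant. The first fact and
   the Helly selection theorem give the centered Feller class. The second one, with independent X_i
   and a Littlewood-Offord bound for the symmetrized sum (the antichain argument of Sperner, Lubell,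
   Yamamoto and Meshalkin), shows that T_n puts little mass on every small interval.

   If the tail is not regular, one of two things happens for suitable x and n along a sequence.
   Either p(dl x) < dl G(x) with dl arbitrarily small: then S_n / x is concentrated around 1 while no
   summand is large, and with Bernoulli X_i the law of T_n concentrates around 1/2. Or
   G(2x) > (1 - dl) G(x): then a single summand dominates S_n with probability bounded below, and T_n
   is close to 0 or 1 on that event. In both cases some limit of T_n has an atom; and no norming a_n
   can work for S_n: in the first case the limits would be degenerate; in the second one tightness forces
   x = O(a_n), while S_n = o(x) with probability close to 1, so the limits would degenerate to 0. *)
Require Import Defs.
From HB Require Import structures.
From mathcomp Require Import all_boot all_order all_algebra finmap.
From mathcomp Require Import ring lra zify.

Set Implicit Arguments.
Unset Strict Implicit.
Unset Printing Implicit Defensive.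

Import Order.TTheory GRing.Theory Num.Theory.

Local Open Scope ring_scope.

(** * The Littlewood-Offord inequality *)

(** The two inequalities of regularity have different roles. Iterating G(2x) <= rho G(x) gives
    geometric decay of G along dyadic scales: going up from a_n it yields tightness, going down to
    a_n / 2^k it makes n G as large as wanted. The bound c G(x) <= p(c x) then turns n G into an
    expected number of large summands. G is convenient because n G(x) bounds P(S_n > x) by Markov's
    inequality, and because G is nonincreasing while x G(x) is nondecreasing, so that G changes by
    at most a factor 2 per dyadic step. Truncation with first and second moments therefore suffices,
    without characteristic functions or infinitely divisible laws. Both conditions of the theorem
    quantify over sequences that are already given, so they say nothing before a sequence exists.
    Refuting them for an irregular tail requires independent copies of Y, and fair coins independent
    of them. These are built from one uniform variable: its even and odd binary digits form two
    independent uniform variables, iteration gives an infinite sequence, and the quantile function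
    gives it the required law. *)

Lemma leq_bin_succ n j : (j.*2 < n)%N -> ('C(n, j) <= 'C(n, j.+1))%N.
Proof.
move=> jn; rewrite -(leq_pmul2l (ltn0Sn j)) mul_bin_left leq_mul2r.
by apply/orP; right; lia.
Qed.

Lemma leq_bin_central k j : ('C(k.*2, j) <= 'C(k.*2, k))%N.
Proof.
have H i : (i <= k)%N -> ('C(k.*2, k - i) <= 'C(k.*2, k))%N.
  elim: i => [|i IH] ik; first by rewrite subn0.
  apply: leq_trans (IH (ltnW ik)).
  rewrite -[X in (_ <= 'C(_, X))%N](_ : (k - i.+1).+1 = _)%N; last lia.
  by apply: leq_bin_succ; lia.
have [jk|kj] := leqP j k; first by rewrite -(subKn jk); apply: H; rewrite leq_subr.
have [j2k|j2k] := leqP j k.*2; last by rewrite bin_small.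
rewrite -bin_sub//.
have -> : (k.*2 - j = k - (j - k))%N by lia.
by apply: H; lia.
Qed.

(** This is C(2k,k) <= 4^k / sqrt(2k+1), squared so that it stays in the integers. With (k+1)
    C(2k+2,k+1) = 2(2k+1) C(2k,k), the induction step reduces to (2k+1)(2k+3) <= (2k+2)^2. *)
Lemma central_bin_bound k : ('C(k.*2, k) ^ 2 * k.*2.+1 <= 16 ^ k)%N.
Proof.
elim: k => [|k IH]; first by rewrite bin0.
have E : (k.+1 * 'C(k.+1.*2, k.+1) = (k.*2.+1).*2 * 'C(k.*2, k))%N.
  have h1 := mul_bin_diag k.*2.+1 k; have h2 := mul_bin_down k.*2.+1 k.
  rewrite /= (_ : (k.*2.+1 - k = k.+1)%N) in h2; last lia.
  rewrite /= in h1.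
  by rewrite doubleS binS mulnDr -h1 -h2 addnn doubleMl.
rewrite -(leq_pmul2l (ltn0Sn k)) -(leq_pmul2l (ltn0Sn k)).
have -> : (k.+1 * (k.+1 * ('C(k.+1.*2, k.+1) ^ 2 * k.+1.*2.+1)) =
   (k.+1 * 'C(k.+1.*2, k.+1)) ^ 2 * k.+1.*2.+1)%N by ring.
rewrite E.
apply: (@leq_trans (16 * k.+1 ^ 2 * ('C(k.*2, k) ^ 2 * k.*2.+1)))%N; last first.
  apply: leq_trans (leq_mul (leqnn _) IH) _.
  by rewrite (expnS 16); set x := (16 ^ k)%N; lia.
have -> : ((k.*2.+1.*2 * 'C(k.*2, k)) ^ 2 * k.+1.*2.+1 =
  (k.*2.+1 * k.+1.*2.+1 * 4) * ('C(k.*2, k) ^ 2 * k.*2.+1))%N by rewrite -!muln2; ring.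
by rewrite leq_mul2r; apply/orP; right; rewrite -!muln2; nia.
Qed.

Section littlewood_offord.
Variables (R : realFieldType) (T : finType) (w : T -> R) (th : R).
Hypothesis w_ge0 : forall i, 0 <= w i.
Hypothesis th_gt0 : 0 < th.
Implicit Types (A M S : {set T}) (lo : R).

Definition subset_sum A : R := \sum_(i in A) w i.

Definition sums_in lo M : {set {set T}} :=
  [set A in powerset M | (lo <= subset_sum A) && (subset_sum A < lo + th)].

Lemma sums_inP lo M A : reflect [/\ A \subset M, lo <= subset_sum A & subset_sum A < lo + th]
  (A \in sums_in lo M).
Proof. by rewrite inE powersetE; apply: (iffP and3P). Qed.

(** A proper subset misses an element of weight at least [th], so its sum lies at least [th] lower
    and leaves the half-open window. This is the antichain property in the case that the induction
    of [lym] requires. *)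
Lemma sums_in_proper lo M A : {in M, forall i, th <= w i} ->
  M \in sums_in lo M -> A \in sums_in lo M -> A = M.
Proof.
move=> hM /sums_inP[_ _ M2] /sums_inP[AM A1 _]; apply/eqP.
apply/negPn/negP => nAM.
have /properP[_ [y yM yA]] : A \proper M by rewrite properEneq nAM.
move: M2; apply/negP; rewrite -leNgt /subset_sum.
rewrite (big_setID A)/= (setIidPr AM) (big_setD1 y (A := M :\: A))/=; last by rewrite inE yA.
apply: lerD => //; rewrite -[th]addr0; apply: lerD; first exact: hM.
by apply: sumr_ge0.
Qed.

(* The Lubell-Yamamoto-Meshalkin inequality: as all weights in [M] are at least [th], the subsets of
   [M] with sum in an interval of length [th] form an antichain. *)
Lemma lym lo M : {in M, forall i, th <= w i} ->
  \sum_(A in sums_in lo M) ('C(#|M|, #|A|)%:R)^-1 <= 1 :> R.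
Proof.
move: {2}#|M| (erefl #|M|) => m; elim: m M => [|m IH] M cM hM.
  have M0 : M = set0 by apply/eqP; rewrite -cards_eq0 cM.
  apply: (@le_trans _ _ (\sum_(A in [set set0 : {set T}]) ('C(#|M|, #|A|)%:R)^-1)).
    rewrite [leRHS](bigID (fun A => A \in sums_in lo M))/=.
    rewrite [X in _ <= X + _](eq_bigl (fun A => A \in sums_in lo M)).
      by rewrite lerDl sumr_ge0// => i _; rewrite invr_ge0 ler0n.
    move=> A; rewrite inE andbC; case: (boolP (A \in _)) => //= /sums_inP[AM _ _].
    by rewrite M0 subset0 in AM.
  by rewrite big_set1 cM cards0 bin0 invr1.
have [MB|MB] := boolP (M \in sums_in lo M).
  rewrite (eq_bigl (fun A => A == M)).
    by rewrite big_pred1_eq binn invr1.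
  move=> A; apply/idP/eqP => [AB|->//]; exact: (sums_in_proper (lo := lo)).
(* The weight of [A] is spread over the m+1-|A| points x of [M] outside [A], by (m+1-|A|) C(m+1,|A|)
   = (m+1) C(m,|A|). After the sums are exchanged, each x contributes at most 1 by induction on
   [M :\ x]. *)
have E A : A \in sums_in lo M -> ('C(#|M|, #|A|)%:R)^-1 =
    m.+1%:R^-1 * \sum_(x in M :\: A) ('C(m, #|A|)%:R)^-1 :> R.
  move=> AB; have /sums_inP[AM _ _] := AB.
  have AlM : (#|A| < m.+1)%N.
    rewrite -cM; apply: proper_card; rewrite properEneq AM andbT.
    by apply/negP => /eqP AE; move: MB; rewrite -{1}AE AB.
  rewrite sumr_const cardsD (setIidPr AM) cM -[_ *+ (_ - _)]mulr_natl.
  have h := mul_bin_down m.+1 #|A|.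
  have b1 : ('C(m.+1, #|A|)%:R : R) != 0 by rewrite pnatr_eq0 -lt0n bin_gt0 ltnW.
  have b2 : ('C(m, #|A|)%:R : R) != 0 by rewrite pnatr_eq0 -lt0n bin_gt0.
  have b3 : (m.+1%:R : R) != 0 by rewrite pnatr_eq0.
  have -> : (m.+1 - #|A|)%:R = m.+1%:R * 'C(m, #|A|)%:R / 'C(m.+1, #|A|)%:R :> R.
    by rewrite -natrM h natrM mulfK.
  by rewrite -!mulrA mulKf// mulrCA mulfV// mulr1.
rewrite (eq_bigr _ E) -mulr_sumr ler_pdivrMl ?ltr0n// mulr1.
rewrite (exchange_big_dep (fun x => x \in M))/=; last first.
  by move=> A x _; rewrite inE => /andP[].
have -> : m.+1%:R = \sum_(x in M) 1 :> R by rewrite sumr_const cM.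
apply: ler_sum => x xM.
have cMx : #|M :\ x| = m by have := cardsD1 x M; rewrite xM cM => -[].
have hMx : {in M :\ x, forall i, th <= w i}.
  by move=> i; rewrite inE => /andP[_]; exact: hM.
apply: le_trans (IH _ cMx hMx); rewrite cMx le_eqVlt; apply/orP; left; apply/eqP.
apply: eq_bigl => A; rewrite !inE xM andbT subsetD1.
by rewrite andbAC andbA; case: (x \in A); rewrite ?andbF ?andbT// andbA.
Qed.

Lemma card_sums_in lo M k : {in M, forall i, th <= w i} -> #|M| = k.*2 ->
  (#|sums_in lo M| <= 'C(k.*2, k))%N.
Proof.
move=> hM cM; have := lym lo hM; rewrite cM => H.
have C0 : (0 < 'C(k.*2, k)%:R :> R) by rewrite ltr0n bin_gt0; lia.
rewrite -(ler_nat R) -[leRHS]mulr1 -ler_pdivrMl//; apply: le_trans H.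
rewrite -sum1_card natr_sum mulr_sumr; apply: ler_sum => A /sums_inP[AM _ _].
rewrite mulr1 lef_pV2 ?posrE// ?ltr0n ?bin_gt0.
  by rewrite ler_nat leq_bin_central.
by rewrite -cM; exact: subset_leq_card.
Qed.

(** Fixing the trace of S outside [M] leaves a subset of [M] whose sum lies in a translate of the
    window, and there are 2^(|T|-2k) outer traces. *)
Lemma card_subset_sums lo M k : {in M, forall i, th <= w i} -> #|M| = k.*2 ->
  (#|[set S | (lo <= subset_sum S)%R && (subset_sum S < lo + th)%R]| <=
    2 ^ (#|T| - k.*2) * 'C(k.*2, k))%N.
Proof.
move=> hM cM; rewrite -sum1_card.
rewrite (partition_big (fun S => S :\: M) (fun B => B \in powerset (~: M)))/=; last first.
  by move=> S _; rewrite powersetE setDE subsetIr.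
have -> : (2 ^ (#|T| - k.*2) * 'C(k.*2, k) = \sum_(B in powerset (~: M)) 'C(k.*2, k))%N.
  by rewrite sum_nat_const card_powerset cardsCs setCK cM.
apply: leq_sum => B; rewrite powersetE => BM.
rewrite sum1_card; apply: leq_trans (card_sums_in (lo - subset_sum B) hM cM).
rewrite -(card_in_imset (f := fun S => S :&: M)); last first.
  move=> S1 S2 /andP[_ /eqP e1] /andP[_ /eqP e2] e3.
  by rewrite -(setID S1 M) -(setID S2 M) e1 e2 e3.
apply/subset_leq_card/fintype.subsetP => _ /imsetP[S + ->].
rewrite inE => /andP[]; rewrite inE => /andP[h1 h2] /eqP SB.
have E : subset_sum S = subset_sum (S :&: M) + subset_sum B.
  by rewrite /subset_sum (big_setID M)/= SB.
rewrite powersetE subsetIr /=; apply/andP; split; lra.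
Qed.

End littlewood_offord.

Definition signed_sum (R : realFieldType) (T : finType) (w : T -> R) (S : {set T}) : R :=
  \sum_i (if i \in S then - w i else w i).

(* Flipping the sign of the negative weights permutes the sign patterns, which reduces to the case of nonnegative weights. *)
Lemma littlewood_offord (R : realFieldType) (T : finType) (w : T -> R) (th e : R)
    (M : {set T}) (k : nat) : 0 <= e -> e < th ->
  {in M, forall i, th <= `|w i|} -> #|M| = k.*2 ->
  (#|[set S : {set T} | (`|signed_sum w S| <= e)%R]| <= 2 ^ (#|T| - k.*2) * 'C(k.*2, k))%N.
Proof.
move=> e0 eth hM cM.
pose N := [set i | w i < 0].
pose f (S : {set T}) := [set i | (i \in S) (+) (i \in N)].
have ff : involutive f.
  by move=> S; apply/setP => i; rewrite !inE -addbA addbb addbF.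
pose v i := `|w i|; pose tot := \sum_i v i.
have E S : signed_sum w S = tot - (subset_sum v (f S)) *+ 2.
  rewrite /signed_sum /tot /subset_sum [in RHS](big_mkcond (fun i => i \in f S)).
  rewrite -sumrMnl -sumrB; apply: eq_bigr => i _; rewrite !inE /v.
  have [wi|wi] := ltrP (w i) 0; case: (i \in S) => /=.
  - by rewrite ltr0_norm// mul0rn subr0.
  - by rewrite ltr0_norm//; ring.
  - by rewrite ger0_norm//; ring.
  - by rewrite ger0_norm// mul0rn subr0.
have v0 i : 0 <= v i by exact: normr_ge0.
have th0 : 0 < th by exact: le_lt_trans eth.
(* By [E], the signed sum is within e of 0 exactly when the subset sum of [f S] lies in
   [(tot-e)/2, (tot+e)/2], whose length e is less than [th]. *)
apply: leq_trans (card_subset_sums v0 th0 ((tot - e) / 2) hM cM).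
rewrite -(card_imset _ (inv_inj ff)); apply/subset_leq_card/fintype.subsetP => _ /imsetP[S + ->].
rewrite !inE E ler_norml => /andP[h1 h2].
by apply/andP; split; lra.
Qed.

Lemma central_bin_ratio (R : realFieldType) (k : nat) :
  (('C(k.*2, k))%:R / 4 ^+ k) ^+ 2 <= (k.*2.+1)%:R^-1 :> R.
Proof.
have := central_bin_bound k; rewrite -(ler_nat R) natrM !natrX => H.
rewrite expr_div_n -exprM mulnC exprM ler_pdivrMr; last by rewrite exprn_gt0// exprn_gt0.
rewrite mulrC ler_pdivlMr ?ltr0n//; apply: le_trans H _.
by rewrite le_eqVlt; apply/orP; left; apply/eqP; congr (_ ^+ _); ring.
Qed.

From mathcomp Require Import all_classical all_reals all_analysis measurable_realfun.

Import numFieldNormedType.Exports.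

Local Open Scope classical_set_scope.
Local Open Scope ring_scope.

(** * Probabilities and expectations of bounded functions *)

Section real_probability.
Context d (T : measurableType d) (R : realType) (P : probability T R).
Implicit Types A B : set T.

(** Real valued, so that [lra] and [nra] decide inequalities between probabilities; [EFin_Pr]
    returns to the extended reals for measurable sets. *)
Definition Pr A : R := fine (P A).

Lemma EFin_Pr A : measurable A -> (Pr A)%:E = P A.
Proof. by move=> mA; rewrite /Pr fineK// fin_num_measure. Qed.

Lemma Pr_ge0 A : 0 <= Pr A.
Proof. by rewrite /Pr fine_ge0. Qed.

Lemma Pr_le1 A : measurable A -> Pr A <= 1.
Proof. by move=> mA; rewrite -lee_fin EFin_Pr//; exact: probability_le1. Qed.

Lemma le_Pr A B : measurable A -> measurable B -> A `<=` B -> Pr A <= Pr B.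
Proof.
by move=> mA mB AB; rewrite -lee_fin !EFin_Pr//; apply: le_measure; rewrite ?inE.
Qed.

Lemma Pr_setT : Pr setT = 1.
Proof. by rewrite /Pr probability_setT. Qed.

Lemma Pr_set0 : Pr set0 = 0.
Proof. by rewrite /Pr measure0. Qed.

Lemma Pr_setC A : measurable A -> Pr (~` A) = 1 - Pr A.
Proof.
move=> mA; apply/EFin_inj; rewrite EFinB !EFin_Pr//; last exact: measurableC.
by rewrite probability_setC.
Qed.

Lemma Pr_setU A B : measurable A -> measurable B -> Pr (A `|` B) <= Pr A + Pr B.
Proof.
move=> mA mB; rewrite -lee_fin EFinD !EFin_Pr//; last exact: measurableU.
exact: measureU2.
Qed.

Lemma Pr_setU_disjoint A B : measurable A -> measurable B -> A `&` B = set0 ->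
  Pr (A `|` B) = Pr A + Pr B.
Proof.
move=> mA mB AB; apply/EFin_inj; rewrite EFinD !EFin_Pr//; last exact: measurableU.
exact: measureU.
Qed.

Lemma Pr_setI A B : measurable A -> measurable B ->
  1 - Pr (~` A) - Pr (~` B) <= Pr (A `&` B).
Proof.
move=> mA mB; rewrite -[A `&` B]setCK setCI [X in _ <= X]Pr_setC; last first.
  by apply: measurableU; exact: measurableC.
have := @Pr_setU (~` A) (~` B) (measurableC mA) (measurableC mB); lra.
Qed.

End real_probability.

Section bounded_expectation.
Context d (T : measurableType d) (R : realType) (P : probability T R).
Implicit Types f g : T -> R.

(** No measure occurs here, so the notion serves the original spaces, products and image laws alike.
    Every expectation taken below is that of a bounded quantity; the moments of Y itself may be
    infinite. *)
Definition bounded_measurable f :=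
  measurable_fun [set: T] f /\ exists M : R, forall x, `|f x| <= M.

Lemma bdd_integrable f : bounded_measurable f -> P.-integrable setT (EFin \o f).
Proof.
move=> [mf [M fM]]; apply: measurable_bounded_integrable => //.
  by rewrite (le_lt_trans (probability_le1 P measurableT))// ltry.
by exists M; split; [exact: num_real|move=> x Mx y _; apply: le_trans (fM y) (ltW Mx)].
Qed.

Lemma bdd_cst c : bounded_measurable (fun=> c).
Proof. by split; [exact: measurable_cst|exists `|c|]. Qed.

Lemma bddD f g : bounded_measurable f -> bounded_measurable g ->
  bounded_measurable (fun x => f x + g x).
Proof.
move=> [mf [M fM]] [mg [N gN]]; split; first exact: measurable_funD.
by exists (M + N) => x; apply: le_trans (ler_normD _ _) _; rewrite lerD.
Qed.

Lemma bddM f g : bounded_measurable f -> bounded_measurable g ->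
  bounded_measurable (fun x => f x * g x).
Proof.
move=> [mf [M fM]] [mg [N gN]]; split; first exact: measurable_funM.
by exists (M * N) => x; rewrite normrM ler_pM.
Qed.

Lemma bdd_sqr f : bounded_measurable f -> bounded_measurable (fun x => f x ^+ 2).
Proof.
by move=> bf; under [X in bounded_measurable X]funext do rewrite expr2; exact: bddM.
Qed.

Lemma bddB f g : bounded_measurable f -> bounded_measurable g ->
  bounded_measurable (fun x => f x - g x).
Proof.
move=> [mf [M fM]] [mg [N gN]]; split; first exact: measurable_funB.
by exists (M + N) => x; apply: le_trans (ler_normB _ _) _; rewrite lerD.
Qed.

Lemma bdd_sum n (f : nat -> T -> R) : (forall i, bounded_measurable (f i)) ->
  bounded_measurable (fun x => \sum_(i < n) f i x).
Proof.
move=> bf; elim: n => [|n IH].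
  by under [X in bounded_measurable X]funext do rewrite big_ord0; exact: bdd_cst.
by under [X in bounded_measurable X]funext do rewrite big_ord_recr; exact: bddD.
Qed.

Lemma bdd_indic (A : set T) : measurable A -> bounded_measurable (\1_A : T -> R).
Proof.
move=> mA; split; first exact: measurable_indic.
by exists 1 => x; rewrite indicE; case: (x \in A); rewrite ?normr1 ?normr0.
Qed.

Definition Ex f : R := \int[P]_w f w.

Lemma Ex_cst c : Ex (fun=> c) = c.
Proof. by rewrite /Ex Rintegral_cst// -/(Pr P setT) Pr_setT mulr1. Qed.

Lemma ExD f g : bounded_measurable f -> bounded_measurable g ->
  Ex (fun x => f x + g x) = Ex f + Ex g.
Proof. by move=> bf bg; rewrite /Ex RintegralD//; exact: bdd_integrable. Qed.

Lemma ExB f g : bounded_measurable f -> bounded_measurable g ->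
  Ex (fun x => f x - g x) = Ex f - Ex g.
Proof. by move=> bf bg; rewrite /Ex RintegralB//; exact: bdd_integrable. Qed.

Lemma ExZ c f : bounded_measurable f -> Ex (fun x => c * f x) = c * Ex f.
Proof. by move=> bf; rewrite /Ex RintegralZl//; exact: bdd_integrable. Qed.

Lemma Ex_sum n (f : nat -> T -> R) : (forall i, bounded_measurable (f i)) ->
  Ex (fun x => \sum_(i < n) f i x) = \sum_(i < n) Ex (f i).
Proof.
move=> bf; elim: n => [|n IH].
  by under [X in Ex X]funext do rewrite big_ord0; rewrite Ex_cst big_ord0.
under [X in Ex X]funext do rewrite big_ord_recr/=.
by rewrite big_ord_recr ExD ?IH//; exact: bdd_sum.
Qed.

Lemma le_Ex f g : bounded_measurable f -> bounded_measurable g ->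
  (forall x, f x <= g x) -> Ex f <= Ex g.
Proof.
by move=> bf bg fg; apply: le_Rintegral => //; exact: bdd_integrable.
Qed.

Lemma Ex_ge0 f : (forall x, 0 <= f x) -> 0 <= Ex f.
Proof. by move=> f0; apply: Rintegral_ge0. Qed.

Lemma Ex_indic A : measurable A -> Ex \1_A = Pr P A.
Proof. by move=> mA; rewrite /Ex /Rintegral integral_indic// setIT. Qed.

Lemma Ex_markov f (a : R) : bounded_measurable f -> (forall x, 0 <= f x) -> 0 < a ->
  Pr P [set w | a <= f w] <= Ex f / a.
Proof.
move=> bf f0 a0.
have mA : measurable [set w | a <= f w].
  rewrite (_ : [set _ | _] = f @^-1` `[a, +oo[).
    by rewrite -[X in measurable X]setTI; exact: bf.1.
  by apply/seteqP; split => w /=; rewrite in_itv/= andbT.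
rewrite ler_pdivlMr// mulrC -Ex_indic// -ExZ//; last exact: bdd_indic.
apply: le_Ex => //; first by apply: bddM; [exact: bdd_cst|exact: bdd_indic].
move=> x; rewrite indicE; have [|] := boolP (x \in _); last by rewrite mulr0.
by rewrite inE /= mulr1.
Qed.

(** Second moments stand in for variances on the right: for indicators they equal the mean, and for
    truncations at z they are at most z times the mean. *)
Lemma chebyshev_sum n (Z : nat -> T -> R) (a : R) :
  (forall i, bounded_measurable (Z i)) ->
  (forall i j : nat, i != j -> Ex (fun w => Z i w * Z j w) = Ex (Z i) * Ex (Z j)) ->
  0 < a ->
  Pr P [set w | a <= `|\sum_(i < n) Z i w - \sum_(i < n) Ex (Z i)|] <=
    (\sum_(i < n) Ex (fun w => Z i w ^+ 2)) / a ^+ 2.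
Proof.
move=> bZ uZ a0.
pose Y i w := Z i w - Ex (Z i).
have bY i : bounded_measurable (Y i) by apply: bddB => //; exact: bdd_cst.
have YE w : \sum_(i < n) Z i w - \sum_(i < n) Ex (Z i) = \sum_(i < n) Y i w.
  by rewrite sumrB.
have EYY i j : Ex (fun w => Y i w * Y j w) =
    Ex (fun w => Z i w * Z j w) - Ex (Z i) * Ex (Z j).
  rewrite (_ : (fun _ => _) = (fun w => (Z i w * Z j w - Ex (Z i) * Z j w) -
      (Ex (Z j) * Z i w - Ex (Z i) * Ex (Z j)))); last first.
    by apply/funext => w; rewrite /Y; ring.
  have bc c i0 : bounded_measurable (fun w => c * Z i0 w).
    by apply: bddM => //; exact: bdd_cst.
  rewrite !ExB ?ExZ ?Ex_cst//; do ?[exact: bdd_cst|exact: bddM].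
  - by ring.
  - by apply: bddB => //; exact: bddM.
  - by apply: bddB => //; exact: bdd_cst.
have bYs := bdd_sum n bY.
have -> : [set w | a <= `|\sum_(i < n) Z i w - \sum_(i < n) Ex (Z i)|] =
    [set w | a ^+ 2 <= (\sum_(i < n) Y i w) * (\sum_(i < n) Y i w)].
  apply/seteqP; split => w /=; rewrite YE -expr2 -(@real_normK _ (\sum_(i < n) Y i w)) ?num_real//;
  by rewrite ler_pXn2r// ?nnegrE// ltW.
apply: le_trans (Ex_markov _ _ _) _.
- exact: bddM.
- by move=> x; rewrite -expr2 sqr_ge0.
- exact: exprn_gt0.
rewrite ler_pM2r ?invr_gt0 ?exprn_gt0//.
under [X in Ex X]funext do rewrite big_distrlr/=.
pose f i w := \sum_(j < n) Y i w * Y j w.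
rewrite (@Ex_sum n f); last first.
  by move=> i; apply: (@bdd_sum n (fun j w => Y i w * Y j w)) => j; exact: bddM.
apply: ler_sum => i _; rewrite /f.
rewrite (@Ex_sum n (fun j w => Y i w * Y j w)); last by move=> j; exact: bddM.
rewrite (bigD1 i)//= big1 ?addr0; last first.
  by move=> j ji; rewrite EYY uZ ?subrr// eq_sym.
rewrite EYY; under [X in Ex X - _]funext do rewrite -expr2.
by rewrite lerBlDr lerDl -expr2 sqr_ge0.
Qed.

End bounded_expectation.

Lemma measurable_set_le d (T : measurableType d) (R : realType) (f g : T -> R) :
  measurable_fun [set: T] f -> measurable_fun [set: T] g ->
  measurable [set w | f w <= g w].
Proof.
move=> mf mg; have := measurable_fun_ler mf mg.
by move=> /(_ measurableT [set true]); rewrite setTI; apply.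
Qed.

Lemma measurable_set_lt d (T : measurableType d) (R : realType) (f g : T -> R) :
  measurable_fun [set: T] f -> measurable_fun [set: T] g ->
  measurable [set w | f w < g w].
Proof.
move=> mf mg; have := measurable_fun_ltr mf mg.
by move=> /(_ measurableT [set true]); rewrite setTI; apply.
Qed.

Lemma measurable_dist_le d (T : measurableType d) (R : realType) (f : T -> R) (c e : R) :
  measurable_fun [set: T] f -> measurable [set w | `|f w - c| <= e].
Proof.
move=> mf; apply: measurable_set_le; last exact: measurable_cst.
by apply: measurableT_comp => //; apply: measurable_funB => //; exact: measurable_cst.
Qed.

Lemma measurable_dist_ge d (T : measurableType d) (R : realType) (f : T -> R) (c e : R) :
  measurable_fun [set: T] f -> measurable [set w | e <= `|f w - c|].
Proof.
move=> mf; apply: measurable_set_le; first exact: measurable_cst.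
by apply: measurableT_comp => //; apply: measurable_funB => //; exact: measurable_cst.
Qed.

Lemma measurable_dist_gt d (T : measurableType d) (R : realType) (f : T -> R) (c e : R) :
  measurable_fun [set: T] f -> measurable [set w | e < `|f w - c|].
Proof.
move=> mf; apply: measurable_set_lt; first exact: measurable_cst.
by apply: measurableT_comp => //; apply: measurable_funB => //; exact: measurable_cst.
Qed.

(** * Continuity points and distribution functions *)

Lemma cvgn_distP (R : realType) (u : R^nat) (l : R) :
  u @ \oo --> l <->
  forall e, 0 < e -> exists N, forall n, (N <= n)%N -> `|u n - l| <= e.
Proof.
split=> [/cvgrPdist_le ul e e0|ul].
  have [N _ NE] := ul _ e0; exists N => n Nn.
  by rewrite distrC; exact: NE.
apply/cvgrPdist_le => e e0; have [N NE] := ul _ e0.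
by exists N => // n /= Nn; rewrite distrC; exact: NE.
Qed.

(** For a distribution function, F v - F u is the mass of (u, v], so continuity at t becomes
    smallness of the mass of an interval around t. Both directions of the theorem meet continuity in
    this form. *)
Lemma nondecreasing_continuousP (R : realType) (F : R -> R) (t : R) :
  {homo F : x y / x <= y} ->
  {for t, continuous F} <->
  forall e, 0 < e -> exists u v, [/\ u < t, t < v & F v - F u <= e].
Proof.
move=> ndF; split=> [cF e e0|H].
  have e20 : 0 < e / 2 by rewrite divr_gt0.
  have /cvgrPdist_le /(_ _ e20) := cF.
  move=> [r /= r0 rP]; exists (t - r / 2), (t + r / 2).
  split; [lra|lra|].
  have h1 : `|F t - F (t - r / 2)| <= e / 2.
    apply: rP => /=; rewrite opprB addrC subrK ger0_norm; lra.
  have h2 : `|F t - F (t + r / 2)| <= e / 2.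
    apply: rP => /=; rewrite opprD addrA subrr sub0r normrN ger0_norm; lra.
  move: h1 h2; rewrite !ler_norml => /andP[_ ?] /andP[? _]; lra.
apply/cvgrPdist_le => e e0; have [u [v [ut tv Fuv]]] := H _ e0.
near=> x.
have ux : u <= x by near: x; exact: lt_le_nbhsr.
have xv : x <= v by near: x; exact: lt_le_nbhsl.
have := ndF _ _ ux; have := ndF _ _ xv; have := ndF _ _ (ltW ut).
have := ndF _ _ (ltW tv).
move=> *; rewrite ler_norml; apply/andP; split; lra.
Unshelve. all: by end_near. Qed.

Section real_cdf.
Context d (T : measurableType d) (R : realType) (P : probability T R).
Variable W : {RV P >-> R}.

Definition rcdf (x : R) : R := Pr P [set w | W w <= x].

Lemma measurable_RV_le x : measurable [set w | W w <= x].
Proof. by apply: measurable_set_le; [exact: measurable_funPT|exact: measurable_cst]. Qed.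

Lemma measurable_RV_gt x : measurable [set w | x < W w].
Proof. by apply: measurable_set_lt; [exact: measurable_cst|exact: measurable_funPT]. Qed.

Lemma cdf_rcdf x : cdf W x = (rcdf x)%:E.
Proof.
rewrite EFin_Pr; last exact: measurable_RV_le.
by rewrite /cdf /distribution /pushforward; congr (P _).
Qed.

Lemma cdf_fineE : cdf W = EFin \o rcdf.
Proof. by apply/funext => x; rewrite cdf_rcdf. Qed.

Lemma rcdf_homo : {homo rcdf : x y / x <= y}.
Proof.
move=> x y xy; apply: le_Pr; do ?exact: measurable_RV_le.
by move=> w /= /le_trans; apply.
Qed.

Lemma rcdf_ge0 x : 0 <= rcdf x. Proof. exact: Pr_ge0. Qed.

Lemma rcdf_le1 x : rcdf x <= 1. Proof. exact/Pr_le1/measurable_RV_le. Qed.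

Lemma Pr_gt x : Pr P [set w | x < W w] = 1 - rcdf x.
Proof.
rewrite -Pr_setC; last exact: measurable_RV_le.
by congr Pr; apply/seteqP; split => w /=; rewrite ltNge => /negP.
Qed.

Lemma cdf_continuousP (t : R) :
  {for t, continuous (cdf W)} <-> {for t, continuous rcdf}.
Proof.
rewrite cdf_fineE; split => h.
  by have /fine_cvgP[_] := h.
by apply: cvg_EFin => //; exact: nearW.
Qed.

Lemma rcdf_cvgy (e : R) : 0 < e -> exists M, forall x, M <= x -> 1 - rcdf x <= e.
Proof.
move=> e0; have := cvg_cdfy1 W; rewrite cdf_fineE => /fine_cvgP[_] /cvgrPdist_le /(_ _ e0).
move=> [M [_ MP]]; exists (M + 1) => x Mx.
apply: le_trans (ler_norm _) _; apply: MP; lra.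
Qed.

Lemma rcdf_cvgNy (e : R) : 0 < e -> exists M, forall x, x <= M -> rcdf x <= e.
Proof.
move=> e0; have := cvg_cdfNy0 W; rewrite cdf_fineE => /fine_cvgP[_] /cvgrPdist_le /(_ _ e0).
move=> [M [_ MP]]; exists (M - 1) => x Mx.
have := MP x; rewrite /= sub0r normrN => MPx.
apply: le_trans (ler_norm _) _; apply: MPx; lra.
Qed.

Lemma rcdf_right (t e : R) : 0 < e -> exists2 v, t < v & rcdf v - rcdf t <= e.
Proof.
move=> e0; have := @cdf_right_continuous _ _ _ _ W t.
rewrite cdf_fineE => /fine_cvgP[_] /cvgrPdist_le /(_ _ e0).
move=> [r /= r0 rP]; exists (t + r / 2); first by lra.
rewrite -lerN2 opprB; apply: le_trans (lerNnormlW _) => //.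
have : `|rcdf t - rcdf (t + r / 2)| <= e.
  apply: rP => /=; last by lra.
  rewrite opprD addrA subrr sub0r normrN ger0_norm; lra.
by [].
Qed.

(** Right-continuity always holds. On the left, the sets where t - 1/(n+1) < W <= t decrease to the
    null set W = t, and continuity from above applies. *)
Lemma pmf0_continuous (t : R) : pmf W t = 0 -> {for t, continuous rcdf}.
Proof.
move=> Wt; apply/(nondecreasing_continuousP _ rcdf_homo) => e e0.
have e20 : 0 < e / 2 by lra.
have [v tv Fv] := rcdf_right t e20.
suff [u ut Fu] : exists2 u, u < t & rcdf t - rcdf u <= e / 2.
  by exists u, v; split => //; lra.
pose A n := [set w | t - n.+1%:R^-1 < W w] `&` [set w | W w <= t].
have mA n : measurable (A n).
  by apply: measurableI; [exact: measurable_RV_gt|exact: measurable_RV_le].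
have AE : \bigcap_n A n = W @^-1` [set t].
  apply/seteqP; split => w /=; last first.
    move=> Wt' n _; split => /=; rewrite Wt' ?lexx//.
    by rewrite ltrBlDr ltrDl invr_gt0.
  move=> h; apply/eqP; rewrite eq_le (h 0%N I).2/= leNgt; apply/negP => Wt'.
  have : 0 < t - W w by lra.
  move=> tW; set k := Num.truncn (t - W w)^-1.
  have := (h k I).1 => /=; apply/negP; rewrite -leNgt.
  rewrite lerBrDl -lerBrDr -[leRHS]invrK lef_pV2 ?posrE ?invr_gt0 ?subr_gt0//.
  by apply/ltW; rewrite /k truncnS_gt.
have mWt : measurable (W @^-1` [set t]).
  by rewrite -[X in measurable X]setTI; exact: measurable_funPT.
have PA : P (\bigcap_n A n) = 0%E.
  by rewrite AE -EFin_Pr//; congr _%:E; exact: Wt.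
have : (EFin \o (fun n => Pr P (A n))) n @[n --> \oo] --> P (\bigcap_n A n).
  rewrite (_ : EFin \o _ = P \o A); last first.
    by apply/funext => n /=; rewrite EFin_Pr.
  apply: nonincreasing_cvg_mu => //.
  - by rewrite (le_lt_trans (probability_le1 P (mA 0%N)))// ltry.
  - by rewrite AE.
  - move=> m n mn; apply/subsetPset => w [/= h1 h2]; split => //=.
    apply: le_lt_trans h1; rewrite lerB// lef_pV2 ?posrE//.
    by rewrite ler_nat.
rewrite PA => /fine_cvgP[_] /cvgn_distP /(_ _ e20)[N /(_ N (leqnn _))].
rewrite /= subr0 ger0_norm ?Pr_ge0// => AN.
exists (t - N.+1%:R^-1); first by rewrite ltrBlDr ltrDl invr_gt0.
have : rcdf t <= rcdf (t - N.+1%:R^-1) + Pr P (A N).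
  apply: (le_trans _ (Pr_setU _ _ _)) => //; last exact: measurable_RV_le.
  apply: le_Pr; first exact: measurable_RV_le.
    by apply: measurableU => //; exact: measurable_RV_le.
  move=> w /= Wt'; have [?|?] := leP (W w) (t - N.+1%:R^-1); [by left|by right; split].
lra.
Qed.

(** Discontinuities are atoms, atoms are countable, and a countable set has Lebesgue measure 0,
    unlike the interval. Convergence in distribution informs only at continuity points, so
    thresholds are moved to such points. *)
Lemma continuity_point_dense (a b : R) : a < b ->
  exists c, [/\ a < c, c < b & {for c, continuous rcdf}].
Proof.
move=> ab; apply: contrapT => H.
have sub : `]a, b[%classic `<=` [set r | 0 < pmf W r].
  move=> c /=; rewrite in_itv/= => /andP[ac cb].
  rewrite lt_neqAle pmf_ge0 andbT eq_sym; apply/negP => /eqP /pmf0_continuous cc.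
  by apply: H; exists c.
have := sub_countable (subset_card_le sub) (pmf_gt0_countable W).
move=> /countable_lebesgue_measure0; rewrite lebesgue_measure_itv/= lte_fin ab.
by rewrite -EFinB => -[] /eqP; rewrite subr_eq0 gt_eqF.
Qed.

(** If no such pair existed, F would jump from 0 to 1 at the infimum c of the points with F > 0, and
    W would equal c almost surely. The pair is then moved inward to continuity points, where both
    bounds can be transferred from a limit law to the converging laws. *)
Lemma non_degenerate_spread : non_degenerate W ->
  exists u v, [/\ u < v, 0 < rcdf u, rcdf v < 1,
    {for u, continuous rcdf} & {for v, continuous rcdf}].
Proof.
move=> ndW.
suff [u [v [uv Fu Fv]]] : exists u v, [/\ u < v, 0 < rcdf u & rcdf v < 1].
  have [u' [uu' u'm u'c]] := @continuity_point_dense u ((u + v) / 2) ltac:(lra).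
  have [v' [mv' v'v v'c]] := @continuity_point_dense ((u + v) / 2) v ltac:(lra).
  exists u', v'; split => //.
  - by lra.
  - by apply: lt_le_trans Fu _; apply/rcdf_homo/ltW.
  - by apply: le_lt_trans Fv; apply/rcdf_homo/ltW.
apply: contrapT => H; apply: ndW.
pose S := [set x | 0 < rcdf x].
have [M MP] := @rcdf_cvgy (1/2) ltac:(lra).
have [N NP] := @rcdf_cvgNy (1/2) ltac:(lra).
have [M1 M1P] := @rcdf_cvgNy (1/2) ltac:(lra).
have hS : has_inf S.
  split; first by exists M => /=; have := MP M (lexx _); rewrite /S/=; lra.
  apply: contrapT => nlb; apply: H.
  have [v Fv] : exists v, rcdf v < 1 by exists N; have := NP N (lexx _); lra.
  have [u Su uv] : exists2 u, S u & u < v.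
    apply: contrapT => h; apply: nlb; exists v => x Sx.
    by rewrite leNgt; apply/negP => xv; apply: h; exists x.
  by exists u, v.
pose c := inf S; exists c.
have Fgt (x : R) : c < x -> rcdf x = 1.
  move=> cx; have [u Su ux] := inf_adherent (eps := x - c) ltac:(lra) hS.
  apply/eqP; rewrite eq_le rcdf_le1/= leNgt; apply/negP => Fx.
  by apply: H; exists u, x; split => //; move: ux; rewrite -/c; lra.
have Flt (x : R) : x < c -> rcdf x = 0.
  move=> xc; apply/eqP; rewrite eq_le rcdf_ge0 andbT leNgt; apply/negP => Fx.
  have : c <= x by apply: ge_inf => //; exact: hS.2.
  lra.
have mc : measurable (W @^-1` [set c]).
  by rewrite -[X in measurable X]setTI; exact: measurable_funPT.
rewrite -EFin_Pr//; congr _%:E; apply/eqP; rewrite eq_le Pr_le1//=.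
have Fc : rcdf c = 1.
  apply/eqP; rewrite eq_le rcdf_le1 leNgt /=; apply/negP => Fc.
  have [v cv] := @rcdf_right c ((1 - rcdf c) / 2) ltac:(lra).
  rewrite (Fgt _ cv); lra.
have -> : W @^-1` [set c] = [set w | W w <= c] `&` ~` (\bigcup_n [set w | W w <= c - n.+1%:R^-1]).
  apply/seteqP; split => w /=.
    move=> Wc; rewrite Wc; split => // -[n _ /=]; rewrite Wc leNgt => /negP; apply.
    by rewrite ltrBlDr ltrDl invr_gt0.
  move=> [Wc h]; apply/eqP; rewrite eq_le Wc/= leNgt; apply/negP => Wc'.
  apply: h; exists (Num.truncn (c - W w)^-1) => //=.
  rewrite lerBrDl -lerBrDr -[leRHS]invrK lef_pV2 ?posrE ?invr_gt0 ?subr_gt0//.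
  by apply/ltW; rewrite truncnS_gt.
have mA n : measurable [set w | W w <= c - n.+1%:R^-1] by exact: measurable_RV_le.
have PA : P (\bigcup_n [set w | W w <= c - n.+1%:R^-1]) = 0%E.
  apply/eqP; rewrite eq_le measure_ge0 andbT.
  apply: le_trans (generalized_Boole_inequality _ mA _) _.
    exact: bigcup_measurable.
  rewrite eseries0// => n _ _; apply: (etrans (esym (EFin_Pr P (mA n)))).
  congr _%:E; apply: Flt.
  by rewrite ltrBlDr ltrDl invr_gt0.
apply: le_trans (Pr_setI _ _ _) => //; last first.
- by apply: measurableC; exact: bigcup_measurable.
- exact: measurable_RV_le.
rewrite setCK {2}/Pr PA/= Pr_setC; last exact: measurable_RV_le.
by rewrite -/(rcdf c) Fc; lra.
Qed.

End real_cdf.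

(** * Helly's selection theorem *)

Lemma increasing_seq_ge (phi : nat -> nat) (n : nat) :
  increasing_seq phi -> (n <= phi n)%N.
Proof.
move=> /increasing_seqP iphi; elim: n => // n IH.
by apply: leq_ltn_trans IH _; have := iphi n; rewrite ltEnat.
Qed.

Lemma increasing_seq_comp (phi psi : nat -> nat) :
  increasing_seq phi -> increasing_seq psi -> increasing_seq (phi \o psi).
Proof. by move=> iphi ipsi m n; apply: (etrans (iphi _ _)); exact: ipsi. Qed.

(** Typically turns the failure of an eventual bound into a subsequence: [p k n] is a violation at
    the k-th tolerance, available at arbitrarily large n. *)
Lemma increasing_subsequence (p : nat -> nat -> Prop) :
  (forall k N, exists2 n, (N <= n)%N & p k n) ->
  exists2 phi : nat -> nat, increasing_seq phi & forall k, p k (phi k).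
Proof.
move=> H; have H' (kN : nat * nat) : exists n, (kN.2 <= n)%N /\ p kN.1 n.
  by have [n ? ?] := H kN.1 kN.2; exists n.
have [f fP] := boolp.choice H'.
pose phi := fix phi k := if k is k'.+1 then f (k, (phi k').+1) else f (0, 0).
exists phi.
  by apply/increasing_seqP => k; rewrite ltEnat /=; have [] := fP (k.+1, (phi k).+1).
by case=> [|k]; [have [] := fP (0, 0)|have [] := fP (k.+1, (phi k).+1)].
Qed.

Lemma diagonal_subsequence (R : realType) (x : nat -> nat -> R) :
  (forall j k, `|x j k| <= 1) ->
  exists2 psi : nat -> nat, increasing_seq psi &
    forall j, cvgn (fun k => x j (psi k)).
Proof.
move=> x1.
have BW j (s : nat -> nat) : {f : nat -> nat | increasing_seq f /\ cvgn (fun k => x j (s (f k)))}.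
  apply: cid; have [|f incf cf] := @bolzano_weierstrass _ (fun k => x j (s k)).
    exists 1; split => // y y1 k _ /=.
    exact: le_trans (x1 _ _) (ltW y1).
  by exists f.
(* [sg j.+1] refines [sg j] by Bolzano-Weierstrass applied to [x j.+1], so x 0, ..., x j all
   converge along [sg j]; the diagonal is eventually a subsequence of each. *)
pose sg := fix sg j := if j is j'.+1 then sg j' \o sval (BW j (sg j')) else sval (BW 0 id).
have incsg j : increasing_seq (sg j).
  elim: j => [|j IH] /=; first by case: (svalP (BW 0 id)).
  by apply: increasing_seq_comp => //; case: (svalP (BW j.+1 (sg j))).
have sgS j k : exists2 m, (k <= m)%N & sg j.+1 k = sg j m.
  exists (sval (BW j.+1 (sg j)) k) => //.
  by apply: increasing_seq_ge; case: (svalP (BW j.+1 (sg j))).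
have sgD j i k : exists2 m, (k <= m)%N & sg (i + j)%N k = sg j m.
  elim: i k => [|i IH] k; first by exists k.
  rewrite addSn; have [m km ->] := sgS (i + j)%N k.
  by have [m' mm' ->] := IH m; exists m' => //; exact: leq_trans mm'.
exists (fun k => sg k k).
  apply/increasing_seqP => k; rewrite ltEnat /=.
  have [m km] := sgS k k.+1; rewrite /= => ->.
  by rewrite ltnNge; have := incsg k m k; rewrite !leEnat => ->; rewrite -ltnNge.
move=> j.
have /cvg_ex[l /cvgn_distP cl] : cvgn (fun k => x j (sg j k)).
  by case: j => [|j] /=; [case: (svalP (BW 0 id))|case: (svalP (BW j.+1 (sg j)))].
apply/cvg_ex; exists l; apply/cvgn_distP => e e0; have [N NP] := cl _ e0.
exists (maxn j N) => n; rewrite geq_max => /andP[jn Nn].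
rewrite -(subnK jn); have [m nm ->] := sgD j (n - j)%N (n - j + j)%N.
by apply: NP; rewrite (leq_trans Nn)// (leq_trans _ nm)// subnK.
Qed.

Section helly.
Variable R : realType.
Variable F : nat -> R -> R.
Hypothesis ndF : forall k, {homo F k : x y / x <= y}.
Hypothesis F_ge0 : forall k x, 0 <= F k x.
Hypothesis F_le1 : forall k x, F k x <= 1.
Hypothesis tightF : forall e, 0 < e -> exists M N, forall k, (N <= k)%N ->
  F k (- M) <= e /\ 1 - e <= F k M.

(** Convergence is arranged at the rationals by the diagonal argument. Mass could still escape to
    infinity and leave a defective limit; [tightF] prevents it and gives the limits 0 and 1. *)
Lemma helly_selection : exists2 psi : nat -> nat, increasing_seq psi &
  exists G : cumulativeBounded (0 : R) (1 : R),
  forall x, {for x, continuous G} -> F (psi k) x @[k --> \oo] --> G x.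
Proof.
pose q (j : nat) : R := ratr (odflt 0 (@choice.unpickle rat j)).
have [|psi incpsi cpsi] := @diagonal_subsequence _ (fun j k => F k (q j)).
  by move=> j k; rewrite ger0_norm.
exists psi => //.
have {}cpsi (r : rat) : exists l : R, F (psi k) (ratr r) @[k --> \oo] --> l.
  apply/cvg_ex; have := cpsi (choice.pickle r).
  by rewrite /q choice.pickleK.
have [g gP] := boolp.choice cpsi.
have gP' (r : rat) (e : R) : 0 < e -> exists N, forall k, (N <= k)%N -> `|F (psi k) (ratr r) - g r| <= e.
  by move=> e0; exact: (cvgn_distP _ _).1 (gP r) e e0.
have g_ge (c : R) r N : (forall k, (N <= k)%N -> c <= F (psi k) (ratr r)) -> c <= g r.
  move=> H; apply/ler_addgt0Pr => e e0; have [N' NP'] := gP' r e e0.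
  have := H (maxn N N') (leq_maxl _ _); have := NP' (maxn N N') (leq_maxr _ _).
  rewrite ler_norml => /andP[]; lra.
have g_le (c : R) r N : (forall k, (N <= k)%N -> F (psi k) (ratr r) <= c) -> g r <= c.
  move=> H; apply/ler_addgt0Pr => e e0; have [N' NP'] := gP' r e e0.
  have := H (maxn N N') (leq_maxl _ _); have := NP' (maxn N N') (leq_maxr _ _).
  rewrite ler_norml => /andP[]; lra.
have g0 r : 0 <= g r by apply: (g_ge _ _ 0%N).
have g1 r : g r <= 1 by apply: (g_le _ _ 0%N).
have g_homo r s : ratr r <= ratr s :> R -> g r <= g s.
  move=> rs; apply/ler_addgt0Pr => e e0; have [N NP] := gP' s e e0.
  apply: (g_le _ _ N) => k /NP; have := ndF (psi k) rs.
  rewrite ler_norml => ? /andP[]; lra.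
have ratP (x y : R) : x < y -> exists r : rat, x < ratr r /\ ratr r < y.
  by move=> /rat_in_itvoo[r]; rewrite in_itv => /andP[? ?]; exists r.
(* Taking only rationals strictly beyond x makes the infimum right-continuous. *)
pose S (x : R) := [set g r | r in [set r : rat | x < ratr r]].
have S_inf x : has_inf (S x).
  split; last by exists 0 => _ [r _ <-].
  have [r [xr _]] := @ratP x (x + 1) ltac:(lra).
  by exists (g r); exists r.
pose G x := inf (S x).
have G_le x r : x < ratr r -> G x <= g r.
  by move=> xr; apply: ge_inf; [exact: (S_inf x).2|exists r].
have G_ge x c : (forall r, x < ratr r -> c <= g r) -> c <= G x.
  by move=> H; apply: lb_le_inf; [exact: (S_inf x).1|move=> _ [r xr <-]; exact: H].
have G_ge' x r : ratr r <= x -> g r <= G x.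
  by move=> rx; apply: G_ge => s xs; apply/g_homo/ltW/(le_lt_trans rx).
have ndG : {homo G : x y / x <= y}.
  by move=> x y xy; apply: G_ge => r yr; apply: G_le; exact: le_lt_trans yr.
have rcG : right_continuous G.
  move=> x; apply/cvgrPdist_le => e e0.
  have [_ [r /= xr <-] gr] := inf_adherent e0 (S_inf x).
  near=> y.
  have xy : x <= y by near: y; exact: nbhs_right_ge.
  have yr : y < ratr r by near: y; exact: nbhs_right_lt.
  have := ndG _ _ xy; have := G_le _ _ yr; rewrite -/(G x) in gr.
  by move=> ? ?; rewrite ler_norml; apply/andP; split; lra.
have tight' (e : R) : 0 < e -> exists M, forall x, (x <= - M -> G x <= e) /\ (M <= x -> 1 - e <= G x).
  move=> e0; have [M [N MNP]] := tightF e0.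
  exists (`|M| + 1) => x; split => hx.
    have [r [xr rM]] := @ratP x (- `|M|) ltac:(lra).
    apply: le_trans (G_le _ _ xr) _; apply: (g_le _ _ N) => k Nk.
    have [h _] := MNP (psi k) (leq_trans Nk (increasing_seq_ge _ incpsi)).
    apply: le_trans (ndF _ _) h; apply/ltW/(lt_le_trans rM).
    by rewrite lerN2 ler_norm.
  have [r [xr rM]] := @ratP `|M| x ltac:(lra).
  apply: le_trans (G_ge' _ _ (ltW rM)); apply: (g_ge _ _ N) => k Nk.
  have [_ h] := MNP (psi k) (leq_trans Nk (increasing_seq_ge _ incpsi)).
  apply: le_trans h _; apply: ndF; apply/ltW/(le_lt_trans _ xr).
  exact: ler_norm.
have G0 x : 0 <= G x by apply: G_ge.
have G1 x : G x <= 1.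
  by have [r [xr _]] := @ratP x (x + 1) ltac:(lra); apply: le_trans (G_le _ _ xr) _.
have GNy : G @ -oo --> (0 : R).
  apply/cvgrPdist_le => e e0; have [M MP] := tight' _ e0.
  exists (- M); split; first exact: num_real.
  move=> x /ltW xM /=; rewrite sub0r normrN ger0_norm//.
  exact: (MP x).1.
have Gy : G @ +oo --> (1 : R).
  apply/cvgrPdist_le => e e0; have [M MP] := tight' _ e0.
  exists M; split; first exact: num_real.
  move=> x /ltW xM /=; rewrite ger0_norm ?subr_ge0//.
  have := (MP x).2 xM; lra.
pose m1 := isCumulative.Build R _ R G ndG rcG.
pose m2 := isCumulativeBounded.Build R 0 1 G GNy Gy.
pose GG : cumulativeBounded (0 : R) (1 : R) := HB.pack G m1 m2.
exists GG => x cG; apply/cvgn_distP => e e0.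
have [u [v [ux xv Guv]]] := (@nondecreasing_continuousP _ G x ndG).1 cG (e / 2) ltac:(lra).
have [r [ur rx]] := ratP _ _ ux; have [s [xs sv]] := ratP _ _ xv.
have [N1 N1P] := gP' r (e / 2) ltac:(lra); have [N2 N2P] := gP' s (e / 2) ltac:(lra).
exists (maxn N1 N2) => k; rewrite geq_max => /andP[/N1P + /N2P].
have := ndF (psi k) (ltW rx); have := ndF (psi k) (ltW xs).
have := G_le _ _ ur; have := G_ge' _ _ (ltW sv); have := G_ge' _ _ (ltW rx); have := G_le _ _ xs.
rewrite !ler_norml => ? ? ? ? ? ? /andP[? ?] /andP[? ?].
change (GG x) with (G x); apply/andP; split; lra.
Unshelve. all: by end_near. Qed.
End helly.

Section cumulative_RV.
Variable R : realType.
Local Open Scope measure_display_scope.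

(** With [W] the identity, [P] itself is the law of [W], so a map of the line whose values have this
    law preserves [P]. The splitting of a uniform variable relies on it. *)
Lemma exists_cumulative_RV (G : cumulativeBounded (0 : R) (1 : R)) :
  exists (P : probability (measurableTypeR R) R) (W : {RV P >-> R}),
  rcdf W = G /\ W =1 idfun.
Proof.
pose W0 : measurableTypeR R -> R := idfun.
pose mW := @isMeasurableFun.Build _ _ _ _ W0 (@measurable_id _ _ setT).
pose W : {mfun measurableTypeR R >-> R} := HB.pack W0 mW.
exists (lebesgue_stieltjes_measure G), W; split => //.
apply/funext => x; apply/EFin_inj; rewrite -cdf_rcdf.
exact: (cdf_lebesgue_stieltjes_id G).
Qed.

End cumulative_RV.

Section helly_RV.
Context d (T : measurableType d) (R : realType) (P : probability T R).

Lemma helly_RV (U : nat -> {RV P >-> R}) :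
  (forall e, 0 < e -> exists M N, forall k, (N <= k)%N ->
    rcdf (U k) (- M) <= e /\ 1 - e <= rcdf (U k) M) ->
  exists2 psi : nat -> nat, increasing_seq psi &
    exists d2 (T2 : measurableType d2) (Q : probability T2 R) (W : {RV Q >-> R}),
    cvg_in_distribution (fun k => U (psi k)) W.
Proof.
move=> tU; have [|||] := @helly_selection _ (fun k => rcdf (U k)) _ _ _ tU.
- by move=> k; exact: rcdf_homo.
- by move=> k x; exact: rcdf_ge0.
- by move=> k x; exact: rcdf_le1.
move=> psi incpsi [G GP]; exists psi => //.
have [Q [W [WG _]]] := exists_cumulative_RV G.
exists _, _, Q, W => x cW; under eq_fun do rewrite cdf_rcdf.
rewrite cdf_rcdf WG; apply: cvg_EFin; first exact: nearW.
by apply: GP; move/cdf_continuousP : cW; rewrite WG.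
Qed.

End helly_RV.

Lemma cvg_in_distributionP d (T : measurableType d) d' (T' : measurableType d')
    (R : realType) (P : probability T R) (Q : probability T' R)
    (U : nat -> {RV P >-> R}) (W : {RV Q >-> R}) (x e : R) :
  cvg_in_distribution U W -> {for x, continuous (rcdf W)} -> 0 < e ->
  exists N, forall k, (N <= k)%N -> `|rcdf (U k) x - rcdf W x| <= e.
Proof.
move=> UW /cdf_continuousP /UW; under eq_fun do rewrite cdf_rcdf.
rewrite cdf_rcdf => /fine_cvgP[_] /cvgn_distP h e0; exact: h.
Qed.

(** * Products and independence *)

Section product_preimages.
Context d1 d2 (T1 : measurableType d1) (T2 : measurableType d2).

Lemma measurable_preimage_fst (A : set T1) : measurable A ->
  measurable (fst @^-1` A : set (T1 * T2)).
Proof. by move=> mA; rewrite -[X in measurable X]setTI; exact: measurable_fst. Qed.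

Lemma measurable_preimage_snd (A : set T2) : measurable A ->
  measurable (snd @^-1` A : set (T1 * T2)).
Proof. by move=> mA; rewrite -[X in measurable X]setTI; exact: measurable_snd. Qed.

Lemma bdd_fst (R : realType) (f : T1 -> R) : bounded_measurable f ->
  bounded_measurable (fun z : T1 * T2 => f z.1).
Proof.
move=> [mf [M MP]]; split; last by exists M => z; exact: MP.
exact: (measurableT_comp mf measurable_fst).
Qed.

Lemma bdd_snd (R : realType) (f : T2 -> R) : bounded_measurable f ->
  bounded_measurable (fun z : T1 * T2 => f z.2).
Proof.
move=> [mf [M MP]]; split; last by exists M => z; exact: MP.
exact: (measurableT_comp mf measurable_snd).
Qed.

End product_preimages.

Section product_expectation.
Context d1 d2 (T1 : measurableType d1) (T2 : measurableType d2) (R : realType).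
Variables (P1 : probability T1 R) (P2 : probability T2 R).

Lemma Ex_prod (a : T1 -> R) (b : T2 -> R) :
  bounded_measurable a -> bounded_measurable b ->
  Ex (P1 \x P2)%E (fun z => a z.1 * b z.2) = Ex P1 a * Ex P2 b.
Proof.
move=> ba bb.
have bab : bounded_measurable (fun z : T1 * T2 => a z.1 * b z.2).
  by apply: bddM; [exact: bdd_fst|exact: bdd_snd].
rewrite /Ex /Rintegral -(integral12_prod_meas1 (bdd_integrable (P1 \x P2)%E bab)).
have Fx x : (fubini_F P2 (EFin \o (fun z : T1 * T2 => (a z.1 * b z.2)%R)) x =
    (a x)%:E * \int[P2]_y (b y)%:E)%E.
  rewrite /fubini_F/= -integralZl//; last exact: (bdd_integrable P2 bb).
transitivity (fine (\int[P1]_x ((a x)%:E * \int[P2]_y (b y)%:E))%E).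
  by congr fine; apply: eq_integral => x _; exact: Fx.
have -> : (\int[P2]_y (b y)%:E)%E = (Ex P2 b)%:E.
  by rewrite /Ex /Rintegral fineK//; apply: integrable_fin_num => //; exact: bdd_integrable.
rewrite integralZr//; last exact: (bdd_integrable P1 ba).
rewrite fineM//; first by apply: integrable_fin_num => //; exact: bdd_integrable.
Qed.

Lemma Pr_prod (A : set T1) (B : set T2) : measurable A -> measurable B ->
  Pr (P1 \x P2)%E (A `*` B) = Pr P1 A * Pr P2 B.
Proof.
move=> mA mB; apply/EFin_inj; rewrite EFinM !EFin_Pr//.
  exact: product_measure1E.
exact: measurableX.
Qed.

Lemma Pr_prod_fst (A : set T1) : measurable A ->
  Pr (P1 \x P2)%E (fst @^-1` A) = Pr P1 A.
Proof.
move=> mA; rewrite -[RHS]mulr1 -(Pr_setT P2) -Pr_prod//.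
by congr Pr; apply/seteqP; split => -[x y] //= [].
Qed.

Lemma Pr_prod_snd (B : set T2) : measurable B ->
  Pr (P1 \x P2)%E (snd @^-1` B) = Pr P2 B.
Proof.
move=> mB; rewrite -[RHS]mul1r -(Pr_setT P1) -Pr_prod//.
by congr Pr; apply/seteqP; split => -[x y] //= [].
Qed.

(** Conditioning on the second coordinate: a bound valid for each fixed value of it survives
    integration. *)
Lemma Pr_prod_section (A : set (T1 * T2)) (c : R) : measurable A -> 0 <= c ->
  (forall y, Pr P1 (ysection A y) <= c) -> Pr (P1 \x P2)%E A <= c.
Proof.
move=> mA c0 H; rewrite -lee_fin EFin_Pr//.
apply: (@le_trans _ _ ((P1 \x^ P2)%E A)).
  rewrite le_eqVlt; apply/orP; left; apply/eqP.
  by apply: product_measure_unique => // X Y mX mY; exact: product_measure2E.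
rewrite /product_measure2.
have -> : c%:E = (\int[P2]_y c%:E)%E.
  rewrite integral_cst//; transitivity (c%:E * P2 setT)%E => //.
  by rewrite probability_setT mule1.
apply: ge0_le_integral => //.
- exact: measurable_fun_ysection.
- by move=> y _ /=; rewrite -EFin_Pr ?lee_fin//; exact: measurable_ysection.
Qed.

End product_expectation.

Lemma Ex_distribution d (T : measurableType d) d' (T' : measurableType d') (R : realType)
    (P : probability T R) (W : {mfun T >-> T'}) (k : T' -> R) : bounded_measurable k ->
  Ex P (k \o W) = Ex (distribution P W) k.
Proof.
move=> [mk [M MP]]; rewrite /Ex /Rintegral; congr fine.
rewrite (integral_distribution (X := W) (f := EFin \o k))//; first exact/measurable_EFinP.
apply: (@bdd_integrable _ _ _ P (k \o W)); split; last by exists M => x; exact: MP.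
exact: measurableT_comp.
Qed.

Section independent_pair.
Context d (T : measurableType d) (R : realType) (P : probability T R).

Lemma Ex_independent (U V : {RV P >-> R}) (f g : R -> R) :
  (forall A B, measurable A -> measurable B ->
     Pr P (U @^-1` A `&` V @^-1` B) = Pr P (U @^-1` A) * Pr P (V @^-1` B)) ->
  bounded_measurable f -> bounded_measurable g ->
  Ex P (fun w => f (U w) * g (V w)) = Ex P (f \o U) * Ex P (g \o V).
Proof.
move=> UV bf bg.
pose h w := (U w, V w).
have mh : measurable_fun [set: T] h by apply/measurable_fun_pairP; split; exact: measurable_funPT.
pose mH := @isMeasurableFun.Build _ _ _ _ h mh.
pose H : {mfun T >-> (R * R)%type} := HB.pack h mH.
rewrite !Ex_distribution// -Ex_prod//.
have bfg : bounded_measurable (fun z : R * R => f z.1 * g z.2).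
  by apply: bddM; [exact: bdd_fst|exact: bdd_snd].
transitivity (Ex (distribution P H) (fun z => f z.1 * g z.2)).
  exact: (Ex_distribution P H bfg).
rewrite /Ex /Rintegral; congr fine; apply/esym/eq_measure_integral => A mA _.
apply: product_measure_unique => // X Y mX mY.
rewrite /distribution /pushforward.
have mUX : measurable (U @^-1` X) by rewrite -[X in measurable X]setTI; exact: measurable_funPT.
have mVY : measurable (V @^-1` Y) by rewrite -[X in measurable X]setTI; exact: measurable_funPT.
change (P (U @^-1` X `&` V @^-1` Y) = P (U @^-1` X) * P (V @^-1` Y))%E.
rewrite -!EFin_Pr//; last exact: measurableI.
by rewrite -EFinM -UV.
Qed.

End independent_pair.

Section same_law.
Context d (T : measurableType d) d' (T' : measurableType d') (R : realType).
Variables (P : probability T R) (P' : probability T' R).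

Lemma same_distribution_Ex (U : {RV P >-> R}) (V : {RV P' >-> R}) (f : R -> R) :
  same_distribution U V -> bounded_measurable f ->
  Ex P (f \o U) = Ex P' (f \o V).
Proof.
move=> UV bk.
rewrite !Ex_distribution// /Ex /Rintegral; congr fine; apply: eq_measure_integral => A mA _.
exact: UV.
Qed.

Lemma same_distribution_Pr (U : {RV P >-> R}) (V : {RV P' >-> R}) (A : set R) :
  same_distribution U V -> measurable A ->
  Pr P (U @^-1` A) = Pr P' (V @^-1` A).
Proof. by move=> UV mA; rewrite /Pr; congr fine; exact: UV. Qed.

(** Boxes form a pi-system generating the sigma-algebra of tuples, so Dynkin's theorem carries every
    event about n variables from one probability space to another. *)
Lemma tuple_law n (U : 'I_n -> {RV P >-> R}) (V : 'I_n -> {RV P' >-> R}) :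
  (forall A : 'I_n -> set R, (forall i, measurable (A i)) ->
    Pr P (\bigcap_i (U i @^-1` A i)) = Pr P' (\bigcap_i (V i @^-1` A i))) ->
  forall B : set (n.-tuple R), measurable B ->
  Pr P [set w | B [tuple U i w | i < n]] = Pr P' [set w | B [tuple V i w | i < n]].
Proof.
move=> UV B mB.
have mt d0 (T0 : measurableType d0) (P0 : probability T0 R) (W : 'I_n -> {RV P0 >-> R}) :
    measurable_fun [set: T0] (fun w => [tuple W i w | i < n]).
  apply/measurable_fun_tnthP => i /=.
  rewrite (_ : _ \o _ = W i); first exact: measurable_funPT.
  by apply/funext => w /=; rewrite tnth_mktuple.
have mBU d0 (T0 : measurableType d0) (P0 : probability T0 R) (W : 'I_n -> {RV P0 >-> R}) C :
    measurable C -> measurable [set w | C [tuple W i w | i < n]].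
  by move=> mC; rewrite -[X in measurable X]setTI; exact: mt.
pose G : set (set (n.-tuple R)) :=
  [set C | exists2 A : 'I_n -> set R, (forall i, measurable (A i)) &
           C = \bigcap_i [set t | A i (tnth t i)]].
have GE : @measurable _ (n.-tuple R) = <<s G >>.
  apply/seteqP; split.
    apply: smallest_sub; first exact: smallest_sigma_algebra.
    move=> C; rewrite -bigcup_seq => -[i /= _ [A mA <-]].
    apply: sub_sigma_algebra; exists (fun j => if j == i then A else setT).
      by move=> j; case: ifP.
    apply/seteqP; split => t /=.
      by move=> [_ At] j _; case: ifP => // /eqP ->.
    by move=> /(_ i I); rewrite eqxx.
  apply: smallest_sub; first exact: sigma_algebra_measurable.
  move=> _ [A mA ->]; apply: fin_bigcap_measurable => // i _.
  rewrite -[X in measurable X]setTI; exact: measurable_tnth.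
apply: (@dynkin_induction _ _ G (fun C => Pr P [set w | C [tuple U i w | i < n]] =
   Pr P' [set w | C [tuple V i w | i < n]])) => //.
- move=> _ _ [A mA ->] [A' mA' ->]; exists (fun i => A i `&` A' i).
    by move=> i; exact: measurableI.
  apply/seteqP; split => t /= h; first by move=> i _; split; [exact: h.1|exact: h.2].
  by split => i _; have [] := h i I.
- by rewrite !Pr_setT.
- move=> _ [A mA ->].
  have E d0 (T0 : measurableType d0) (P0 : probability T0 R) (W : 'I_n -> {RV P0 >-> R}) :
    [set w | (\bigcap_i [set t | A i (tnth t i)]) [tuple W i w | i < n]] = \bigcap_i (W i @^-1` A i).
    by apply/seteqP; split => w /= h i _; have := h i I; rewrite /= tnth_mktuple.
  by rewrite !E; exact: UV.
- move=> C mC HC.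
  rewrite -[[set w | (~` C) _]]/(~` [set w | C [tuple U i w | i < n]]) Pr_setC; last exact: mBU.
  by rewrite HC -Pr_setC//; exact: mBU.
- move=> F mF tF HF.
  have E d0 (T0 : measurableType d0) (P0 : probability T0 R) (W : 'I_n -> {RV P0 >-> R}) :
     Pr P0 [set w | (\bigcup_k F k) [tuple W i w | i < n]] =
     fine (\sum_(k <oo) (Pr P0 [set w | F k [tuple W i w | i < n]])%:E)%E.
    rewrite /Pr; congr fine.
    rewrite (_ : [set w | _] = \bigcup_k [set w | F k [tuple W i w | i < n]]); last first.
      by apply/seteqP; split => w [k _ h]; exists k.
    rewrite measure_bigcup//=.
    + rewrite (eq_eseriesl (Q := xpredT)); last by move=> k; rewrite in_setT.
      by apply: eq_eseriesr => k _; rewrite fineK//; apply: fin_num_measure; exact: mBU.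
    + by move=> k _; exact: mBU.
    + by move=> j k _ _ [w [/= h1 h2]]; apply: tF => //; eexists; split; [exact: h1|exact: h2].
  by rewrite !E; congr fine; apply: eq_eseriesr => k _; rewrite HF.
- by rewrite -GE.
Qed.

End same_law.

Lemma measurable_RV_preimage d (T : measurableType d) (R : realType)
    (P : probability T R) (X : {RV P >-> R}) (A : set R) :
  measurable A -> measurable (X @^-1` A).
Proof. by move=> mA; rewrite -[X in measurable X]setTI; exact: measurable_funPT. Qed.

Section mutual_independence.
Context d (T : measurableType d) (R : realType) (P : probability T R).
Implicit Types Z : nat -> {RV P >-> R}.

Definition cylinder Z (n : nat) (A : nat -> set R) : set T :=
  \bigcap_(i in `I_n) (Z i @^-1` A i).

Lemma measurable_cylinder Z n A : (forall i, measurable (A i)) ->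
  measurable (cylinder Z n A).
Proof.
move=> mA; apply: bigcap_measurableType => // i _; exact: measurable_RV_preimage.
Qed.

Lemma prod_Pr_EFin (I : Type) (r : seq I) (F : I -> set T) :
  (forall i, measurable (F i)) ->
  (\prod_(i <- r) P (F i))%E = (\prod_(i <- r) Pr P (F i))%:E.
Proof.
move=> mF; elim: r => [|i r IH]; first by rewrite !big_nil.
by rewrite !big_cons IH EFinM EFin_Pr.
Qed.

Lemma mutually_independent_cylinder Z n A : mutually_independent Z ->
  (forall i, measurable (A i)) ->
  Pr P (cylinder Z n A) = \prod_(i < n) Pr P (Z i @^-1` A i).
Proof.
move=> iZ mA; pose J : {fset nat} := [fset i | i in iota 0 n]%fset.
have memJ i : (i \in J) = (i < n)%N.
  by rewrite !inE /= mem_iota.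
have := iZ J A mA.
rewrite prod_Pr_EFin; last by move=> i; exact: measurable_RV_preimage.
rewrite (_ : \bigcap_(i in [set` J]) _ = cylinder Z n A); last first.
  by rewrite /cylinder; congr bigcap; apply/seteqP; split => i /=; rewrite memJ.
rewrite -EFin_Pr; last exact: measurable_cylinder.
move=> -[->]; rewrite -(big_mkord xpredT (fun i => Pr P (Z i @^-1` A i))).
apply: perm_big; apply: uniq_perm; [exact: fset_uniq|exact: iota_uniq|].
by move=> i; rewrite memJ mem_index_iota.
Qed.

(** Lengths of the form [f n] suffice because a finite family of constraints can be padded with the
    full line. Interleaved sequences are checked at even lengths only, iterates at all lengths. *)
Lemma cylinder_mutually_independent Z (f : nat -> nat) : (forall n, (n <= f n)%N) ->
  (forall n A, (forall i, measurable (A i)) ->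
     Pr P (cylinder Z (f n) A) = \prod_(i < f n) Pr P (Z i @^-1` A i)) ->
  mutually_independent Z.
Proof.
move=> nf H J A mA.
rewrite prod_Pr_EFin; last by move=> i; exact: measurable_RV_preimage.
pose n := (\max_(i <- J) i).+1.
pose A' i := if i \in J then A i else setT.
have mA' i : measurable (A' i) by rewrite /A'; case: ifP.
have Jn i : i \in J -> (i < f n)%N.
  move=> iJ; apply: leq_trans (nf n); rewrite /n ltnS.
  by rewrite (big_rem i)//= leq_maxl.
rewrite (_ : \bigcap_(i in [set` J]) _ = cylinder Z (f n) A'); last first.
  apply/seteqP; split => w h i /= iJ.
    by rewrite /A'; case: ifP => // iJ'; exact: (h i).
  by have := h i (Jn _ iJ); rewrite /A' /= iJ.
rewrite -EFin_Pr; last exact: measurable_cylinder.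
congr EFin; rewrite H//.
rewrite (bigID (fun i : 'I__ => (i : nat) \in J))/= [X in _ * X]big1 ?mulr1; last first.
  by move=> i /negbTE iJ; rewrite /A' iJ preimage_setT Pr_setT.
rewrite -(big_mkord (fun i => i \in J) (fun i => Pr P (Z i @^-1` A' i))) -big_filter.
rewrite (perm_big J)/=; first by apply: eq_big_seq => i iJ; rewrite /A' iJ.
apply: uniq_perm; [by rewrite filter_uniq// iota_uniq|exact: fset_uniq|].
move=> i; rewrite mem_filter mem_index_iota /=.
by case: (boolP (i \in J)) => //= /Jn ->.
Qed.

Lemma mutually_independent_inj Z (s : nat -> nat) : injective s ->
  mutually_independent Z -> mutually_independent (Z \o s).
Proof.
move=> injs iZ J A mA.
(* By injectivity this is [A i] when k = s i. Outside the range of s the family is empty and the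
   intersection is the full line. *)
pose A' k := \bigcap_(i in [set i | s i = k]) A i.
have sI i : A' (s i) = A i.
  by apply/seteqP; split => x /=; [apply|move=> Ax j /injs ->].
have mA' k : measurable (A' k) by apply: bigcap_measurableType.
have := iZ [fset s i | i in J]%fset A' mA'.
rewrite big_imfset/=; last by move=> x y _ _; exact: injs.
under eq_bigr do rewrite sI.
move=> <-; congr (P _); apply/seteqP; split => w h.
  by move=> _ /= /imfsetP[i /= iJ ->]; rewrite sI; exact: h.
move=> i iJ; rewrite /= -(sI i); apply: h => /=.
by apply/imfsetP; exists i.
Qed.

Lemma mutually_independent_pair Z i j A B : mutually_independent Z -> i != j ->
  measurable A -> measurable B ->
  Pr P (Z i @^-1` A `&` Z j @^-1` B) = Pr P (Z i @^-1` A) * Pr P (Z j @^-1` B).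
Proof.
move=> iZ ij mA mB.
pose A' k := if k == i then A else B.
have mA' k : measurable (A' k) by rewrite /A'; case: ifP.
have := iZ [fset i; j]%fset A' mA'.
rewrite prod_Pr_EFin; last by move=> k; exact: measurable_RV_preimage.
rewrite (perm_big [:: i; j])/=; last first.
  apply: uniq_perm; [exact: fset_uniq|by rewrite /= inE ij|].
  by move=> k; rewrite !inE.
rewrite big_cons big_seq1 /A' eqxx eq_sym (negbTE ij).
move=> h; apply/EFin_inj; rewrite -h EFin_Pr; last first.
  by apply: measurableI; exact: measurable_RV_preimage.
congr (P _); apply/seteqP; split => w /=.
  by move=> [wA wB] k /=; rewrite !inE => /orP[|] /eqP ->; rewrite ?eqxx// eq_sym (negbTE ij).
move=> hw; split; first by have := hw i; rewrite /= !inE !eqxx; exact.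
by have := hw j; rewrite /= !inE eqxx orbT eq_sym (negbTE ij); exact.
Qed.

Lemma mutually_independent_Ex Z i j f g : mutually_independent Z -> i != j ->
  bounded_measurable f -> bounded_measurable g ->
  Ex P (fun w => f (Z i w) * g (Z j w)) = Ex P (f \o Z i) * Ex P (g \o Z j).
Proof.
move=> iZ ij bf bg; apply: Ex_independent => // A B mA mB.
exact: mutually_independent_pair.
Qed.

End mutual_independence.

Lemma measurable_nth_tuple (R : realType) n k :
  measurable_fun [set: n.-tuple R] (fun t : n.-tuple R => nth 0 t k).
Proof.
have [kn|nk] := ltnP k n.
  rewrite (_ : (fun _ => _) = (@tnth _ R ^~ (Ordinal kn))).
    exact: measurable_tnth.
  by apply/funext => t; rewrite (tnth_nth 0).
rewrite (_ : (fun _ => _) = (fun=> 0)); first exact: measurable_cst.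
by apply/funext => t; rewrite nth_default// size_tuple.
Qed.

Lemma nth_sequence_tuple (R : realType) (T : Type) (U : nat -> T -> R) n w k :
  (k < n)%N -> nth 0 [tuple U i w | i < n] k = U k w.
Proof. by move=> kn; rewrite -(tnth_nth 0 _ (Ordinal kn)) tnth_mktuple. Qed.

Section sequence_law.
Context d (T : measurableType d) d' (T' : measurableType d') (R : realType).
Variables (P : probability T R) (P' : probability T' R).

Lemma sequence_law n (U : nat -> {RV P >-> R}) (V : nat -> {RV P' >-> R}) :
  (forall A, (forall i, measurable (A i)) ->
    Pr P (cylinder U n A) = Pr P' (cylinder V n A)) ->
  forall B : set (n.-tuple R), measurable B ->
  Pr P [set w | B [tuple U i w | i < n]] = Pr P' [set w | B [tuple V i w | i < n]].
Proof.
move=> UV; apply: (@tuple_law _ _ _ _ _ _ _ _ (fun i : 'I_n => U i) (fun i : 'I_n => V i)).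
move=> A mA; pose A' k := if insub k is Some i then A i else setT.
have mA' k : measurable (A' k) by rewrite /A'; case: insubP.
have E d0 (T0 : measurableType d0) (P0 : probability T0 R) (W : nat -> {RV P0 >-> R}) :
    \bigcap_(i : 'I_n) (W i @^-1` A i) = cylinder W n A'.
  apply/seteqP; split => w h i /= ni.
    by rewrite /A' (insubT (fun k => k < n)%N ni) /=; exact: (h (Ordinal ni)).
  by have := h i (ltn_ord i); rewrite /A' /= valK.
by rewrite !E; exact: UV.
Qed.

Lemma iid_law n d1 (T1 : measurableType d1)
    (P1 : probability T1 R) (U : nat -> {RV P >-> R}) (V : nat -> {RV P' >-> R})
    (X : {RV P1 >-> R}) :
  iid_copies U X -> iid_copies V X ->
  forall B : set (n.-tuple R), measurable B ->
  Pr P [set w | B [tuple U i w | i < n]] = Pr P' [set w | B [tuple V i w | i < n]].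
Proof.
move=> [iU UX] [iV VX]; apply: sequence_law => A mA.
rewrite !mutually_independent_cylinder//; apply: eq_bigr => i _.
by rewrite (same_distribution_Pr (UX i))// (same_distribution_Pr (VX i)).
Qed.

End sequence_law.

Section interleave.
Context d1 (T1 : measurableType d1) d2 (T2 : measurableType d2) (R : realType).
Variables (P1 : probability T1 R) (P2 : probability T2 R).
Variables (U : nat -> {RV P1 >-> R}) (V : nat -> {RV P2 >-> R}).

Definition lift_fst (X : {RV P1 >-> R}) : T1 * T2 -> R := X \o fst.
Definition lift_snd (Y : {RV P2 >-> R}) : T1 * T2 -> R := Y \o snd.

Lemma measurable_lift_fst X : measurable_fun [set: T1 * T2] (lift_fst X).
Proof. by apply: measurableT_comp => //; exact: measurable_funPT. Qed.

Lemma measurable_lift_snd X : measurable_fun [set: T1 * T2] (lift_snd X).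
Proof. by apply: measurableT_comp => //; exact: measurable_funPT. Qed.

HB.instance Definition _ X :=
  isMeasurableFun.Build _ _ _ _ (lift_fst X) (measurable_lift_fst X).
HB.instance Definition _ X :=
  isMeasurableFun.Build _ _ _ _ (lift_snd X) (measurable_lift_snd X).

(** Codes a pair of sequences on a product space as a single sequence, so that results on the law of
    one sequence cover joint laws. Entries 2i and 2i+1 form the i-th pair. *)
Definition interleave (k : nat) : {RV (P1 \x P2)%E >-> R} :=
  if odd k then (lift_snd (V k./2) : {RV (P1 \x P2)%E >-> R})
  else (lift_fst (U k./2) : {RV (P1 \x P2)%E >-> R}).

Lemma Pr_cylinder_interleave n A : (forall i, measurable (A i)) ->
  Pr (P1 \x P2)%E (cylinder interleave n.*2 A) =
  Pr P1 (cylinder U n (fun i => A i.*2)) * Pr P2 (cylinder V n (fun i => A i.*2.+1)).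
Proof.
move=> mA; rewrite -Pr_prod; do ?exact: measurable_cylinder.
congr Pr; apply/seteqP; split => -[w1 w2] /=.
  move=> h; split => i /= ni.
    by have := h i.*2; rewrite /interleave /= odd_double doubleK ltn_double; exact.
  have := h i.*2.+1; rewrite /interleave /= odd_double /= uphalf_double ltn_Sdouble; exact.
move=> [h1 h2] k /= kn; rewrite /interleave; case: ifPn => ok /=.
  have := h2 k./2; rewrite /=.
  by have <- : (k./2).*2.+1 = k; [rewrite -[RHS]odd_double_half ok|rewrite /= uphalf_double; apply; lia].
have := h1 k./2; rewrite /=.
by have <- : (k./2).*2 = k; [rewrite -[RHS]odd_double_half (negbTE ok)|rewrite /= doubleK; apply; lia].
Qed.

End interleave.

Section interleave_law.
Context d1 (T1 : measurableType d1) d2 (T2 : measurableType d2) (R : realType).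
Variables (P1 : probability T1 R) (P2 : probability T2 R).
Variables (U : nat -> {RV P1 >-> R}) (V : nat -> {RV P2 >-> R}).

Lemma Pr_interleave_even i A : measurable A ->
  Pr (P1 \x P2)%E (interleave U V i.*2 @^-1` A) = Pr P1 (U i @^-1` A).
Proof.
move=> mA; rewrite -(Pr_prod_fst P1 P2); last exact: measurable_RV_preimage.
by rewrite /interleave odd_double doubleK.
Qed.

Lemma Pr_interleave_odd i A : measurable A ->
  Pr (P1 \x P2)%E (interleave U V i.*2.+1 @^-1` A) = Pr P2 (V i @^-1` A).
Proof.
move=> mA; rewrite -(Pr_prod_snd P1 P2); last exact: measurable_RV_preimage.
by rewrite /interleave /= odd_double /= uphalf_double.
Qed.

Lemma prod_double (F : nat -> R) n :
  \prod_(i < n.*2) F i = (\prod_(i < n) F i.*2) * (\prod_(i < n) F i.*2.+1).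
Proof.
elim: n => [|n IH]; first by rewrite !big_ord0 mulr1.
by rewrite doubleS !big_ord_recr/= IH; ring.
Qed.

Lemma iid_interleave d0 (T0 : measurableType d0) (P0 : probability T0 R)
    (X : {RV P0 >-> R}) :
  iid_copies U X -> iid_copies V X -> iid_copies (interleave U V) X.
Proof.
move=> [iU UX] [iV VX]; split.
  apply: (@cylinder_mutually_independent _ _ _ _ _ double).
    by move=> n; rewrite -addnn leq_addr.
  move=> n A mA; rewrite Pr_cylinder_interleave// !mutually_independent_cylinder//.
  rewrite (prod_double (fun k => Pr _ (interleave U V k @^-1` A k))); congr (_ * _).
    by apply: eq_bigr => i _; rewrite Pr_interleave_even.
  by apply: eq_bigr => i _; rewrite Pr_interleave_odd.
move=> k A mA; rewrite /distribution /pushforward.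
rewrite -!EFin_Pr; do ?exact: measurable_RV_preimage.
congr EFin; rewrite -(odd_double_half k); case: (odd k) => /=.
  by rewrite add1n Pr_interleave_odd//; exact: same_distribution_Pr.
by rewrite add0n Pr_interleave_even//; exact: same_distribution_Pr.
Qed.

End interleave_law.

Section joint_law.
Context d (T : measurableType d) (R : realType) (P : probability T R).
Variables (Xs Ys : nat -> {RV P >-> R}).
Hypothesis iXY : independent_sequences Xs Ys.

Definition weave (k : nat) : {RV P >-> R} := if odd k then Ys k./2 else Xs k./2.

Lemma sigma_algebra_of_cylinder (Z : nat -> {RV P >-> R}) n A :
  (forall i, measurable (A i)) -> sigma_algebra_of Z (cylinder Z n A).
Proof.
move=> mA; rewrite /sigma_algebra_of /cylinder.
set G := \bigcup_i _.
have [s0 sD sU] := smallest_sigma_algebra [set: T] G.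
have sC B : <<s G >> B -> <<s G >> (~` B) by move=> /sD; rewrite setTD.
rewrite -[X in <<s G >> X]setCK setC_bigcap; apply: (sC).
rewrite bigcup_mkcond; apply: sU => i; case: ifP => [_|_]; last exact: s0.
apply: sC; apply: sub_sigma_algebra; exists i => //.
by exists (A i) => //; rewrite setTI.
Qed.

(** Allows events about independent Xs and Ys to be computed on the product of two copies of the
    space, where conditioning on all the Ys amounts to fixing the second coordinate. *)
Lemma weave_law n (B : set ((n.*2).-tuple R)) : measurable B ->
  Pr P [set w | B [tuple weave i w | i < n.*2]] =
  Pr (P \x P)%E [set w | B [tuple interleave Xs Ys i w | i < n.*2]].
Proof.
apply: sequence_law => A mA; rewrite Pr_cylinder_interleave//.
set A0 := fun i => A i.*2; set A1 := fun i => A i.*2.+1.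
have -> : cylinder weave n.*2 A = cylinder Xs n A0 `&` cylinder Ys n A1.
  apply/seteqP; split => w /=.
    move=> h; split => i /= ni.
      by have := h i.*2; rewrite /weave /= odd_double doubleK ltn_double; exact.
    have := h i.*2.+1; rewrite /weave /= odd_double /= uphalf_double ltn_Sdouble; exact.
  move=> [h1 h2] k /= kn; rewrite /weave; case: ifPn => ok /=.
    have := h2 k./2; rewrite /= /A1.
    by have <- : (k./2).*2.+1 = k; [rewrite -[RHS]odd_double_half ok|rewrite /= uphalf_double; apply; lia].
  have := h1 k./2; rewrite /= /A0.
  by have <- : (k./2).*2 = k; [rewrite -[RHS]odd_double_half (negbTE ok)|rewrite /= doubleK; apply; lia].
apply/EFin_inj; rewrite EFinM !EFin_Pr; do ?[by apply: measurable_cylinder => i; exact: mA].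
  by apply: iXY; apply: sigma_algebra_of_cylinder => i; exact: mA.
by apply: measurableI; apply: measurable_cylinder => i; exact: mA.
Qed.

End joint_law.

(** * Concentration of weighted sums *)

Section swap_pairs.
Variable s : nat -> bool.

(* Exchanges [2i] and [2i+1] for those [i] with [s i]; on a woven sequence this flips the sign of the
   i-th difference. *)
Definition swap_pairs (k : nat) : nat :=
  if s k./2 then (if odd k then k.-1 else k.+1) else k.

Lemma swap_pairs_even i : swap_pairs i.*2 = if s i then i.*2.+1 else i.*2.
Proof. by rewrite /swap_pairs doubleK odd_double. Qed.

Lemma swap_pairs_odd i : swap_pairs i.*2.+1 = if s i then i.*2 else i.*2.+1.
Proof. by rewrite /swap_pairs /= uphalf_double odd_double. Qed.

Lemma swap_pairs_inj : injective swap_pairs.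
Proof.
apply: inv_inj => k; rewrite -(odd_double_half k); case: (odd k) => /=.
  rewrite add1n swap_pairs_odd; case: ifP => si; last by rewrite swap_pairs_odd si.
  by rewrite swap_pairs_even si.
rewrite add0n swap_pairs_even; case: ifP => si; last by rewrite swap_pairs_even si.
by rewrite swap_pairs_odd si.
Qed.

End swap_pairs.

Lemma measurable_natr_bool d (T : measurableType d) (R : realType) (p : T -> bool) :
  measurable [set x | p x] -> measurable_fun [set: T] (fun x => (p x)%:R : R).
Proof.
move=> mp; rewrite (_ : (fun _ => _) = \1_[set x | p x]); first exact: measurable_indic.
by apply/funext => x; rewrite indicE mem_setE.
Qed.

Section symmetrized_sum.
Context d0 (T0 : measurableType d0) (R : realType) (P0 : probability T0 R).
Variable X : {RV P0 >-> R}.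
Context d (T : measurableType d) (P : probability T R).
Variable Xs : nat -> {RV P >-> R}.
Hypothesis iidX : iid_copies Xs X.
Variables (n k : nat) (v : nat -> R) (eta e L : R).
Hypothesis e_ge0 : 0 <= e.
Hypothesis L_gt0 : 0 < L.
Hypothesis eta_gt0 : 0 < eta.
Hypothesis eL : 2 * e < eta * L.

Definition heavy_diff (D : nat -> R) (i : nat) : bool := (eta <= `|v i|) && (L <= `|D i|).

Definition many_heavy (D : nat -> R) : bool :=
  (k.*2%:R <= \sum_(i < n) (heavy_diff D i)%:R :> R).

(** The bound 2e arises from two values of a sum within e of a common centre. At a heavy index the
    term has modulus at least [eta * L] > 2e, the separation that Littlewood-Offord requires. *)
Definition small_and_heavy (D : nat -> R) : bool :=
  (`|\sum_(i < n) v i * D i| <= 2 * e) && many_heavy D.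

Definition pair_diff (t : nat -> R) (i : nat) : R := t i.*2 - t i.*2.+1.

Lemma eq_small_and_heavy D D' : (forall i, (i < n)%N -> D i = D' i) ->
  small_and_heavy D = small_and_heavy D'.
Proof.
move=> DD'; rewrite /small_and_heavy /many_heavy; congr andb.
  by congr (`|_| <= _); apply: eq_bigr => i _; rewrite DD'.
by congr (_ <= _); apply: eq_bigr => i _; rewrite /heavy_diff DD'.
Qed.

Lemma measurable_many_heavy d1 (S : measurableType d1) (D : nat -> S -> R) :
  (forall i, measurable_fun [set: S] (D i)) ->
  measurable [set x | many_heavy (D ^~ x)].
Proof.
move=> mD; apply: measurable_set_le; first exact: measurable_cst.
apply: measurable_sum => i; apply: measurable_natr_bool; rewrite /heavy_diff.
case: (eta <= `|v i|) => /=; last first.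
  by rewrite (_ : [set _ | _] = set0)//; apply/seteqP; split.
apply: measurable_set_le; first exact: measurable_cst.
by apply: measurableT_comp => //; exact: mD.
Qed.

Lemma measurable_small_and_heavy d1 (S : measurableType d1) (D : nat -> S -> R) :
  (forall i, measurable_fun [set: S] (D i)) ->
  measurable [set x | small_and_heavy (D ^~ x)].
Proof.
move=> mD; rewrite /small_and_heavy.
rewrite (_ : [set x | _] = [set x | `|\sum_(i < n) v i * D i x| <= 2 * e] `&`
   [set x | many_heavy (D ^~ x)]); last first.
  by apply/seteqP; split => x /=; [move/andP|move=> h; apply/andP].
apply: measurableI; last exact: measurable_many_heavy.
apply: measurable_set_le; last exact: measurable_cst.
apply: measurableT_comp => //; apply: measurable_sum => i.
by apply: measurable_funM => //; exact: measurable_cst.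
Qed.

Let W := interleave Xs Xs.
Let D (z : T * T) (i : nat) : R := Xs i z.1 - Xs i z.2.

Let mD i : measurable_fun [set: T * T] (D ^~ i).
Proof. by apply: measurable_funB; apply: measurableT_comp. Qed.

Let WE z i : W i.*2 z = Xs i z.1.
Proof. by rewrite /W /interleave odd_double doubleK. Qed.

Let WO z i : W i.*2.+1 z = Xs i z.2.
Proof. by rewrite /W /interleave /= odd_double /= uphalf_double. Qed.

Let flip (S : {set 'I_n}) (z : T * T) (i : nat) : R :=
  if insub i is Some j then (if j \in S then - D z i else D z i) else D z i.

Let mflip S i : measurable_fun [set: T * T] (flip S ^~ i).
Proof.
rewrite /flip; case: insubP => [j _ _|_]; last exact: mD.
by case: (j \in S); [apply: measurableT_comp => //; exact: mD|exact: mD].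
Qed.

(* The joint law of the differences is invariant under sign changes, so [D] may be replaced by an
   average over all sign patterns. *)
Lemma Pr_flip (S : {set 'I_n}) :
  Pr (P \x P)%E [set z | small_and_heavy (flip S z)] =
  Pr (P \x P)%E [set z | small_and_heavy (D z)].
Proof.
pose s i := if insub i is Some j then j \in S else false.
pose sg := swap_pairs s.
have iidW : iid_copies W X by exact: iid_interleave.
have iidWs : iid_copies (W \o sg) X.
  split; last by move=> i; exact: iidW.2.
  by apply: mutually_independent_inj; [exact: swap_pairs_inj|exact: iidW.1].
pose B : set (n.*2.-tuple R) := [set t | small_and_heavy (pair_diff (nth 0 t))].
have mB : measurable B.
  apply: (measurable_small_and_heavy (D := fun i (t : n.*2.-tuple R) => pair_diff (nth 0 t) i)) => i.
  by apply: measurable_funB; exact: measurable_nth_tuple.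
have := @iid_law _ _ _ _ _ (P \x P)%E (P \x P)%E n.*2 _ _ _ _ _ X iidWs iidW B mB.
have BE (U : nat -> {RV (P \x P)%E >-> R}) (F : T * T -> nat -> R) :
    (forall z i, (i < n)%N -> U i.*2 z - U i.*2.+1 z = F z i) ->
    [set w | B [tuple U i w | i < n.*2]] = [set z | small_and_heavy (F z)].
  move=> UF; apply: eq_set => z; rewrite /B /mkset; congr is_true.
  apply: eq_small_and_heavy => i ni.
  by rewrite /pair_diff !(nth_sequence_tuple (fun i => U i : T * T -> R)) ?ltn_double ?ltn_Sdouble// UF.
rewrite (BE _ (flip S)); last first.
  move=> z i ni /=; rewrite /sg swap_pairs_even swap_pairs_odd /flip /s /D.
  by case: insubP => [j _ _|_]; rewrite ?WE ?WO//; case: (j \in S); rewrite ?WE ?WO// opprB.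
by rewrite (BE _ D)// => z i ni; rewrite WE WO.
Qed.

Let flip_heavy S z i : heavy_diff (flip S z) i = heavy_diff (D z) i.
Proof.
by rewrite /heavy_diff /flip; case: insubP => // j _ _; case: ifP => //; rewrite normrN.
Qed.

Let flip_sum S z : \sum_(i < n) v i * flip S z i = signed_sum (fun i : 'I_n => v i * D z i) S.
Proof.
apply: eq_bigr => i _; rewrite /flip valK; case: ifP => // _; by rewrite mulrN.
Qed.

(** For fixed z with 2k heavy indices, at most 2^(n-2k) C(2k,k) of the 2^n sign patterns give a
    small sum. Heaviness does not depend on the signs, so averaging over the patterns bounds the
    probability of the whole event. *)
Lemma Pr_small_and_heavy :
  Pr (P \x P)%E [set z | small_and_heavy (D z)] <= 'C(k.*2, k)%:R / 4 ^+ k.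
Proof.
pose E S := [set z | small_and_heavy (flip S z)].
have mE S : measurable (E S) by exact: (measurable_small_and_heavy (D := fun i z => flip S z i)).
have n2 : (0 : R) < 2 ^+ n by exact: exprn_gt0.
rewrite -(ler_pM2l n2).
have cardS : #|{: {set 'I_n}}| = (2 ^ n)%N.
  by rewrite -cardsT -powersetT card_powerset cardsT card_ord.
pose f S : T * T -> R := \1_(E S).
have bf S : bounded_measurable (f S) by exact: bdd_indic.
pose r := enum {: {set 'I_n}}.
have H1 : 2 ^+ n * Pr (P \x P)%E [set z | small_and_heavy (D z)] =
    \sum_(i < size r) Ex (P \x P)%E (f (nth finset.set0 r i)).
  under eq_bigr do rewrite Ex_indic// Pr_flip.
  by rewrite [RHS]sumr_const card_ord -cardE cardS -[RHS]mulr_natl natrX.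
rewrite H1 -(@Ex_sum _ _ _ _ _ (fun i => f (nth finset.set0 r i)))//.
rewrite -[leRHS](Ex_cst (P \x P)%E); apply: le_Ex.
- by apply: (@bdd_sum _ _ _ _ (fun i => f (nth finset.set0 r i))).
- exact: bdd_cst.
move=> z; rewrite (_ : \sum_(i < size r) _ = \sum_S f S z); last first.
  rewrite -(big_mkord xpredT (fun i => f (nth finset.set0 r i) z)) -(big_nth finset.set0 xpredT (f^~ z)).
  by rewrite big_enum.
have [mh|nmh] := boolP (many_heavy (D z)); last first.
  rewrite big1; first by rewrite mulr_ge0 ?divr_ge0 ?ler0n ?exprn_ge0.
  move=> S _; rewrite /f indicE memNset// /E /=; apply/negP.
  rewrite negb_and; apply/orP; right; apply: contra nmh.
  by rewrite /many_heavy; under eq_bigr do rewrite flip_heavy.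
pose M0 := [set i : 'I_n | heavy_diff (D z) i]%SET.
have cM0 : (k.*2 <= #|M0|)%N.
  rewrite -(ler_nat R); apply: le_trans mh _.
  rewrite -sum1_card natr_sum [leRHS]big_mkcond/=; apply: ler_sum => i _.
  by rewrite inE; case: heavy_diff.
(* Exactly 2k heavy indices are retained, the size for which the counting bound is stated. *)
have [M MM0 /eqP cM] : exists2 M : {set 'I_n}, M \subset M0 & #|M| == k.*2.
  have /card_gt0P[M] : (0 < #|[set A : {set 'I_n} | A \subset M0 & #|A| == k.*2]%SET|)%N.
    by rewrite cards_draws bin_gt0.
  by rewrite inE => /andP[? ?]; exists M.
apply: (@le_trans _ _ (#|[set S : {set 'I_n} | (`|signed_sum (fun i : 'I_n => v i * D z i) S| <= 2 * e)%R]%SET|)%:R).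
  rewrite -sum1_card natr_sum [leRHS]big_mkcond/=; apply: ler_sum => S _.
  rewrite /f indicE inE; case: (boolP (z \in _)) => [/set_mem|_]; last by case: ifP.
  by rewrite /E /mkset /small_and_heavy flip_sum => /andP[-> _].
have kn : (k.*2 <= n)%N by rewrite -cM -[leqRHS]card_ord; exact: max_card.
rewrite (_ : 2 ^+ n * _ = (2 ^ (n - k.*2) * 'C(k.*2, k))%:R); last first.
  rewrite natrM natrX -{1}(subnK kn) exprD -mulrA; congr (_ * _).
  rewrite -mul2n exprM (_ : 2 ^+ 2 = 4); last by ring.
  by rewrite mulrC divfK// expf_neq0.
rewrite ler_nat -[X in (2 ^ (X - _))%N]card_ord.
have e2 : 0 <= 2 * e by exact: mulr_ge0.
apply: (@littlewood_offord _ _ _ (eta * L) (2 * e) M k e2 eL _ cM).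
move=> i /(fintype.subsetP MM0); rewrite inE /heavy_diff normrM => /andP[h1 h2].
by apply: ler_pM => //; exact: ltW.
Qed.

End symmetrized_sum.

Section concentration.
Context d0 (T0 : measurableType d0) (R : realType) (P0 : probability T0 R).
Variable X : {RV P0 >-> R}.
Hypothesis ndX : non_degenerate X.

Lemma Pr_same_le d (T : measurableType d) (P : probability T R) (Z : {RV P >-> R}) x :
  same_distribution Z X -> Pr P [set w | Z w <= x] = rcdf X x.
Proof.
move=> ZX; have := @same_distribution_Pr _ _ _ _ _ _ _ Z X `]-oo, x] ZX (measurable_itv _).
rewrite /rcdf => h; rewrite (_ : [set w | Z w <= x] = Z @^-1` `]-oo, x]) ?h//.
Qed.

Lemma ceil_nat (x : R) : exists m : nat, x <= m%:R.
Proof. by exists (Num.truncn x).+1; apply/ltW; exact: truncnS_gt. Qed.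

(** Symmetrization: the squared probability is that of two independent copies of the sum both lying
    within e of t, and then they differ by at most 2e. [K] and [L] depend only on [tau] and the law
    of X; this uniformity in n, v and t is what permits random weights. *)
Lemma concentration (tau : R) : 0 < tau -> exists (K : nat) (L : R), 0 < L /\
  forall d (T : measurableType d) (P : probability T R) (Xs : nat -> {RV P >-> R}),
  iid_copies Xs X -> forall n (v : nat -> R) (eta e t : R),
  0 <= e -> 0 < eta -> 2 * e < eta * L ->
  (K <= #|[pred i : 'I_n | (eta <= `|v i|)%R]|)%N ->
  Pr P [set w | `|\sum_(i < n) v i * Xs i w - t| <= e] <= tau.
Proof.
move=> tau0.
have [u [v0 [uv Fu Fv _ _]]] := non_degenerate_spread ndX.
pose L := v0 - u; have L0 : 0 < L by rewrite /L; lra.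
pose p := rcdf X u * (1 - rcdf X v0).
have p0 : 0 < p by rewrite /p mulr_gt0// subr_gt0.
(* k makes the Littlewood-Offord bound at most tau^2/2. If N >= K weights are large, then N p >= 8k
   + 8/tau^2, where p is the chance of the event that forces a difference of at least L. Hence 2k <=
   N p / 4, and Chebyshev's bound 4/(N p) is at most tau^2/2. *)
have [k kP] := ceil_nat ((tau ^+ 2 / 2) ^- 2).
have [K KP] := ceil_nat (4 * k.*2%:R / p + (tau ^+ 2 / 8) ^-1 / p + 1).
have tau20 : 0 < tau ^+ 2 by exact: exprn_gt0.
have ck : 'C(k.*2, k)%:R / 4 ^+ k <= tau ^+ 2 / 2.
  rewrite -(@ler_pXn2r _ 2)// ?nnegrE ?divr_ge0 ?ler0n ?exprn_ge0//; last by lra.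
  apply: le_trans (central_bin_ratio _ _) _.
  rewrite -[leRHS]invrK lef_pV2 ?posrE ?ltr0n// ?invr_gt0 ?exprn_gt0 ?divr_gt0//.
  by apply: le_trans kP _; rewrite ler_nat; lia.
exists K, L; split => // d T P Xs iidX n v eta e t e0 eta0 eL cK.
set A := [set w | _].
have mXs i : measurable_fun [set: T] (Xs i) by exact: measurable_funPT.
have mA : measurable A.
  apply: measurable_dist_le.
  apply: measurable_sum => i; apply: measurable_funM => //; exact: measurable_cst.
pose D (z : T * T) (i : nat) : R := Xs i z.1 - Xs i z.2.
have mD i : measurable_fun [set: T * T] (D ^~ i).
  by apply: measurable_funB; apply: measurableT_comp.
pose PP := (P \x P)%E.
pose sh z := small_and_heavy n k v eta e L (D z).
pose mh z := many_heavy n k v eta L (D z).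
have msh : measurable [set z | sh z] by apply: measurable_small_and_heavy.
have mmh : measurable [set z | mh z] by apply: measurable_many_heavy.
have H1 : Pr PP [set z | sh z] <= tau ^+ 2 / 2.
  apply: le_trans ck; exact: (Pr_small_and_heavy iidX).
suff H2 : Pr PP [set z | ~~ mh z] <= tau ^+ 2 / 2.
  have : Pr P A ^+ 2 <= tau ^+ 2.
    rewrite expr2 -Pr_prod//.
    apply: (@le_trans _ _ (Pr PP ([set z | sh z] `|` [set z | ~~ mh z]))).
      apply: le_Pr.
      - exact: measurableX.
      - apply: measurableU => //.
        by rewrite (_ : [set z | ~~ mh z] = ~` [set z | mh z]);
          [exact: measurableC|apply/seteqP; split => z /= /negP].
      - move=> z [/= A1 A2]; case: (boolP (mh z)) => h; last by right.
        left; rewrite /sh /small_and_heavy; apply/andP; split; last exact: h.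
        have -> : \sum_(i < n) v i * D z i = (\sum_(i < n) v i * Xs i z.1 - t) - (\sum_(i < n) v i * Xs i z.2 - t).
          rewrite opprB addrA subrK -sumrB; apply: eq_bigr => i _.
          by rewrite /D mulrBr.
        apply: le_trans (ler_normB _ _) _.
        by rewrite mulr_natl mulr2n lerD.
    have := Pr_setU PP msh.
    have -> : [set z | ~~ mh z] = ~` [set z | mh z].
      by apply/seteqP; split => z /= /negP.
    move=> /(_ _ (measurableC mmh)).
    have := H2; have -> : [set z | ~~ mh z] = ~` [set z | mh z].
      by apply/seteqP; split => z /= /negP.
    move=> h1 h2; apply: le_trans h2 _; rewrite [leRHS]splitr; exact: lerD.
  by rewrite ler_pXn2r// nnegrE ?Pr_ge0// ltW.
(* The events [Xs i <= u] and [Xs' i > v0] are independent over i, and force [`|D i| >= L]. *)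
pose J := [pred i : 'I_n | eta <= `|v i|].
pose a i : T -> R := \1_[set w | Xs i w <= u].
pose b i : T -> R := \1_[set w | v0 < Xs i w].
pose h (i : nat) : R := (eta <= `|v i|)%R%:R.
pose Z i (z : T * T) : R := h i * (a i z.1 * b i z.2).
have ma i : measurable [set w | Xs i w <= u] by exact: measurable_RV_le.
have mb i : measurable [set w | v0 < Xs i w] by exact: measurable_RV_gt.
have ba i : bounded_measurable (a i) by exact: bdd_indic.
have bb i : bounded_measurable (b i) by exact: bdd_indic.
have Ea i : Ex P (a i) = rcdf X u by rewrite Ex_indic// Pr_same_le//; exact: iidX.2.
have Eb i : Ex P (b i) = 1 - rcdf X v0.
  by rewrite Ex_indic// Pr_gt /rcdf Pr_same_le//; exact: iidX.2.
have Eaa i j : i != j -> Ex P (fun w => a i w * a j w) = rcdf X u ^+ 2.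
  move=> ij; rewrite expr2 -{1}(Ea i) -(Ea j).
  have -> : (fun w => a i w * a j w) = fun w => \1_(`]-oo, u]%classic) (Xs i w) * \1_(`]-oo, u]%classic) (Xs j w).
    by apply/funext => w; rewrite /a !indicE !mem_setE.
  rewrite (mutually_independent_Ex iidX.1 ij); do ?exact: bdd_indic.
  by congr (Ex P _ * Ex P _); apply/funext => w; rewrite /a /= !indicE !mem_setE.
have Ebb i j : i != j -> Ex P (fun w => b i w * b j w) = (1 - rcdf X v0) ^+ 2.
  move=> ij; rewrite expr2 -{1}(Eb i) -(Eb j).
  have -> : (fun w => b i w * b j w) = fun w => \1_(`]v0, +oo[%classic) (Xs i w) * \1_(`]v0, +oo[%classic) (Xs j w).
    by apply/funext => w; rewrite /b !indicE !mem_setE in_itv/= in_itv/= !andbT.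
  rewrite (mutually_independent_Ex iidX.1 ij); do ?exact: bdd_indic.
  by congr (Ex P _ * Ex P _); apply/funext => w; rewrite /b /= !indicE !mem_setE in_itv/= andbT.
have bab i j : bounded_measurable (fun z : T * T => (a i z.1 * a j z.1) * (b i z.2 * b j z.2)).
  by apply: bddM; apply: bddM; [exact: bdd_fst|exact: bdd_fst|exact: bdd_snd|exact: bdd_snd].
have bZ0 i : bounded_measurable (fun z : T * T => a i z.1 * b i z.2).
  have := bab i i; congr bounded_measurable; apply/funext => z.
  by rewrite /a /b !indicE; do 2 case: (_ \in _); rewrite /= ?mulr1 ?mulr0.
have bZ i : bounded_measurable (Z i) by apply: bddM => //; exact: bdd_cst.
have EZ i : Ex PP (Z i) = h i * p by rewrite ExZ// Ex_prod// Ea Eb.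
have EZZ i j : i != j -> Ex PP (fun z => Z i z * Z j z) = Ex PP (Z i) * Ex PP (Z j).
  move=> ij; rewrite !EZ.
  have -> : (fun z => Z i z * Z j z) = fun z => (h i * h j) * ((a i z.1 * a j z.1) * (b i z.2 * b j z.2)).
    by apply/funext => z; rewrite /Z; ring.
  rewrite ExZ// (@Ex_prod _ _ _ _ _ P P (fun w => a i w * a j w) (fun w => b i w * b j w)); do ?exact: bddM.
  by rewrite Eaa// Ebb// /p; ring.
have EZ2 i : Ex PP (fun z => Z i z ^+ 2) = h i * p.
  rewrite -EZ; congr Ex; apply/funext => z; rewrite /Z /h /a /b !indicE.
  by case: (_ <= _); do 2 case: (_ \in _); rewrite /= ?mulr1 ?mulr0 ?expr1n ?expr0n.
pose N : R := #|J|%:R.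
have hN : \sum_(i < n) h i * p = N * p.
  rewrite -mulr_suml; congr (_ * _).
  by rewrite /N -sum1_card natr_sum [RHS]big_mkcond/=; apply: eq_bigr => i _; rewrite /h inE; case: ifP.
have KN : K%:R <= N by rewrite ler_nat.
have Np1 : 4 * k.*2%:R + (tau ^+ 2 / 8)^-1 <= N * p.
  rewrite -ler_pdivrMr// mulrDl; lra.
have x0 : 0 < (tau ^+ 2 / 8)^-1 by rewrite invr_gt0; lra.
have k0 : 0 <= k.*2%:R :> R by exact: ler0n.
have Np0 : 0 < N * p by lra.
have cheb := @chebyshev_sum _ _ _ PP n Z (N * p / 2) bZ EZZ ltac:(lra).
have sub : [set z | ~~ mh z] `<=` [set z | N * p / 2 <= `|\sum_(i < n) Z i z - \sum_(i < n) Ex PP (Z i)|].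
  move=> z /=; rewrite /mh /many_heavy -ltNge => hz.
  under [X in _ - X]eq_bigr do rewrite EZ.
  rewrite hN; have : \sum_(i < n) Z i z <= \sum_(i < n) (heavy_diff v eta L (D z) i)%:R.
    apply: ler_sum => i _; rewrite /Z /h /a /b !indicE /heavy_diff.
    case: (eta <= _) => /=; last by rewrite mul0r.
    rewrite mul1r; case: (boolP (z.1 \in _)) => [/set_mem /= h1|_]; last by rewrite mul0r ler0n.
    case: (boolP (z.2 \in _)) => [/set_mem /= h2|_]; last by rewrite mulr0 ler0n.
    rewrite mulr1.
    suff -> : L <= `|D z i| by [].
    by rewrite /D distrC; apply: le_trans (ler_norm _); rewrite /L; lra.
  move=> hZ; rewrite distrC; apply: le_trans (ler_norm _); lra.
have m1 : measurable [set z | ~~ mh z].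
  by rewrite (_ : [set z | ~~ mh z] = ~` [set z | mh z]);
    [exact: measurableC|apply/seteqP; split => z /= /negP].
have m2 : measurable [set z | N * p / 2 <= `|\sum_(i < n) Z i z - \sum_(i < n) Ex PP (Z i)|].
  apply: measurable_dist_ge.
  by apply: measurable_sum => i; exact: (bZ i).1.
apply: le_trans (le_Pr _ m1 m2 sub) _; apply: le_trans cheb _.
under eq_bigr do rewrite EZ2.
have xE (x : R) : 0 < x -> x / (x / 2) ^+ 2 = 4 / x by move=> ?; field; rewrite gt_eqF.
rewrite hN xE//.
rewrite ler_pdivrMr//.
have := ler_wpM2l (ltW tau20) Np1.
have yE (x : R) : 0 < x -> x * (x / 8)^-1 = 8 by move=> ?; field; rewrite gt_eqF.
rewrite mulrDr yE//.
have : 0 <= tau ^+ 2 * (4 * k.*2%:R) by rewrite !mulr_ge0// ltW.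
lra.
Qed.
End concentration.

Section truncations.
Variable R : realType.
Implicit Types x y z : R.

(** * Truncated moments *)

(** The cut at 0 makes these functions bounded on the whole line. A capped value is the truncated
    value plus x times the exceedance indicator, which splits E min(Y, x) into a part from small
    values and a part from jumps. *)
Definition capf x y : R := Num.min (Num.max y 0) x.
Definition truncf x y : R := if (0 <= y) && (y <= x) then y else 0.
Definition gtf x y : R := (x < y)%R%:R.

Lemma bdd_capf x : 0 <= x -> bounded_measurable (capf x).
Proof.
move=> x0; split.
  by apply: measurable_minr => //; apply: measurable_maxr.
exists x => y; rewrite ger0_norm; first by rewrite /capf ge_min lexx orbT.
by rewrite /capf le_min x0 andbT le_max lexx orbT.
Qed.

Lemma bdd_gtf x : bounded_measurable (gtf x).
Proof.
split; last by exists 1 => y; rewrite /gtf; case: (_ < _); rewrite ?normr1 ?normr0.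
apply: measurable_natr_bool; apply: measurable_set_lt => //; exact: measurable_cst.
Qed.

Lemma truncfE x y : 0 <= x -> truncf x y = capf x y - x * gtf x y.
Proof.
move=> x0; rewrite /truncf /capf /gtf.
have [y0|y0] := leP 0 y => /=.
  have [yx|xy] := leP y x; first by rewrite mulr0 subr0.
  by rewrite mulr1 subrr.
by rewrite min_l// ltNge (ltW (lt_le_trans y0 x0))/= mulr0 subr0.
Qed.

Lemma bdd_truncf x : 0 <= x -> bounded_measurable (truncf x).
Proof.
move=> x0; rewrite (_ : truncf x = fun y => capf x y - x * gtf x y).
  apply: bddB; first exact: bdd_capf.
  by apply: bddM; [exact: bdd_cst|exact: bdd_gtf].
by apply/funext => y; exact: truncfE.
Qed.

Lemma truncf_ge0 x y : 0 <= truncf x y.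
Proof. by rewrite /truncf; case: ifP => // /andP[]. Qed.

Lemma capf_ge0 x y : 0 <= x -> 0 <= capf x y.
Proof. by move=> x0; rewrite /capf le_min x0 andbT le_max lexx orbT. Qed.

Lemma capf_le x y : capf x y <= x.
Proof. by rewrite /capf ge_min lexx orbT. Qed.

Lemma capf_homo x z y : x <= z -> capf x y <= capf z y.
Proof. by move=> xz; rewrite /capf le_min ge_min lexx/= ge_min xz orbT. Qed.

Lemma capf_split x z y : 0 <= z -> z <= x -> capf x y <= truncf z y + x * gtf z y.
Proof.
move=> z0 zx; rewrite /gtf; have [zy|yz] := ltP z y.
  by rewrite mulr1; apply: le_trans (capf_le _ _) _; rewrite lerDr truncf_ge0.
rewrite mulr0 addr0 /truncf yz andbT /capf.
by have [y0|y0] := leP 0 y; rewrite ge_min lexx.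
Qed.

Lemma capf_scale x z y : 0 <= x -> x <= z -> x * capf z y <= z * capf x y.
Proof.
move=> x0 xz; rewrite /capf; have z0 := le_trans x0 xz.
have [y0|y0] := leP 0 y; last by rewrite !min_l// !mulr0.
have [yz|yz] := leP y z; have [yx|yx] := leP y x.
- by rewrite ler_wpM2r.
- by rewrite mulrC ler_wpM2r.
- by have := le_lt_trans xz yz; rewrite ltNge yx.
- by rewrite mulrC.
Qed.

Lemma capf_drop x y : 0 <= x -> truncf x y <= 2 * capf x y - capf (2 * x) y.
Proof.
move=> x0; rewrite /truncf /capf; have [y0|y0] /= := leP 0 y; last first.
  by rewrite !min_l ?mulr_ge0//; lra.
have [yx|xy] := leP y x; have [y2|y2] := leP y (2 * x); lra.
Qed.

Lemma capf_ge v x y : 0 <= v -> 0 <= x -> Num.min v x * gtf v y <= capf x y.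
Proof.
move=> v0 x0; rewrite /gtf; have [vy|yv] := ltP v y; last by rewrite mulr0 capf_ge0.
rewrite mulr1 /capf le_min !ge_min lexx orbT andbT.
by rewrite le_max (ltW vy).
Qed.

Lemma truncf_sqr x y : truncf x y ^+ 2 <= x * truncf x y.
Proof.
rewrite /truncf; case: ifP => [/andP[y0 yx]|_]; last by rewrite expr2 !mulr0.
by rewrite expr2 ler_wpM2r.
Qed.

Lemma bdd_comp d (T : measurableType d) (P : probability T R) (X : {RV P >-> R}) (f : R -> R) :
  bounded_measurable f -> bounded_measurable (f \o X).
Proof.
move=> [mf [M MP]]; split; last by exists M => w; exact: MP.
by apply: measurableT_comp => //; exact: measurable_funPT.
Qed.

End truncations.

Section truncated_moments.
Context d (T : measurableType d) (R : realType) (P : probability T R).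
Variable Y : {RV P >-> R}.
Implicit Types x z : R.

Definition tail x : R := Pr P [set w | x < Y w].
Definition capm x : R := Ex P (capf x \o Y).
Definition truncm x : R := Ex P (truncf x \o Y).
(* [capG x] is G(x) = E[min(Y/x, 1)]. *)
Definition capG x : R := capm x / x.

Lemma tail_ge0 x : 0 <= tail x. Proof. exact: Pr_ge0. Qed.

Lemma tail_le1 x : tail x <= 1. Proof. exact/Pr_le1/measurable_RV_gt. Qed.

Lemma Ex_gtf x : Ex P (gtf x \o Y) = tail x.
Proof.
rewrite /tail -Ex_indic; last exact: measurable_RV_gt.
by congr Ex; apply/funext => w; rewrite /gtf /= indicE mem_setE.
Qed.

Lemma capmE x : 0 <= x -> capm x = truncm x + x * tail x.
Proof.
move=> x0; rewrite /capm /truncm -Ex_gtf -ExZ; last exact/bdd_comp/bdd_gtf.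
rewrite -ExD; do ?exact/bdd_comp/bdd_truncf.
  by congr Ex; apply/funext => w /=; rewrite truncfE// subrK.
by apply: bddM; [exact: bdd_cst|exact/bdd_comp/bdd_gtf].
Qed.

Lemma truncm_ge0 x : 0 <= truncm x.
Proof. by apply: Ex_ge0 => w; exact: truncf_ge0. Qed.

Lemma truncm_sqr x : 0 <= x -> Ex P (fun w => truncf x (Y w) ^+ 2) <= x * truncm x.
Proof.
move=> x0; have bt : bounded_measurable (truncf x \o Y) by exact/bdd_comp/bdd_truncf.
rewrite /truncm -ExZ//; apply: le_Ex.
- exact: bdd_sqr.
- by apply: bddM => //; exact: bdd_cst.
- by move=> w; exact: truncf_sqr.
Qed.

Lemma capm_split x z : 0 <= z -> z <= x -> capm x <= truncm z + x * tail z.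
Proof.
move=> z0 zx; have x0 : 0 <= x by exact: le_trans zx.
rewrite /capm /truncm -Ex_gtf -ExZ; last exact/bdd_comp/bdd_gtf.
have bg : bounded_measurable (fun w => x * (gtf z \o Y) w).
  by apply: bddM; [exact: bdd_cst|exact/bdd_comp/bdd_gtf].
rewrite -ExD//; do ?exact/bdd_comp/bdd_truncf.
apply: le_Ex; first exact/bdd_comp/bdd_capf.
  by apply: bddD => //; exact/bdd_comp/bdd_truncf.
by move=> w; exact: capf_split.
Qed.

Lemma capm_homo x z : 0 <= x -> x <= z -> capm x <= capm z.
Proof.
move=> x0 xz; apply: le_Ex => [||w]; last exact: capf_homo.
  exact/bdd_comp/bdd_capf.
by apply/bdd_comp/bdd_capf; exact: le_trans xz.
Qed.

Lemma capmG x : 0 < x -> capm x = x * capG x.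
Proof. by move=> x0; rewrite /capG mulrC divfK// gt_eqF. Qed.

Lemma capG_nonincr x z : 0 < x -> x <= z -> capG z <= capG x.
Proof.
move=> x0 xz; have z0 := lt_le_trans x0 xz.
rewrite /capG ler_pdivrMr// mulrAC ler_pdivlMr// mulrC [leRHS]mulrC.
rewrite /capm -!ExZ; do ?[by apply/bdd_comp/bdd_capf; exact: ltW].
apply: le_Ex => [||w /=]; last exact: capf_scale (ltW _) _.
  by apply: bddM; [exact: bdd_cst|apply/bdd_comp/bdd_capf; exact: ltW].
by apply: bddM; [exact: bdd_cst|apply/bdd_comp/bdd_capf; exact: ltW].
Qed.

(** The capped mean x G(x) is nondecreasing, so G loses at most a factor c when the scale grows by
    c. *)
Lemma capG_scale (c x : R) : 1 <= c -> 0 < x -> capG x <= c * capG (c * x).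
Proof.
move=> c1 x0; have c0 : 0 < c by lra.
have -> : c * capG (c * x) = capm (c * x) / x by rewrite /capG; field; rewrite !gt_eqF.
have xcx : x <= c * x by rewrite ler_peMl// ltW.
by rewrite /capG ler_pM2r ?invr_gt0//; exact: capm_homo (ltW x0) xcx.
Qed.

Lemma tail_le_capG x : 0 < x -> tail x <= capG x.
Proof.
move=> x0; rewrite /capG ler_pdivlMr// (capmE (ltW x0)).
by have := truncm_ge0 x; lra.
Qed.

Lemma truncm_le_capG x z : 0 < z -> z <= x -> truncm z <= x * capG x.
Proof.
move=> z0 zx; rewrite -capmG ?(lt_le_trans z0)//.
apply: le_trans (capm_homo (ltW z0) zx).
by rewrite (capmE (ltW z0)) lerDl mulr_ge0 ?tail_ge0// ltW.
Qed.

(** If G hardly decreases from x to 2x, the values of Y below x contribute little to E min(Y, x),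
    which then comes from jumps beyond x. Pointwise, 2 min(y, x) - min(y, 2x) equals y on [0, x] and
    is nonnegative beyond. *)
Lemma capG_drop x : 0 < x -> truncm x <= 2 * x * (capG x - capG (2 * x)).
Proof.
move=> x0; have x20 : 0 < 2 * x by lra.
have -> : 2 * x * (capG x - capG (2 * x)) = 2 * capm x - capm (2 * x).
  by rewrite (capmG x0) (capmG x20); ring.
have b1 : bounded_measurable (capf x \o Y) by apply/bdd_comp/bdd_capf; exact: ltW.
have b2 : bounded_measurable (capf (2 * x) \o Y) by apply/bdd_comp/bdd_capf; exact: ltW.
have b3 : bounded_measurable (fun w => 2 * (capf x \o Y) w) by apply: bddM => //; exact: bdd_cst.
rewrite /truncm /capm -ExZ// -ExB//; apply: le_Ex => [||w /=].
- by apply/bdd_comp/bdd_truncf; exact: ltW.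
- exact: bddB.
- by apply: capf_drop; exact: ltW.
Qed.

Lemma tail_small e : 0 < e -> exists M, 0 < M /\ tail M <= e.
Proof.
move=> e0; have [M MP] := rcdf_cvgy Y e0.
exists (Num.max M 1); split; first by rewrite lt_max ltr01 orbT.
by rewrite /tail Pr_gt; apply: MP; rewrite le_max lexx.
Qed.

(** Split at a level M of small tail: the values below contribute at most M/x, those above at most
    P(Y > M). *)
Lemma capG_small e : 0 < e -> exists x0, 0 < x0 /\ forall x, x0 <= x -> capG x <= e.
Proof.
move=> e0; have [M [M0 tM]] := @tail_small (e / 2) ltac:(lra).
exists (M + M / (e / 2)); have h : 0 < M / (e / 2) by rewrite divr_gt0//; lra.
split; first by lra.
move=> x hx; have x0 : 0 < x by lra.
rewrite /capG ler_pdivrMr//; apply: le_trans (capm_split (ltW M0) _) _; first by lra.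
have h1 : truncm M <= M.
  apply: le_trans (truncm_le_capG M0 (lexx _)) _; rewrite -capmG//.
  rewrite /capm -[leRHS](Ex_cst P); apply: le_Ex => [||w /=].
  - by apply/bdd_comp/bdd_capf; exact: ltW.
  - exact: bdd_cst.
  - exact: capf_le.
have h2 : M <= e / 2 * x by rewrite mulrC -ler_pdivrMr; lra.
have h3 : x * tail M <= x * (e / 2) by rewrite ler_pM2l.
lra.
Qed.

Lemma capG_gt0 x : non_degenerate Y -> (forall w, 0 <= Y w) -> 0 < x -> 0 < capG x.
Proof.
move=> ndY Y0 x0; have [u [v [uv Fu Fv _ _]]] := non_degenerate_spread ndY.
have u0 : 0 <= u.
  rewrite leNgt; apply/negP => u0; move: Fu; apply/negP; rewrite -leNgt.
  rewrite /rcdf (_ : [set w | Y w <= u] = set0) ?Pr_set0//.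
  apply/seteqP; split => w //= h; have := Y0 w; lra.
have tv : 0 < tail v by rewrite /tail Pr_gt; lra.
rewrite divr_gt0//; apply: (@lt_le_trans _ _ (Num.min v x * tail v)).
  by rewrite mulr_gt0// lt_min x0 andbT; lra.
rewrite -Ex_gtf -ExZ; last exact/bdd_comp/bdd_gtf.
apply: le_Ex => [||w /=].
- by apply: bddM; [exact: bdd_cst|exact/bdd_comp/bdd_gtf].
- by apply/bdd_comp/bdd_capf; exact: ltW.
- by apply: capf_ge; lra.
Qed.

End truncated_moments.

Lemma Ex_sum_sqr d (T : measurableType d) (R : realType) (P : probability T R)
    n (Z : nat -> T -> R) :
  (forall i, bounded_measurable (Z i)) ->
  (forall i j : nat, i != j -> Ex P (fun w => Z i w * Z j w) = Ex P (Z i) * Ex P (Z j)) ->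
  Ex P (fun w => (\sum_(i < n) Z i w) ^+ 2) <=
    \sum_(i < n) Ex P (fun w => Z i w ^+ 2) + (\sum_(i < n) Ex P (Z i)) ^+ 2.
Proof.
move=> bZ uZ.
under [X in Ex P X]funext do rewrite expr2 big_distrlr/=.
rewrite (@Ex_sum _ _ _ P n (fun i w => \sum_(j < n) Z i w * Z j w)); last first.
  by move=> i; apply: (@bdd_sum _ _ _ n (fun j w => Z i w * Z j w)) => j; exact: bddM.
rewrite expr2 big_distrlr/= -big_split/=; apply: ler_sum => i _.
rewrite (@Ex_sum _ _ _ P n (fun j w => Z i w * Z j w)); last by move=> j; exact: bddM.
rewrite (bigD1 i)//= [X in _ <= _ + X](bigD1 i)//=.
under [X in Ex P X + _ <= _]funext do rewrite -expr2.
rewrite lerD2l [X in X <= _](eq_bigr (fun j : 'I_n => Ex P (Z i) * Ex P (Z j))).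
  by rewrite lerDr -expr2 sqr_ge0.
by move=> j ji; rewrite uZ// eq_sym.
Qed.

Section iid_sums.
Context d0 (T0 : measurableType d0) (R : realType) (P0 : probability T0 R).
Variable Y : {RV P0 >-> R}.
Context d (T : measurableType d) (P : probability T R).
Variable Ys : nat -> {RV P >-> R}.
Hypothesis iidY : iid_copies Ys Y.
Hypothesis Ys_ge0 : forall i w, 0 <= Ys i w.

Definition partial_sum (n : nat) (w : T) : R := \sum_(i < n) Ys i w.
Definition exceedances (z : R) (n : nat) (w : T) : R := \sum_(i < n) gtf z (Ys i w).
Definition truncated_sum (z : R) (n : nat) (w : T) : R := \sum_(i < n) truncf z (Ys i w).

Lemma measurable_partial_sum n : measurable_fun [set: T] (partial_sum n).
Proof. by apply: measurable_sum => i; exact: measurable_funPT. Qed.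

Lemma partial_sum_ge0 n w : 0 <= partial_sum n w.
Proof. exact: sumr_ge0. Qed.

Lemma bdd_exceedances z n : bounded_measurable (exceedances z n).
Proof.
apply: (@bdd_sum _ _ _ n (fun i w => gtf z (Ys i w))) => i.
exact: (bdd_comp (Ys i) (bdd_gtf z)).
Qed.

Lemma bdd_truncated_sum z n : 0 <= z -> bounded_measurable (truncated_sum z n).
Proof.
move=> z0; apply: (@bdd_sum _ _ _ n (fun i w => truncf z (Ys i w))) => i.
exact: (bdd_comp (Ys i) (bdd_truncf z0)).
Qed.

Lemma Ex_copy i (f : R -> R) : bounded_measurable f ->
  Ex P (fun w => f (Ys i w)) = Ex P0 (f \o Y).
Proof. by move=> bf; rewrite -(same_distribution_Ex (iidY.2 i) bf). Qed.

Lemma Ex_copy2 i j (f : R -> R) : bounded_measurable f -> i != j ->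
  Ex P (fun w => f (Ys i w) * f (Ys j w)) =
  Ex P (fun w => f (Ys i w)) * Ex P (fun w => f (Ys j w)).
Proof. by move=> bf ij; rewrite (mutually_independent_Ex iidY.1 ij). Qed.

Lemma sum_Ex_copy n (f : R -> R) : bounded_measurable f ->
  \sum_(i < n) Ex P (fun w => f (Ys i w)) = n%:R * Ex P0 (f \o Y).
Proof.
move=> bf; under eq_bigr do rewrite Ex_copy//.
by rewrite sumr_const card_ord mulr_natl.
Qed.

Lemma Ex_exceedances z n : Ex P (exceedances z n) = n%:R * tail Y z.
Proof.
rewrite /exceedances (@Ex_sum _ _ _ P n (fun i w => gtf z (Ys i w))); last first.
  by move=> i; exact: (bdd_comp (Ys i) (bdd_gtf z)).
by rewrite sum_Ex_copy ?Ex_gtf//; exact: bdd_gtf.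
Qed.

Lemma exceedances_ge0 z n w : 0 <= exceedances z n w.
Proof. by apply: sumr_ge0 => i _; rewrite /gtf ler0n. Qed.

Lemma Pr_exceedances_le z n :
  Pr P [set w | 1 <= exceedances z n w] <= n%:R * tail Y z.
Proof.
rewrite -Ex_exceedances -[leRHS]divr1; apply: Ex_markov => //.
  exact: bdd_exceedances.
exact: exceedances_ge0.
Qed.

(** If S_n exceeds [la], the sum of the summands capped at [la] is at least [la]: either one summand
    reaches the cap, or no cap is active. Markov's inequality then applies without any moment of
    Y. *)
Lemma partial_sum_gt_le n (la : R) : 0 < la ->
  Pr P [set w | la < partial_sum n w] <= n%:R * capG Y la.
Proof.
move=> la0; pose f w := \sum_(i < n) capf la (Ys i w).
have bc : bounded_measurable (capf la) by exact/bdd_capf/ltW.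
have bf : bounded_measurable f.
  by apply: (@bdd_sum _ _ _ n (fun i w => capf la (Ys i w))) => i; exact: (bdd_comp (Ys i) bc).
have Ef : Ex P f = n%:R * capm Y la.
  rewrite /f (@Ex_sum _ _ _ P n (fun i w => capf la (Ys i w))); last first.
    by move=> i; exact: (bdd_comp (Ys i) bc).
  by rewrite sum_Ex_copy.
have f0 w : 0 <= f w by apply: sumr_ge0 => i _; apply: capf_ge0; exact: ltW.
rewrite /capG mulrA -Ef; apply: le_trans (Ex_markov P bf f0 la0).
apply: le_Pr.
- by apply: measurable_set_lt; [exact: measurable_cst|exact: measurable_partial_sum].
- by apply: measurable_set_le; [exact: measurable_cst|exact: bf.1].
move=> w /= Sla; rewrite /f.
have [/existsP[i laY]|/existsPn nla] := boolP [exists i : 'I_n, la <= Ys i w].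
  rewrite (bigD1 i)//=; apply: (@le_trans _ _ (capf la (Ys i w))).
    by rewrite /capf le_min lexx andbT le_max laY.
  by rewrite lerDl; apply: sumr_ge0 => j _; apply: capf_ge0; exact: ltW.
apply: le_trans (ltW Sla) _; apply: ler_sum => i _.
have := nla i; rewrite -ltNge => Yla.
by rewrite /capf le_min (ltW Yla) andbT le_max lexx.
Qed.

Lemma gtf_sqr z y : gtf z y ^+ 2 = gtf z y :> R.
Proof. by rewrite /gtf; case: (_ < _); rewrite ?expr1n ?expr0n. Qed.

Lemma Pr_few_exceedances z n (K : R) : 0 < n%:R * tail Y z -> 2 * K <= n%:R * tail Y z ->
  Pr P [set w | exceedances z n w < K] <= 4 / (n%:R * tail Y z).
Proof.
move=> np0 Knp; set np := n%:R * tail Y z in np0 Knp *.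
have cheb := @chebyshev_sum _ _ _ P n (fun i w => gtf z (Ys i w)) (np / 2)
  (fun i => bdd_comp (Ys i) (bdd_gtf z)) (fun i j ij => Ex_copy2 (bdd_gtf z) ij) ltac:(lra).
rewrite (sum_Ex_copy _ (bdd_gtf z)) Ex_gtf -/np in cheb.
rewrite [X in _ <= X / _](_ : _ = np) in cheb; last first.
  under eq_bigr do under [X in Ex P X]funext do rewrite gtf_sqr.
  by rewrite (sum_Ex_copy _ (bdd_gtf z)) Ex_gtf.
have -> : 4 / np = np / (np / 2) ^+ 2 by field; rewrite gt_eqF.
apply: le_trans cheb; apply: le_Pr.
- by apply: measurable_set_lt; [exact: (bdd_exceedances _ _).1|exact: measurable_cst].
- apply: measurable_dist_ge.
  exact: (bdd_exceedances _ _).1.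
by move=> w /=; rewrite /exceedances distrC => h; apply: le_trans (ler_norm _); lra.
Qed.

(** For an integer N >= 0, 2N - N^2 is 1 at N = 1 and at most 0 otherwise, so 2 E N - E N^2 is a
    lower bound; moreover E N^2 <= np + (np)^2. *)
Lemma Pr_one_exceedance z n : Pr P [set w | exceedances z n w = 1] >=
  n%:R * tail Y z - (n%:R * tail Y z) ^+ 2.
Proof.
set np := n%:R * tail Y z.
have bN := bdd_exceedances z n.
have mE : measurable [set w | exceedances z n w = 1].
  rewrite (_ : [set w | _] = exceedances z n @^-1` [set 1])//.
  by rewrite -[X in measurable X]setTI; exact: bN.1.
have E2 : Ex P (fun w => exceedances z n w ^+ 2) <= np + np ^+ 2.
  apply: le_trans (@Ex_sum_sqr _ _ _ P n (fun i w => gtf z (Ys i w))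
    (fun i => bdd_comp (Ys i) (bdd_gtf z)) (fun i j ij => Ex_copy2 (bdd_gtf z) ij)) _.
  under eq_bigr do under [X in Ex P X]funext do rewrite gtf_sqr.
  by rewrite (sum_Ex_copy _ (bdd_gtf z)) Ex_gtf.
have b2 : bounded_measurable (fun w => exceedances z n w ^+ 2).
  exact: bdd_sqr.
have b1 : bounded_measurable (fun w => 2 * exceedances z n w) by apply: bddM => //; exact: bdd_cst.
rewrite -Ex_indic//; apply: (@le_trans _ _ (Ex P (fun w => 2 * exceedances z n w - exceedances z n w ^+ 2))).
  by rewrite ExB// ExZ// Ex_exceedances -/np; lra.
apply: le_Ex => [||w]; [exact: bddB|exact: bdd_indic|].
have [m Em] : exists m : nat, exceedances z n w = m%:R.
  by exists (\sum_(i < n) (z < Ys i w)%R)%N; rewrite natr_sum.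
rewrite Em indicE; case: m Em => [|[|m]] Em.
- by rewrite mulr0 expr0n subr0 ler0n.
- by rewrite mem_set//= expr1n; lra.
apply: (@le_trans _ _ 0) => //.
rewrite subr_le0 expr2 ler_wpM2r ?ler0n// ler_nat//.
Qed.

(** No exceedance has probability (1-p)^n, and (1-p)^n (1+np) <= (1-p)^n (1+p)^n <= 1 by Bernoulli's
    inequality. The lower bound is positive however small np > 0 is. *)
Lemma Pr_some_exceedance z n :
  1 - (1 + n%:R * tail Y z)^-1 <= Pr P [set w | 1 <= exceedances z n w].
Proof.
have bN := bdd_exceedances z n.
have mE : measurable [set w | 1 <= exceedances z n w].
  by apply: measurable_set_le; [exact: measurable_cst|exact: bN.1].
suff : Pr P (~` [set w | 1 <= exceedances z n w]) <= (1 + n%:R * tail Y z)^-1.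
  by rewrite Pr_setC//; lra.
have -> : ~` [set w | 1 <= exceedances z n w] = cylinder Ys n (fun=> `]-oo, z]%classic).
  apply/seteqP; split => w /=.
    move=> /negP; rewrite -ltNge => h i /= ni; rewrite in_itv/= leNgt; apply/negP => zY.
    move: h; apply/negP; rewrite -leNgt /exceedances (bigD1 (Ordinal ni))//= /gtf zY.
    by rewrite lerDl; apply: sumr_ge0 => j _; rewrite ler0n.
  move=> h; apply/negP; rewrite -ltNge /exceedances big1// => i _.
  by have := h i (ltn_ord i); rewrite /= in_itv/= /gtf ltNge => ->.
rewrite mutually_independent_cylinder//; last exact: iidY.1.
set p := tail Y z; have p0 : 0 <= p := tail_ge0 Y z; have p1 : p <= 1 := tail_le1 Y z.
rewrite (eq_bigr (fun=> 1 - p)); last first.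
  move=> i _; rewrite (same_distribution_Pr (iidY.2 i))// /p /tail Pr_gt opprB addrC subrK.
  by congr Pr; apply/seteqP; split => w /=; rewrite in_itv.
rewrite prodr_const card_ord.
have n0 : 0 <= n%:R :> R by exact: ler0n.
have np0 : 0 <= n%:R * p by exact: mulr_ge0.
rewrite -[leRHS]div1r ler_pdivlMr; last by lra.
have bern : 1 + n%:R * p <= (1 + p) ^+ n.
  elim: (n) => [|k IH]; first by rewrite expr0 mul0r addr0.
  rewrite exprS; apply: (@le_trans _ _ ((1 + p) * (1 + k%:R * p))).
    rewrite -natr1; have : 0 <= k%:R * p * p by rewrite !mulr_ge0// ler0n.
    nra.
  by rewrite ler_wpM2l//; lra.
apply: (@le_trans _ _ ((1 - p) ^+ n * (1 + p) ^+ n)).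
  by rewrite ler_wpM2l// exprn_ge0//; lra.
rewrite -exprMn exprn_ile1//; nra.
Qed.

Lemma Pr_truncated_sum z n (a : R) : 0 <= z -> 0 < a ->
  Pr P [set w | a <= `|truncated_sum z n w - n%:R * truncm Y z|] <=
    n%:R * (z * truncm Y z) / a ^+ 2.
Proof.
move=> z0 a0; have bt := bdd_truncf z0.
have := @chebyshev_sum _ _ _ P n (fun i w => truncf z (Ys i w)) a
  (fun i => bdd_comp (Ys i) bt) (fun i j ij => Ex_copy2 bt ij) a0.
rewrite (sum_Ex_copy _ bt) => h; apply: le_trans h _.
rewrite ler_pM2r ?invr_gt0 ?exprn_gt0//.
have b2 : bounded_measurable (fun y => truncf z y ^+ 2).
  exact: bdd_sqr.
rewrite (sum_Ex_copy _ b2) ler_wpM2l ?ler0n//.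
exact: truncm_sqr.
Qed.

Lemma partial_sum_truncated z n w : exceedances z n w < 1 ->
  partial_sum n w = truncated_sum z n w.
Proof.
move=> h; apply: eq_bigr => i _; rewrite /truncf Ys_ge0/=; case: ifP => // /negbT.
rewrite -ltNge => zY; move: h; apply: contraTeq => _; rewrite -leNgt.
rewrite /exceedances (bigD1 i)//= {1}/gtf zY lerDl.
by apply: sumr_ge0 => j _; rewrite ler0n.
Qed.

End iid_sums.

(** * Regular tails *)

Definition regular_tail d (T : measurableType d) (R : realType) (P : probability T R)
    (Y : {RV P >-> R}) (x0 c rho : R) : Prop :=
  [/\ 0 < x0, 0 < c, c <= 1, 0 < rho & rho < 1] /\
  forall x, x0 <= x -> c * capG Y x <= tail Y (c * x) /\ capG Y (2 * x) <= rho * capG Y x.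

Lemma exp_small (R : realType) (rho e : R) : 0 < rho -> rho < 1 -> 0 < e ->
  exists k : nat, rho ^+ k <= e.
Proof.
move=> r0 r1 e0; have : `|rho| < 1 by rewrite gtr0_norm.
move=> /cvg_expr /cvgn_distP /(_ _ e0)[N /(_ N (leqnn _))].
by rewrite subr0 (ger0_norm (exprn_ge0 _ (ltW r0))) => h; exists N.
Qed.

Section norming.
Context d0 (T0 : measurableType d0) (R : realType) (P0 : probability T0 R).
Variable Y : {RV P0 >-> R}.
Hypothesis ndY : non_degenerate Y.
Hypothesis Y_ge0 : forall w, 0 <= Y w.

(** a_n is the least power of 2 with n G(a_n) <= 1; it exists since G tends to 0, and it diverges
    since G > 0. Minimality and G(a_n/2) <= 2 G(a_n) give the lower bound 1/2 as soon as a_n >= 2,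
    when a_n/2 is itself a candidate. *)
Lemma norming_sequence : exists a : R^nat, [/\ forall n, 0 < a n,
  forall A, exists N, forall n, (N <= n)%N -> A <= a n,
  forall n, n%:R * capG Y (a n) <= 1 &
  exists N, forall n, (N <= n)%N -> 1 / 2 <= n%:R * capG Y (a n)].
Proof.
have H n : exists j : nat, n%:R * capG Y (2 ^+ j) <= 1 /\
    forall i, (i < j)%N -> 1 < n%:R * capG Y (2 ^+ i).
  have [x0 [x00 x0P]] := @capG_small _ _ _ _ Y (n.+1%:R^-1) ltac:(by rewrite invr_gt0).
  have ex : exists j : nat, n%:R * capG Y (2 ^+ j) <= 1.
    have [k kP] := @exp_small _ (1/2 : R) (x0^-1) ltac:(lra) ltac:(lra) ltac:(by rewrite invr_gt0).
    exists k; apply: (@le_trans _ _ (n%:R * n.+1%:R^-1)).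
      rewrite ler_wpM2l// x0P// -[leRHS]invrK -[leLHS]invrK lef_pV2 ?posrE ?invr_gt0 ?exprn_gt0//.
      by rewrite -exprVn; apply: le_trans kP; rewrite div1r.
    by rewrite ler_pdivrMr// mul1r ler_nat.
  have [j Pj jmin] := ex_minnP ex; exists j; split => // i ij.
  by rewrite ltNge; apply/negP => /jmin; rewrite leqNgt ij.
have [j jP] := boolp.choice H.
have G0 (x : R) : 0 < x -> 0 < capG Y x by exact: capG_gt0.
have a0 n : 0 < 2 ^+ j n :> R by exact: exprn_gt0.
have ainf (A : R) : exists N, forall n, (N <= n)%N -> A <= 2 ^+ j n.
  pose B := Num.max A 1; have B0 : 0 < B by rewrite /B lt_max ltr01 orbT.
  have [N NP] := ceil_nat ((capG Y B)^-1).
  exists N.+1 => n Nn; rewrite leNgt; apply/negP => h.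
  have : capG Y B <= capG Y (2 ^+ j n).
    by apply: capG_nonincr => //; rewrite /B le_max (ltW h).
  move=> /(ler_wpM2l (ler0n _ n)) h1.
  have := le_trans h1 (jP n).1; apply/negP; rewrite -ltNge -ltr_pdivrMr ?G0//.
  by rewrite mul1r; apply: le_lt_trans NP _; rewrite ltr_nat.
exists (fun n => 2 ^+ j n); split => //; first by move=> n; exact: (jP n).1.
have [N NP] := ainf 2; exists N => n Nn.
have := NP n Nn; have := (jP n).2; case: (j n) => [|i] hi.
  by rewrite expr0; lra.
move=> _; have h1 := hi i (ltnSn _).
have h2 : capG Y (2 ^+ i) <= 2 * capG Y (2 ^+ i.+1).
  by rewrite exprS; apply: capG_scale => //; lra.
have h3 := ler_wpM2l (ler0n _ n) h2; rewrite (mulrCA n%:R 2) in h3.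
by rewrite ler_pdivrMr//; apply: le_trans (ltW h1) _; rewrite [leRHS]mulrC.
Qed.

Variables (x0 c rho : R).
Hypothesis regY : regular_tail Y x0 c rho.

Lemma capG_decay k (x : R) : x0 <= x -> capG Y (2 ^+ k * x) <= rho ^+ k * capG Y x.
Proof.
have [[x00 c0 c1 r0 r1] H] := regY.
move=> xx; elim: k => [|k IH]; first by rewrite !expr0 !mul1r.
have h1 : x0 <= 2 ^+ k * x.
  have k1 : 1 <= 2 ^+ k :> R by apply: exprn_ege1; lra.
  by apply: (le_trans xx); rewrite ler_peMl//; exact: ltW (lt_le_trans x00 xx).
rewrite !exprS -!mulrA; apply: le_trans (H _ h1).2 _.
by rewrite ler_pM2l.
Qed.

Variable a : R^nat.
Hypothesis a_gt0 : forall n, 0 < a n.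
Hypothesis a_infty : forall A, exists N, forall n, (N <= n)%N -> A <= a n.
Hypothesis a_le1 : forall n, n%:R * capG Y (a n) <= 1.
Hypothesis a_ge : exists N, forall n, (N <= n)%N -> 1 / 2 <= n%:R * capG Y (a n).

Context d (T : measurableType d) (P : probability T R).
Variable Ys : nat -> {RV P >-> R}.
Hypothesis iidY : iid_copies Ys Y.
Hypothesis Ys_ge0 : forall i w, 0 <= Ys i w.

Lemma partial_sum_tight (e : R) : 0 < e -> exists M N, 0 < M /\ forall n, (N <= n)%N ->
  Pr P [set w | M * a n < partial_sum Ys n w] <= e.
Proof.
have [[x00 c0 c1 r0 r1] H] := regY.
move=> e0; have [k kP] := exp_small r0 r1 e0; have [N NP] := a_infty x0.
have M0 : 0 < 2 ^+ k :> R by exact: exprn_gt0.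
exists (2 ^+ k), N; split => // n Nn.
have la0 : 0 < 2 ^+ k * a n by rewrite mulr_gt0.
apply: le_trans (partial_sum_gt_le iidY _ la0) _.
apply: (@le_trans _ _ (n%:R * (rho ^+ k * capG Y (a n)))).
  by rewrite ler_wpM2l// capG_decay// NP.
rewrite mulrCA; apply: le_trans kP; rewrite ler_piMr// ?exprn_ge0 ?ltW//.
Qed.

Lemma exceedance_partial_sum (z : R) n w : 1 <= exceedances Ys z n w -> z < partial_sum Ys n w.
Proof.
apply: contraTT; rewrite -leNgt -ltNge => h.
rewrite /exceedances big1// => i _; rewrite /gtf ltNge; case: leP => // Yz.
suff : Ys i w <= partial_sum Ys n w by move=> h2; have := le_lt_trans (le_trans h2 h) Yz; rewrite ltxx.
rewrite /partial_sum (bigD1 i)//= lerDl; exact: sumr_ge0.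
Qed.

(** As v is arbitrary, limits of S_n / a_n have unbounded support and cannot be degenerate. One
    summand beyond c 2^k a_n >= v a_n is enough, and the expected number of these is at least c 2^-k
    n G(a_n) >= c 2^-k / 2 = [q0]. *)
Lemma partial_sum_unbounded (v : R) : exists q N, 0 < q /\ forall n, (N <= n)%N ->
  q <= Pr P [set w | v * a n < partial_sum Ys n w].
Proof.
have [[x00 c0 c1 r0 r1] H] := regY.
have [N1 N1P] := a_infty x0; have [N2 N2P] := a_ge.
have [k kP] : exists k : nat, v <= c * 2 ^+ k.
  have [k kP] := @exp_small _ (1 / 2 : R) ((`|v| / c + 1)^-1) ltac:(lra) ltac:(lra)
    ltac:(by rewrite invr_gt0 ltr_wpDl// divr_ge0// ltW).
  exists k; apply: le_trans (ler_norm _) _; rewrite mulrC -ler_pdivrMr//.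
  have x1 : 0 < `|v| / c + 1 by rewrite ltr_wpDl// divr_ge0// ltW.
  suff : `|v| / c + 1 <= 2 ^+ k by lra.
  rewrite -[leRHS]invrK -[leLHS]invrK lef_pV2 ?posrE ?invr_gt0 ?exprn_gt0//.
  by rewrite -exprVn; move: kP; rewrite div1r.
pose q0 : R := c * (2 ^+ k)^-1 / 2.
have k0 : 0 < 2 ^+ k :> R by exact: exprn_gt0.
have q00 : 0 < q0 by rewrite /q0 !mulr_gt0 ?invr_gt0.
have q01 : (1 + q0)^-1 < 1 by rewrite invf_lt1; lra.
exists (1 - (1 + q0)^-1), (maxn N1 N2); split; first by lra.
move=> n; rewrite geq_max => /andP[/N1P an1 /N2P an2].
pose z := c * (2 ^+ k * a n).
have z0 : 0 < z by rewrite /z !mulr_gt0.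
have h1 : x0 <= 2 ^+ k * a n.
  by apply: le_trans an1 _; rewrite ler_peMl ?(ltW (a_gt0 n))// exprn_ege1//; lra.
have h2 : q0 <= n%:R * tail Y z.
  apply: (@le_trans _ _ (n%:R * (c * capG Y (2 ^+ k * a n)))); last first.
    by rewrite ler_wpM2l//; exact: (H _ h1).1.
  have h3 : capG Y (a n) <= 2 ^+ k * capG Y (2 ^+ k * a n).
    by apply: capG_scale => //; rewrite exprn_ege1//; lra.
  have h4 : (2 ^+ k)^-1 * capG Y (a n) <= capG Y (2 ^+ k * a n) by rewrite ler_pdivrMl.
  apply: (@le_trans _ _ (n%:R * (c * ((2 ^+ k)^-1 * capG Y (a n))))); last first.
    by rewrite ler_wpM2l// ler_pM2l.
  have -> : n%:R * (c * ((2 ^+ k)^-1 * capG Y (a n))) = c * (2 ^+ k)^-1 * (n%:R * capG Y (a n)) by ring.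
  by rewrite /q0 ler_pM2l ?mulr_gt0 ?invr_gt0// -div1r.
apply: (@le_trans _ _ (1 - (1 + n%:R * tail Y z)^-1)).
  by rewrite lerB// lef_pV2 ?posrE; lra.
apply: le_trans (Pr_some_exceedance iidY z n) _; apply: le_Pr.
- apply: measurable_set_le; [exact: measurable_cst|].
  exact: (bdd_exceedances Ys z n).1.
- by apply: measurable_set_lt; [exact: measurable_cst|exact: measurable_partial_sum].
move=> w /= /exceedance_partial_sum; apply: le_lt_trans.
by rewrite /z mulrA ler_pM2r.
Qed.

(** Going down k dyadic steps from a_n multiplies n G by at least rho^-k, so the expected number of
    exceedances reaches 2K + 4/tau, and Chebyshev's inequality leaves at most tau for fewer than K.
    In the choice of k, the factor c comes from regularity and 1/2 from n G(a_n) >= 1/2. *)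
Lemma many_exceedances (K : nat) (tau : R) : 0 < tau -> exists th N, 0 < th /\
  forall n, (N <= n)%N -> Pr P [set w | exceedances Ys (th * a n) n w < K%:R] <= tau.
Proof.
have [[x00 c0 c1 r0 r1] H] := regY.
move=> tau0; have [N2 N2P] := a_ge.
have [k kP] := @exp_small _ rho (c / 2 / (2 * K%:R + 4 / tau)) r0 r1
  ltac:(by rewrite !divr_gt0// ltr_wpDl ?divr_gt0// mulr_ge0).
have [N1 N1P] := a_infty (2 ^+ k * x0).
have k0 : 0 < 2 ^+ k :> R by exact: exprn_gt0.
exists (c / 2 ^+ k), (maxn N1 N2); split; first by rewrite divr_gt0.
move=> n; rewrite geq_max => /andP[/N1P an1 /N2P an2].
pose y := a n / 2 ^+ k.
have y0 : x0 <= y by rewrite /y ler_pdivlMr// mulrC.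
have ya : 2 ^+ k * y = a n by rewrite /y mulrC divfK// gt_eqF.
have zE : c / 2 ^+ k * a n = c * y by rewrite /y; ring.
have h1 : 2 * K%:R + 4 / tau <= n%:R * tail Y (c * y).
  apply: (@le_trans _ _ (n%:R * (c * capG Y y))); last first.
    by rewrite ler_wpM2l//; exact: (H _ y0).1.
  have := capG_decay k y0; rewrite ya => h2.
  have rk : 0 < rho ^+ k by exact: exprn_gt0.
  have h3 : capG Y (a n) / rho ^+ k <= capG Y y by rewrite ler_pdivrMr// mulrC.
  apply: (@le_trans _ _ (n%:R * (c * (capG Y (a n) / rho ^+ k)))); last first.
    by rewrite ler_wpM2l// ler_pM2l.
  have -> : n%:R * (c * (capG Y (a n) / rho ^+ k)) = (n%:R * capG Y (a n)) * c / rho ^+ k by ring.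
  rewrite ler_pdivlMr//.
  have t4 : 0 < 4 / tau by rewrite divr_gt0.
  have q0 : 0 < 2 * K%:R + 4 / tau by rewrite ltr_wpDl// mulr_ge0.
  move: kP; rewrite ler_pdivlMr// mulrC => kP; apply: le_trans kP _.
  by rewrite mulrC ler_pM2r//; lra.
have t4 : 0 < 4 / tau by rewrite divr_gt0.
have K0 : 0 <= K%:R :> R by exact: ler0n.
rewrite zE; apply: le_trans (Pr_few_exceedances iidY _ _) _; [lra|lra|].
rewrite ler_pdivrMr; last by lra.
have := ler_wpM2l (ltW tau0) h1; rewrite mulrDr (mulrC tau (4 / tau)) divfK ?gt_eqF//.
have k1 := mulr_ge0 (ltW tau0) (mulr_ge0 (ler0n R 2) K0).
by move=> h; apply: le_trans h; rewrite lerDr.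
Qed.

End norming.

(** * Reduction to variables that are nonnegative everywhere *)

Lemma Pr_eq_off_null d (T : measurableType d) (R : realType) (P : probability T R)
    (A B N : set T) : measurable A -> measurable B -> measurable N ->
  Pr P N = 0 -> (forall w, ~ N w -> A w <-> B w) -> Pr P A = Pr P B.
Proof.
move=> mA mB mN N0 AB.
have H (C D : set T) : measurable C -> measurable D -> (forall w, ~ N w -> C w -> D w) ->
    Pr P C <= Pr P D.
  move=> mC mD CD; rewrite -[leRHS]addr0 -N0; apply: (le_trans _ (Pr_setU _ mD mN)).
  apply: le_Pr => //; first exact: measurableU.
  by move=> w Cw; have [Nw|Nw] := pselect (N w); [right|left; exact: CD].
by apply/eqP; rewrite eq_le !H// => w /AB [].
Qed.

Section positive_part.
Context d (T : measurableType d) (R : realType) (P : probability T R).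

(** Y >= 0 holds only almost surely, and for its copies only through their law. The positive part
    has the same law and is nonnegative at every point, so pointwise estimates of sums are free of
    exceptional sets, and events change by a null set only. *)
Definition pos_part (Y : {RV P >-> R}) (w : T) : R := Num.max (Y w) 0.

Lemma measurable_pos_part Y : measurable_fun [set: T] (pos_part Y).
Proof. by apply: measurable_maxr => //; exact: measurable_funPT. Qed.

HB.instance Definition _ Y :=
  isMeasurableFun.Build _ _ _ _ (pos_part Y) (measurable_pos_part Y).

Lemma pos_part_ge0 (Y : {RV P >-> R}) w : 0 <= pos_part Y w.
Proof. by rewrite /pos_part le_max lexx orbT. Qed.

Lemma pos_part_id (Y : {RV P >-> R}) w : 0 <= Y w -> pos_part Y w = Y w.
Proof. by move=> Y0; rewrite /pos_part max_l. Qed.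

Lemma pos_part_same_distribution (Y : {RV P >-> R}) : {ae P, forall w, 0 <= Y w} ->
  same_distribution Y (pos_part Y : {RV P >-> R}).
Proof.
move=> aeY A mA; rewrite /distribution /pushforward.
have mN : measurable [set w | Y w < 0].
  by apply: measurable_set_lt; [exact: measurable_funPT|exact: measurable_cst].
have mYA := measurable_RV_preimage Y mA.
have mYA' := measurable_RV_preimage (pos_part Y : {RV P >-> R}) mA.
rewrite -(EFin_Pr P mYA) -(EFin_Pr P mYA'); congr EFin.
apply: (Pr_eq_off_null mYA mYA' mN); last first.
  by move=> w /negP; rewrite -leNgt => Yw; rewrite /preimage /= pos_part_id.
rewrite /Pr; have : P.-negligible (~` [set w | 0 <= Y w]) := aeY.
rewrite (_ : ~` _ = [set w | Y w < 0]); last first.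
  by apply/seteqP; split => w /=; rewrite ltNge => /negP.
by move=> /(measure_negligible mN) h; rewrite [P _]h.
Qed.

End positive_part.

Section positive_part_sequences.
Context d0 (T0 : measurableType d0) (R : realType) (P0 : probability T0 R).
Variable Y : {RV P0 >-> R}.
Hypothesis Y_ge0 : forall w, 0 <= Y w.
Context d (T : measurableType d) (P : probability T R).
Variable Ys : nat -> {RV P >-> R}.
Hypothesis iidY : iid_copies Ys Y.

Definition pos_seq (i : nat) : {RV P >-> R} := pos_part (Ys i).

Lemma pos_seq_ge0 i w : 0 <= pos_seq i w. Proof. exact: pos_part_ge0. Qed.

Let phi (y : R) : R := Num.max y 0.

Let mphi A : measurable A -> measurable (phi @^-1` A).
Proof.
move=> mA; rewrite -[X in measurable X]setTI.
by apply: (measurable_maxr (D := setT)).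
Qed.

Lemma iid_pos_seq : iid_copies pos_seq Y.
Proof.
have [iY sY] := iidY; split.
  by move=> J A mA; exact: (iY J (fun i => phi @^-1` A i) (fun i => mphi (mA i))).
move=> i A mA; have := sY i _ (mphi mA); rewrite /distribution /pushforward => h.
apply: etrans h _; congr (P0 _); apply/seteqP; split => w /=; by rewrite /phi max_l.
Qed.

Lemma pos_seq_independent (Xs : nat -> {RV P >-> R}) :
  independent_sequences Xs Ys -> independent_sequences Xs pos_seq.
Proof.
move=> iXY E F sE sF; apply: iXY => //; move: F sF.
apply: smallest_sub; first exact: smallest_sigma_algebra.
move=> _ [i _ [A mA <-]]; apply: sub_sigma_algebra; exists i => //.
by exists (phi @^-1` A) => //; exact: mphi.
Qed.

Let neg : set T := \bigcup_i [set w | Ys i w < 0].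

Let mneg_i i : measurable [set w | Ys i w < 0].
Proof. by apply: measurable_set_lt; [exact: measurable_funPT|exact: measurable_cst]. Qed.

Let mneg : measurable neg. Proof. exact: bigcup_measurable. Qed.

Let neg0 : Pr P neg = 0.
Proof.
rewrite /Pr; suff -> : P neg = 0%E by [].
apply/eqP; rewrite eq_le measure_ge0 andbT.
apply: le_trans (generalized_Boole_inequality _ mneg_i _) _; first exact: mneg.
rewrite eseries0// => i _ _.
have := iidY.2 i `]-oo, 0[%classic (measurable_itv _).
rewrite /distribution /pushforward => h.
transitivity (P (Ys i @^-1` `]-oo, 0[%classic)).
  by congr (P _); apply/seteqP; split => w /=; rewrite in_itv.
rewrite h (_ : _ @^-1` _ = set0) ?measure0//.
by apply/seteqP; split => w //=; rewrite in_itv/= ltNge Y_ge0.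
Qed.

Lemma Pr_pos_seq (A B : set T) : measurable A -> measurable B ->
  (forall w, (forall i, pos_seq i w = Ys i w) -> A w <-> B w) -> Pr P A = Pr P B.
Proof.
move=> mA mB AB; apply: (Pr_eq_off_null mA mB mneg neg0) => w negw; apply: AB => i.
apply: pos_part_id; rewrite leNgt; apply/negP => Yi; apply: negw; by exists i.
Qed.

Lemma rcdf_normed_sum_pos (a b : R^nat) n x :
  rcdf (normed_sum Ys a b n : {RV P >-> R}) x = rcdf (normed_sum pos_seq a b n : {RV P >-> R}) x.
Proof.
apply: Pr_pos_seq; do ?exact: measurable_RV_le.
move=> w E; rewrite /mkset /= /normed_sum.
by under [X in _ <-> (_ * (X - _) <= _)]eq_bigr do rewrite E.
Qed.

Lemma rcdf_weighted_mean_pos (Xs : nat -> {RV P >-> R}) n x :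
  rcdf (weighted_mean Xs Ys n : {RV P >-> R}) x = rcdf (weighted_mean Xs pos_seq n : {RV P >-> R}) x.
Proof.
apply: Pr_pos_seq; do ?exact: measurable_RV_le.
move=> w E; rewrite /mkset /= /weighted_mean.
under [X in _ <-> (X / _ <= _)]eq_bigr do rewrite E.
by under [X in _ <-> (_ / X <= _)]eq_bigr do rewrite E.
Qed.

End positive_part_sequences.

(** * Regular tails: Feller limits of the sums and continuous limits of the means *)

Section regular_feller.
Context d0 (T0 : measurableType d0) (R : realType) (P0 : probability T0 R).
Variable Y : {RV P0 >-> R}.
Hypothesis ndY : non_degenerate Y.
Hypothesis Y_ge0 : forall w, 0 <= Y w.
Variables (x0 c rho : R).
Hypothesis regY : regular_tail Y x0 c rho.

Lemma rcdf_normed_sum d (T : measurableType d) (P : probability T R)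
    (Ys : nat -> {RV P >-> R}) (a : R^nat) n x : (forall n, 0 < a n) ->
  1 - rcdf (normed_sum Ys a (fun=> 0) n : {RV P >-> R}) x = Pr P [set w | x * a n < partial_sum Ys n w].
Proof.
move=> a0; rewrite -Pr_gt; congr Pr; apply/seteqP; split => w; rewrite /mkset /= /normed_sum /partial_sum subr0.
  by rewrite ltr_pdivlMl// mulrC.
by rewrite ltr_pdivlMl// mulrC.
Qed.

(** Tightness and Helly's theorem give a limit W. If W were the constant c0, its distribution
    function would be 1 at a continuity point x > c0, while P(S_n > x a_n) stays bounded away from
    0. *)
Lemma regular_tail_feller : centered_feller_class Y.
Proof.
have [a [a0 ainf a1 a2]] := norming_sequence ndY Y_ge0.
exists a; split => //.
  apply/cvgryPger => A _; have [N NP] := ainf A.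
  by exists N => // n /=; exact: NP.
move=> d1 T1 P1 Ys iidY phi incphi.
have iidP := iid_pos_seq Y_ge0 iidY.
have P_ge0 := @pos_seq_ge0 _ _ _ _ Ys.
pose U k : {RV P1 >-> R} := normed_sum Ys a (fun=> 0) (phi k).
have UE k x : rcdf (U k) x = 1 - Pr P1 [set w | x * a (phi k) < partial_sum (pos_seq Ys) (phi k) w].
  by rewrite /U (rcdf_normed_sum_pos Y_ge0 iidY) -(rcdf_normed_sum (pos_seq Ys))//; lra.
have [|psi incpsi [d2 [T2 [Q [W UW]]]]] := @helly_RV _ _ _ _ U.
  move=> e e0; have [M [N [M0 MP]]] := partial_sum_tight regY a0 ainf a1 iidP e0.
  exists M, N => k Nk.
  have Nphi : (N <= phi k)%N by apply: leq_trans Nk _; exact: increasing_seq_ge.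
  split; last by rewrite UE lerB//; exact: MP.
  rewrite UE (_ : [set w | _] = setT); first by rewrite Pr_setT; lra.
  apply/seteqP; split => w //= _; apply: (@lt_le_trans _ _ 0).
    by rewrite mulNr oppr_lt0 mulr_gt0.
  exact: partial_sum_ge0.
exists psi => //; exists d2, T2, Q, W; split; last exact: UW.
move=> [c0 Wc].
have [x [cx _ xc]] := @continuity_point_dense _ _ _ _ W c0 (c0 + 1) ltac:(lra).
have Fx : rcdf W x = 1.
  apply/eqP; rewrite eq_le rcdf_le1/=.
  have mc : measurable (W @^-1` [set c0]) by exact: measurable_RV_preimage.
  have <- : Pr Q (W @^-1` [set c0]) = 1 by rewrite /Pr Wc.
  by apply: le_Pr => //; [exact: measurable_RV_le|move=> w /= ->; exact: ltW].
have [q [N [q0 NP]]] := partial_sum_unbounded regY a0 ainf a2 iidP P_ge0 x.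
have [N' N'P] := cvg_in_distributionP UW xc (e := q / 2) ltac:(lra).
pose k := maxn N N'.
have := N'P k (leq_maxr _ _); rewrite Fx UE ler_norml.
have hk : (N <= phi (psi k))%N.
  apply: leq_trans (leq_maxl N N') _; apply: (leq_trans (increasing_seq_ge k incpsi)).
  exact: increasing_seq_ge.
have := NP _ hk; set p := Pr _ _; move=> ? /andP[]; lra.
Qed.

Lemma weighted_mean_spread d (T : measurableType d) (P : probability T R)
    (Xs Ys : nat -> {RV P >-> R}) d1 (T1 : measurableType d1) (P1 : probability T1 R)
    (X : {RV P1 >-> R}) (t tau : R) :
  non_degenerate X -> iid_copies Xs X -> iid_copies Ys Y ->
  independent_sequences Xs Ys -> (forall i w, 0 <= Ys i w) -> 0 < tau ->
  exists (e : R) (N : nat), 0 < e /\ forall n, (N <= n)%N ->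
    Pr P [set w | `|weighted_mean Xs Ys n w - t| <= e] <= tau.
Proof.
move=> ndX iidX iidY iXY Ys_ge0 tau0.
have [a [a0 ainf a1 a2]] := norming_sequence ndY Y_ge0.
have t3 : 0 < tau / 3 by rewrite divr_gt0.
have tau3 : tau / 3 + (tau / 3 + tau / 3) = tau by field.
have [K [L [L0 conc]]] := concentration ndX t3.
have [th [N1 [th0 N1P]]] := many_exceedances regY ainf a2 iidY K t3.
have [M [N2 [M0 N2P]]] := partial_sum_tight regY a0 ainf a1 iidY t3.
pose eta := th / M; have eta0 : 0 < eta by rewrite divr_gt0.
(* This gives 2e = eta L / 2 < eta L, as [concentration] demands. *)
pose e := eta * L / 4; have e0 : 0 < e by rewrite divr_gt0// mulr_gt0.
exists e, (maxn N1 N2); split => // n; rewrite geq_max => /andP[/N1P h1 /N2P h2].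
(* The mean is written as a function of two numerical sequences, so that its woven and interleaved
   versions become the same event [B] about tuples. *)
pose tm (x y : nat -> R) := (\sum_(i < n) x i * y i) / (\sum_(i < n) y i).
have eq_tm x x' y y' : (forall i, (i < n)%N -> x i = x' i) ->
    (forall i, (i < n)%N -> y i = y' i) -> tm x y = tm x' y'.
  move=> xx yy; rewrite /tm; congr (_ / _); apply: eq_bigr => i _; rewrite ?xx ?yy//.
pose B : set (n.*2.-tuple R) :=
  [set z | `|tm (fun i => nth 0 z i.*2) (fun i => nth 0 z i.*2.+1) - t| <= e].
have mtm d' (S : measurableType d') (x y : nat -> S -> R) :
    (forall i, measurable_fun [set: S] (x i)) -> (forall i, measurable_fun [set: S] (y i)) ->
    measurable [set z | `|tm (x ^~ z) (y ^~ z) - t| <= e].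
  move=> mx my; apply: measurable_dist_le.
  apply: measurable_funM; first by apply: measurable_sum => i; exact: measurable_funM.
  by apply: (measurableT_comp (@measurable_invr R)); apply: measurable_sum.
have mB : measurable B.
  by apply: (mtm _ _ (fun i (z : n.*2.-tuple R) => nth 0 z i.*2) (fun i z => nth 0 z i.*2.+1)) => i;
    exact: measurable_nth_tuple.
have := weave_law iXY mB.
have -> : [set w | B [tuple weave Xs Ys i w | i < n.*2]] = [set w | `|weighted_mean Xs Ys n w - t| <= e].
  apply: eq_set => w; rewrite /B /mkset.
  rewrite (eq_tm _ (fun i => Xs i w) _ (fun i => Ys i w))// => i ni.
    by rewrite (nth_sequence_tuple (fun i => weave Xs Ys i : T -> R)) ?ltn_double// /weave odd_double doubleK.
  by rewrite (nth_sequence_tuple (fun i => weave Xs Ys i : T -> R)) ?ltn_Sdouble// /weave /= odd_double /= uphalf_double.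
pose A := [set z : T * T | `|tm (fun i => Xs i z.1) (fun i => Ys i z.2) - t| <= e].
have -> : [set w | B [tuple interleave Xs Ys i w | i < n.*2]] = A.
  apply: eq_set => w; rewrite /B /mkset.
  rewrite (eq_tm _ (fun i => Xs i w.1) _ (fun i => Ys i w.2))// => i ni.
    by rewrite (nth_sequence_tuple (fun i => interleave Xs Ys i : T * T -> R)) ?ltn_double// /interleave odd_double doubleK.
  by rewrite (nth_sequence_tuple (fun i => interleave Xs Ys i : T * T -> R)) ?ltn_Sdouble// /interleave /= odd_double /= uphalf_double.
move=> ->.
have mA : measurable A.
  by apply: (mtm _ _ (fun i (z : T * T) => Xs i z.1) (fun i z => Ys i z.2)) => i; apply: measurableT_comp.
pose G1 := [set w | exceedances Ys (th * a n) n w < K%:R].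
pose G2 := [set w | M * a n < partial_sum Ys n w].
have mG1 : measurable G1.
  by apply: measurable_set_lt; [exact: (bdd_exceedances _ _ _).1|exact: measurable_cst].
have mG2 : measurable G2.
  by apply: measurable_set_lt; [exact: measurable_cst|exact: measurable_partial_sum].
pose G := G1 `|` G2; have mG : measurable G by exact: measurableU.
have mGs : measurable (snd @^-1` G : set (T * T)).
  exact: measurable_preimage_snd.
have h3 : Pr (P \x P)%E (snd @^-1` G) <= tau / 3 + tau / 3.
  by rewrite Pr_prod_snd//; apply: le_trans (Pr_setU _ mG1 mG2) _; exact: lerD.
have mAG : measurable (A `&` ~` (snd @^-1` G)) by apply: measurableI => //; exact: measurableC.
suff h4 : Pr (P \x P)%E (A `&` ~` (snd @^-1` G)) <= tau / 3.
  apply: (@le_trans _ _ (Pr (P \x P)%E ((A `&` ~` (snd @^-1` G)) `|` (snd @^-1` G)))).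
    apply: le_Pr => //; first exact: measurableU.
    by move=> z Az; have [?|?] := pselect ((snd @^-1` G) z); [right|left].
  by apply: le_trans (Pr_setU _ mAG mGs) _; rewrite -[leRHS]tau3; exact: lerD.
apply: Pr_prod_section => //; first exact: ltW.
move=> y; have [Gy|nGy] := pselect (G y).
  rewrite (_ : ysection _ y = set0) ?Pr_set0; first exact: ltW.
  by apply/seteqP; split => x //; rewrite /ysection/= inE => -[_ /=]; apply.
have [g1 g2] : K%:R <= exceedances Ys (th * a n) n y /\ partial_sum Ys n y <= M * a n.
  by split; rewrite leNgt; apply/negP => h; apply: nGy; [left|right].
pose v i := Ys i y / partial_sum Ys n y.
have cK : (K <= #|[pred i : 'I_n | (eta <= `|v i|)%R]|)%N.
  rewrite -(ler_nat R); apply: le_trans g1 _.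
  rewrite -sum1_card natr_sum [leRHS]big_mkcond/=; apply: ler_sum => i _.
  rewrite inE /gtf; case: ltP => // thY; last by case: ifP.
  suff -> : eta <= `|v i| by [].
  have Yi : 0 < Ys i y by apply: lt_trans thY; rewrite mulr_gt0.
  have YS : Ys i y <= partial_sum Ys n y.
    by rewrite /partial_sum (bigD1 i)//= lerDl; exact: sumr_ge0.
  have S0 : 0 < partial_sum Ys n y by exact: lt_le_trans YS.
  rewrite /v ger0_norm; last by rewrite divr_ge0// ltW.
  rewrite ler_pdivlMr// /eta mulrAC ler_pdivrMr//.
  apply: (@le_trans _ _ (th * (M * a n))); first by rewrite ler_pM2l.
  by rewrite mulrCA mulrC ler_pM2r// ltW.
have := conc _ _ _ Xs iidX n v eta e t (ltW e0) eta0 _ cK.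
move=> /(_ ltac:(rewrite /e; have := mulr_gt0 eta0 L0; lra)); apply: le_trans.
apply: le_Pr.
- exact: measurable_ysection.
- apply: measurable_dist_le.
  by apply: measurable_sum => i; apply: measurable_funM => //; exact: measurable_cst.
move=> x; rewrite /ysection/= inE => -[+ _]; rewrite /A/= /tm.
suff -> : (\sum_(i < n) Xs i x * Ys i y) / (\sum_(i < n) Ys i y) = \sum_(i < n) v i * Xs i x by [].
by rewrite mulr_suml; apply: eq_bigr => i _; rewrite /v /partial_sum; ring.
Qed.

Lemma regular_tail_continuous d (T : measurableType d) (P : probability T R)
    (Xs Ys : nat -> {RV P >-> R}) d1 (T1 : measurableType d1) (P1 : probability T1 R)
    (X : {RV P1 >-> R}) d3 (T3 : measurableType d3) (Q : probability T3 R) (W : {RV Q >-> R}) :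
  non_degenerate X -> iid_copies Xs X -> iid_copies Ys Y -> independent_sequences Xs Ys ->
  subsequential_limit (fun n => weighted_mean Xs Ys n : {RV P >-> R}) W ->
  continuous_distribution W.
Proof.
move=> ndX iidX iidY iXY [phi incphi TW] t.
apply/cdf_continuousP/(nondecreasing_continuousP _ (@rcdf_homo _ _ _ _ W)) => tau tau0.
have [|e [N [e0 NP]]] := weighted_mean_spread t ndX iidX (iid_pos_seq Y_ge0 iidY)
   (pos_seq_independent iXY) (@pos_seq_ge0 _ _ _ _ Ys) (tau := tau / 2).
  by lra.
(* u and v are continuity points within e of t. For T_n the mass of (u, v] is at most tau/2, and the
   two approximation errors of tau/4 complete tau. *)
have [u [tu ut uc]] := @continuity_point_dense _ _ _ _ W (t - e) t ltac:(lra).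
have [v [tv vt vc]] := @continuity_point_dense _ _ _ _ W t (t + e) ltac:(lra).
exists u, v; split => //.
have [N1 N1P] := cvg_in_distributionP TW uc (e := tau / 4) ltac:(lra).
have [N2 N2P] := cvg_in_distributionP TW vc (e := tau / 4) ltac:(lra).
pose k := maxn N (maxn N1 N2).
have := N1P k ltac:(by rewrite /k !leq_max leqnn !orbT).
have := N2P k ltac:(by rewrite /k !leq_max leqnn !orbT).
have := NP (phi k) ltac:(by apply: leq_trans (increasing_seq_ge k incphi); rewrite /k leq_max leqnn).
rewrite /= !(rcdf_weighted_mean_pos Y_ge0 iidY).
set Tk : {RV P >-> R} := weighted_mean Xs (pos_seq Ys) (phi k).
move=> h1; suff : rcdf Tk v - rcdf Tk u <= Pr P [set w | `|weighted_mean Xs (pos_seq Ys) (phi k) w - t| <= e].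
  move: h1; rewrite !ler_norml; set p := Pr _ _ => ? ? /andP[? ?] /andP[? ?]; lra.
rewrite lerBlDl; apply: (le_trans _ (Pr_setU _ _ _)); first last.
- apply: measurable_dist_le.
  exact: (measurable_funPT Tk).
- exact: measurable_RV_le.
apply: le_Pr; first exact: measurable_RV_le.
  apply: measurableU; first exact: measurable_RV_le.
  apply: measurable_dist_le.
  exact: (measurable_funPT Tk).
move=> w /= wv; have [wu|wu] := leP (Tk w) u; [by left|right].
by move: wv wu; rewrite /= /Tk /= ler_norml => ? ?; apply/andP; split; lra.
Qed.

End regular_feller.

(** * Irregular tails *)

Section irregular_tail.
Context d0 (T0 : measurableType d0) (R : realType) (P0 : probability T0 R).
Variable Y : {RV P0 >-> R}.
Hypothesis ndY : non_degenerate Y.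
Hypothesis Y_ge0 : forall w, 0 <= Y w.

(** Negates the first regularity inequality for every constant, at arbitrarily large x;
    [heavy_jumps] negates the second. If each of them failed for some constant, the tail would be
    regular with that c and with rho = 1 - dl. *)
Definition light_jumps : Prop := forall dl x0 : R, 0 < dl -> dl <= 1 -> 0 < x0 ->
  exists2 x, x0 <= x & tail Y (dl * x) < dl * capG Y x.

Definition heavy_jumps : Prop := forall dl x0 : R, 0 < dl -> dl < 1 -> 0 < x0 ->
  exists2 x, x0 <= x & (1 - dl) * capG Y x < capG Y (2 * x).

Lemma irregular_tail_cases : ~ (exists x0 c rho, regular_tail Y x0 c rho) ->
  light_jumps \/ heavy_jumps.
Proof.
move=> nreg; have [?|nl] := pselect light_jumps; first by left.
right=> dl x0 dl0 dl1 x00; apply: contrapT => nh; apply: nl => c x1 c0 c1 x10.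
apply: contrapT => nl; apply: nreg.
exists (Num.max x0 x1), c, (1 - dl); split.
  by split => //; [rewrite lt_max x00|lra|lra].
move=> x; rewrite ge_max => /andP[xx0 xx1]; split.
  by rewrite leNgt; apply/negP => h; apply: nl; exists x.
by rewrite leNgt; apply/negP => h; apply: nh; exists x.
Qed.

(** Here x comes first and n = floor(kap / G(x)) + 1 is fitted to it, because irregularity is known
    only along a sequence of scales. Smallness of G(x) forces n >= N. *)
Lemma count_times (kap x : R) (N : nat) : 0 < kap -> kap <= 1 -> 0 < x ->
    capG Y x <= kap -> capG Y x <= kap / N.+1%:R -> exists n, [/\ (N <= n)%N,
  kap <= n%:R * capG Y x & n%:R * capG Y x <= kap + capG Y x].
Proof.
move=> k0 k1 x0 Gk GN; have G0 := capG_gt0 ndY Y_ge0 x0.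
have q0 : 0 <= kap / capG Y x by rewrite divr_ge0// ltW.
have /andP[h1 h2] := truncn_itv q0.
exists (Num.truncn (kap / capG Y x)).+1; split.
- rewrite -(ler_nat R); apply: (@le_trans _ _ N.+1%:R); first by rewrite ler_nat.
  apply: ltW; apply: le_lt_trans h2.
  by rewrite ler_pdivlMr// mulrC -ler_pdivlMr.
- by rewrite -ler_pdivrMr// ltW.
- by rewrite -natr1 mulrDl mul1r lerD2r -ler_pdivlMr.
Qed.

(** With n G(x) close to 1, splitting E min(Y, x) at dl x shows that nearly all of it is the
    truncated mean. So the truncated sum has mean close to x and second moments adding up to order
    dl x^2, while exceedances of dl x are rare. *)
Lemma light_jumpsP (dl : R) (N : nat) : light_jumps -> 0 < dl -> dl <= 1 ->
  exists n x, [/\ (N <= n)%N, 0 < x, n%:R * tail Y (dl * x) <= 2 * dl,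
    `|n%:R * truncm Y (dl * x) - x| <= dl * x &
    n%:R * (dl * x * truncm Y (dl * x)) <= 2 * dl * x ^+ 2].
Proof.
move=> lj dl0 dl1.
have [x1 [x10 x1P]] := @capG_small _ _ _ _ Y (dl / N.+1%:R) ltac:(by rewrite divr_gt0).
have [x x1x hx] := lj dl x1 dl0 dl1 x10.
have x0 : 0 < x by exact: lt_le_trans x1x.
have GN := x1P _ x1x.
have Gdl : capG Y x <= dl.
  by apply: le_trans GN _; rewrite ler_pdivrMr// ler_peMr ?(ltW dl0)// ler1n.
have G0 := capG_gt0 ndY Y_ge0 x0.
have [||n [Nn n1 n2]] := @count_times 1 x N ltr01 (lexx _) x0.
- by apply: le_trans dl1.
- by apply: le_trans GN _; rewrite ler_pM2r ?invr_gt0.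
exists n, x; split => //.
- apply: (@le_trans _ _ (n%:R * (dl * capG Y x))); first by rewrite ler_wpM2l// ltW.
  by rewrite mulrCA mulrC ler_pM2r//; lra.
- have z0 : 0 < dl * x by exact: mulr_gt0.
  have zx : dl * x <= x by rewrite ler_piMl// ltW.
  have h1 : n%:R * truncm Y (dl * x) <= x * (n%:R * capG Y x).
    by rewrite mulrCA ler_wpM2l// truncm_le_capG.
  have h2 : x * (n%:R * capG Y x) <= n%:R * truncm Y (dl * x) + x * dl * (n%:R * capG Y x).
    have := capm_split Y (ltW z0) zx; rewrite (capmG Y x0) => h.
    have := ler_wpM2l (ler0n R n) h; rewrite mulrCA mulrDr => h'.
    apply: le_trans h' _; rewrite lerD2l.
    rewrite (_ : x * dl * (n%:R * capG Y x) = n%:R * (x * (dl * capG Y x))); last by ring.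
    by rewrite ler_wpM2l// ler_wpM2l ?(ltW x0)// ltW.
  move: h1 h2 n1 n2; set A := n%:R * truncm _ _; set g := n%:R * capG _ _ => h1 h2 n1 n2.
  rewrite ler_norml; apply/andP; split; nra.
- have z0 : 0 < dl * x by exact: mulr_gt0.
  have zx : dl * x <= x by rewrite ler_piMl// ltW.
  have h1 : n%:R * truncm Y (dl * x) <= x * (n%:R * capG Y x).
    by rewrite mulrCA ler_wpM2l// truncm_le_capG.
  rewrite mulrCA (_ : 2 * dl * x ^+ 2 = dl * x * (2 * x)); last by ring.
  rewrite ler_pM2l//; apply: le_trans h1 _; rewrite mulrC ler_pM2r//; lra.
Qed.

(** [capG_drop] makes the truncated mean negligible, so G(x) is comparable to P(Y > x). Fitting n
    G(x) to a small kap instead of 1 leaves probability of order kap for a single exceedance and at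
    most 2 kap for any. *)
Lemma heavy_jumpsP (kap dl : R) (N : nat) : heavy_jumps -> 0 < kap -> kap <= 1 / 4 ->
  0 < dl -> dl <= 1 / 4 ->
  exists n x, [/\ (N <= n)%N, 0 < x, kap / 2 <= n%:R * tail Y x, n%:R * tail Y x <= 2 * kap &
    n%:R * truncm Y x <= dl * x].
Proof.
move=> hj k0 k1 dl0 dl1.
have [x1 [x10 x1P]] := @capG_small _ _ _ _ Y (kap / N.+1%:R) ltac:(by rewrite divr_gt0).
have [x x1x hx] := hj dl x1 dl0 ltac:(lra) x10.
have x0 : 0 < x by exact: lt_le_trans x1x.
have GN := x1P _ x1x.
have Gk : capG Y x <= kap.
  by apply: le_trans GN _; rewrite ler_pdivrMr// ler_peMr ?(ltW k0)// ler1n.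
have G0 := capG_gt0 ndY Y_ge0 x0.
have [n [Nn n1 n2]] := @count_times kap x N k0 ltac:(lra) x0 Gk GN.
have h1 : truncm Y x <= 2 * x * (dl * capG Y x).
  apply: le_trans (capG_drop Y x0) _; rewrite ler_pM2l; last by lra.
  lra.
have h2 : x * capG Y x = truncm Y x + x * tail Y x by rewrite -capmG// capmE// ltW.
have h3 : capG Y x / 2 <= tail Y x.
  rewrite -(ler_pM2l x0).
  have : 2 * x * (dl * capG Y x) <= x * (capG Y x / 2).
    have -> : 2 * x * (dl * capG Y x) = x * capG Y x * (2 * dl) by ring.
    have -> : x * (capG Y x / 2) = x * capG Y x * (1 / 2) by ring.
    by apply: ler_wpM2l; [exact: mulr_ge0 (ltW x0) (ltW G0)|lra].
  lra.
have n0 : 0 <= n%:R :> R by exact: ler0n.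
exists n, x; split => //.
- have := ler_wpM2l n0 h3; rewrite mulrA; lra.
- have := ler_wpM2l n0 (tail_le_capG Y x0); lra.
- apply: le_trans (ler_wpM2l n0 h1) _.
  have -> : n%:R * (2 * x * (dl * capG Y x)) = (n%:R * capG Y x) * 2 * (dl * x) by ring.
  have dx0 : 0 < dl * x by exact: mulr_gt0.
  by rewrite -[leRHS]mul1r ler_pM2r//; lra.
Qed.

Context d (T : measurableType d) (P : probability T R).
Variable Ys : nat -> {RV P >-> R}.
Hypothesis iidY : iid_copies Ys Y.
Hypothesis Ys_ge0 : forall i w, 0 <= Ys i w.

Lemma light_jumps_sum (e : R) (N : nat) : light_jumps -> 0 < e -> e <= 1 / 2 ->
  exists n x, [/\ (N <= n)%N, 0 < x &
    exists dl, [/\ 0 < dl, dl <= e ^+ 3 / 16,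
     `|n%:R * truncm Y (dl * x) - x| <= dl * x,
     n%:R * (dl * x * truncm Y (dl * x)) <= 2 * dl * x ^+ 2 &
     Pr P ([set w | 1 <= exceedances Ys (dl * x) n w] `|`
           [set w | e * x < `|partial_sum Ys n w - x|]) <= e]].
Proof.
(* Chebyshev's inequality at distance (e/2) x gives 2 dl x^2 / (e x / 2)^2 = 8 dl / e^2 = e/2. *)
move=> lj e0 e1; pose dl := e ^+ 3 / 16.
have e3 : 0 < e ^+ 3 by exact: exprn_gt0.
have e2 : 0 < e ^+ 2 by exact: exprn_gt0.
have dl0 : 0 < dl by rewrite /dl; lra.
have e2e : e ^+ 2 <= 1 / 4 by rewrite expr2; nra.
have dle : dl <= e / 64 by rewrite /dl exprS; nra.
have [n [x [Nn x0 h1 h2 h3]]] := light_jumpsP N lj dl0 ltac:(lra).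
exists n, x; split => //; exists dl; split => //.
have z0 : 0 < dl * x by exact: mulr_gt0.
have ex0 : 0 < e / 2 * x by rewrite mulr_gt0//; lra.
have c1 := le_trans (Pr_exceedances_le iidY (dl * x) n) h1.
have c2 : Pr P [set w | e / 2 * x <= `|truncated_sum Ys (dl * x) n w - n%:R * truncm Y (dl * x)|] <= e / 2.
  apply: le_trans (Pr_truncated_sum iidY n (ltW z0) ex0) _.
  rewrite ler_pdivrMr ?exprn_gt0//; apply: le_trans h3 _.
  by rewrite le_eqVlt; apply/orP; left; apply/eqP; rewrite /dl; field.
have m1 : measurable [set w | 1 <= exceedances Ys (dl * x) n w].
  by apply: measurable_set_le; [exact: measurable_cst|exact: (bdd_exceedances _ _ _).1].
have m2 : measurable [set w | e / 2 * x <= `|truncated_sum Ys (dl * x) n w - n%:R * truncm Y (dl * x)|].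
  apply: measurable_dist_ge.
  exact: (bdd_truncated_sum _ _ (ltW z0)).1.
have m3 : measurable [set w | e * x < `|partial_sum Ys n w - x|] by apply: measurable_dist_gt; exact: measurable_partial_sum.
apply: le_trans (le_Pr P _ (measurableU _ _ m1 m2) _) _; first exact: measurableU.
  move=> w [w1|/= w1]; first by left.
  have [h|h] := leP 1 (exceedances Ys (dl * x) n w); [by left|right].
  rewrite /= -(partial_sum_truncated Ys_ge0 h).
  have := ler_normD (partial_sum Ys n w - n%:R * truncm Y (dl * x)) (n%:R * truncm Y (dl * x) - x).
  rewrite addrA subrK => tri.
  have : dl * x <= e / 2 * x by rewrite ler_pM2r//; lra.
  lra.
by apply: le_trans (Pr_setU _ m1 m2) _; lra.
Qed.

(** On the first event S_n is one large summand plus a remainder below e x; it serves the weighted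
    means. The other two bounds locate x and e x relative to the norming constants of a Feller
    sequence. *)
Lemma heavy_jumps_sum (kap e : R) (N : nat) : heavy_jumps -> 0 < kap -> kap <= 1 / 4 ->
  0 < e -> e <= 1 / 2 ->
  exists n x, [/\ (N <= n)%N, 0 < x,
    kap / 8 <= Pr P ([set w | exceedances Ys x n w = 1] `&` [set w | truncated_sum Ys x n w < e * x]),
    kap / 4 <= Pr P [set w | x < partial_sum Ys n w] &
    Pr P [set w | e * x < partial_sum Ys n w] <= 3 * kap].
Proof.
(* By Markov's inequality the truncated sum reaches e x with probability at most dl / e = kap/8.
   With m = n P(Y > x) in [kap/2, 2 kap] and kap <= 1/4, one has m - m^2 >= m/2 >= kap/4. *)
move=> hj k0 k1 e0 e1; pose dl := kap / 8 * e.
have dl0 : 0 < dl by rewrite /dl mulr_gt0//; lra.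
have dl1 : dl <= 1 / 4 by rewrite /dl; nra.
have [n [x [Nn x0 h1 h2 h3]]] := heavy_jumpsP N hj k0 k1 dl0 dl1.
exists n, x; have ex0 : 0 < e * x by exact: mulr_gt0.
have bt := bdd_truncated_sum Ys n (ltW x0).
have c1 : Pr P [set w | e * x <= truncated_sum Ys x n w] <= kap / 8.
  apply: le_trans (Ex_markov P bt _ ex0) _; first by move=> w; apply: sumr_ge0 => i _; exact: truncf_ge0.
  rewrite /truncated_sum (@Ex_sum _ _ _ P n (fun i w => truncf x (Ys i w))); last first.
    by move=> i; exact: (bdd_comp (Ys i) (bdd_truncf (ltW x0))).
  rewrite (sum_Ex_copy iidY _ (bdd_truncf (ltW x0))) ler_pdivrMr//.
  by apply: le_trans h3 _; rewrite /dl mulrA.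
have c2 : kap / 4 <= Pr P [set w | exceedances Ys x n w = 1].
  apply: le_trans (Pr_one_exceedance iidY x n); move: h1 h2; set p := n%:R * _ => h1 h2.
  rewrite expr2; nra.
have mN : measurable [set w | exceedances Ys x n w = 1].
  rewrite (_ : [set w | _] = exceedances Ys x n @^-1` [set 1])//.
  by rewrite -[X in measurable X]setTI; exact: (bdd_exceedances _ _ _).1.
have mt : measurable [set w | truncated_sum Ys x n w < e * x].
  by apply: measurable_set_lt; [exact: bt.1|exact: measurable_cst].
have mt' : measurable [set w | e * x <= truncated_sum Ys x n w].
  by apply: measurable_set_le; [exact: measurable_cst|exact: bt.1].
have mS z : measurable [set w | z < partial_sum Ys n w].
  by apply: measurable_set_lt; [exact: measurable_cst|exact: measurable_partial_sum].
have m1 : measurable [set w | 1 <= exceedances Ys x n w].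
  by apply: measurable_set_le; [exact: measurable_cst|exact: (bdd_exceedances _ _ _).1].
split => //.
- have := Pr_setI P mN mt; rewrite (Pr_setC P mN).
  rewrite (_ : ~` [set w | truncated_sum Ys x n w < e * x] = [set w | e * x <= truncated_sum Ys x n w]); last first.
    by apply/seteqP; split => w /=; rewrite leNgt => /negP.
  lra.
- apply: le_trans c2 _; apply: le_Pr => //.
  by move=> w /= N1; apply: (exceedance_partial_sum Ys_ge0); rewrite N1.
- apply: le_trans (le_Pr P (mS _) (measurableU _ _ m1 mt') _) _.
    move=> w /= eS; have [h|h] := leP 1 (exceedances Ys x n w); [by left|right].
    by rewrite /= -(partial_sum_truncated Ys_ge0 h) ltW.
  apply: le_trans (Pr_setU _ m1 mt') _.
  have := le_trans (Pr_exceedances_le iidY x n) h2; lra.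
Qed.

End irregular_tail.

(** * Consequences of a centered Feller norming *)

Lemma inv_succ_small (R : realType) (e : R) : 0 < e ->
  exists N, forall k, (N <= k)%N -> k.+1%:R^-1 <= e.
Proof.
move=> e0; have [N NP] := ceil_nat e^-1; exists N => k Nk.
rewrite -[leRHS]invrK lef_pV2 ?posrE ?invr_gt0//.
by apply: le_trans NP _; rewrite ler_nat ltnW.
Qed.

Section feller_consequences.
Context d0 (T0 : measurableType d0) (R : realType) (P0 : probability T0 R).
Variable Y : {RV P0 >-> R}.
Hypothesis ndY : non_degenerate Y.
Hypothesis Y_ge0 : forall w, 0 <= Y w.
Context d (T : measurableType d) (P : probability T R).
Variable Ys : nat -> {RV P >-> R}.
Hypothesis iidY : iid_copies Ys Y.
Hypothesis Ys_ge0 : forall i w, 0 <= Ys i w.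
Variable a : R^nat.
Hypothesis fellerY : feller_norming Y a (fun=> 0).

Let a0 n : 0 < a n. Proof. by case: fellerY. Qed.

(** All that is retained of the limit W is tightness and a pair u < v with mass on both sides,
    restated for the sums. As the centering is 0, these bounds compare S_n with multiples of a_n. *)
Lemma feller_subsequence (phi : nat -> nat) : increasing_seq phi ->
  exists psi, increasing_seq psi /\ exists u v, [/\ u < v,
    (exists q N, 0 < q /\ forall k, (N <= k)%N ->
       q <= 1 - Pr P [set w | u * a (phi (psi k)) < partial_sum Ys (phi (psi k)) w]),
    (exists q N, 0 < q /\ forall k, (N <= k)%N ->
       q <= Pr P [set w | v * a (phi (psi k)) < partial_sum Ys (phi (psi k)) w]) &
    (forall q, 0 < q -> exists M N, 0 < M /\ forall k, (N <= k)%N ->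
       Pr P [set w | M * a (phi (psi k)) < partial_sum Ys (phi (psi k)) w] <= q)].
Proof.
move=> incphi; have [_ _ H] := fellerY.
have [psi incpsi [d2 [T2 [Q [W [ndW UW]]]]]] := H _ _ _ _ iidY _ incphi.
exists psi; split => //.
have [u [v [uv Fu Fv uc vc]]] := non_degenerate_spread ndW.
have E x k := rcdf_normed_sum Ys (phi (psi k)) x a0.
have cvg x e : {for x, continuous (rcdf W)} -> 0 < e -> exists N, forall k, (N <= k)%N ->
    `|(1 - Pr P [set w | x * a (phi (psi k)) < partial_sum Ys (phi (psi k)) w]) - rcdf W x| <= e.
  move=> xc e0; have [N NP] := cvg_in_distributionP UW xc e0.
  by exists N => k Nk; rewrite -E subKr; exact: NP.
exists u, v; split => //.
- have [N NP] := cvg u (rcdf W u / 2) uc ltac:(lra).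
  exists (rcdf W u / 2), N; split; first by lra.
  move=> k /NP; rewrite ler_norml => /andP[]; lra.
- have [N NP] := cvg v ((1 - rcdf W v) / 2) vc ltac:(lra).
  exists ((1 - rcdf W v) / 2), N; split; first by lra.
  move=> k /NP; rewrite ler_norml => /andP[]; lra.
- move=> q q0; have [M MP] := @rcdf_cvgy _ _ _ _ W (q / 2) ltac:(lra).
  have [x [Mx _ xc]] := @continuity_point_dense _ _ _ _ W (Num.max M 1) (Num.max M 1 + 1) ltac:(lra).
  have [N NP] := cvg x (q / 2) xc ltac:(lra).
  have x0 : 0 < x by apply: lt_trans Mx; rewrite lt_max ltr01 orbT.
  have xM : M <= x by apply/ltW/(le_lt_trans _ Mx); rewrite le_max lexx.
  exists x, N; split => // k /NP; rewrite ler_norml => /andP[].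
  have := MP _ xM; lra.
Qed.

Lemma measurable_partial_sum_gt n x : measurable [set w | x < partial_sum Ys n w].
Proof.
by apply: measurable_set_lt; [exact: measurable_cst|exact: measurable_partial_sum].
Qed.

(** Otherwise S_n / a_n would tend to 0 in probability along a subsequence, against a lower bound
    for P(S_n > v a_n) with v > u >= 0. Here u >= 0 because S_n > u a_n is certain when u < 0. *)
Lemma feller_nonvanishing : exists v q N, [/\ 0 < v, 0 < q & forall n, (N <= n)%N ->
  q <= Pr P [set w | v * a n < partial_sum Ys n w]].
Proof.
apply: contrapT => H.
have [k N|phi incphi phiP] := @increasing_subsequence (fun k n =>
    Pr P [set w | k.+1%:R^-1 * a n < partial_sum Ys n w] <= k.+1%:R^-1).
  apply: contrapT => H'; apply: H; exists k.+1%:R^-1, k.+1%:R^-1, N; split; rewrite ?invr_gt0//.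
  by move=> n Nn; rewrite leNgt; apply/negP => /ltW h; apply: H'; exists n.
have [psi [incpsi [u [v [uv [q1 [N1 [q10 h1]]] [q2 [N2 [q20 h2]]] _]]]]] := feller_subsequence incphi.
have u0 : 0 <= u.
  rewrite leNgt; apply/negP => u0; have := h1 N1 (leqnn _).
  rewrite (_ : [set w | _] = setT) ?Pr_setT; first by lra.
  apply/seteqP; split => w //= _; apply: (@lt_le_trans _ _ 0); last exact: partial_sum_ge0.
  by rewrite pmulr_llt0.
have v0 : 0 < v by exact: le_lt_trans uv.
have [N3 N3P] := inv_succ_small v0; have [N4 N4P] := @inv_succ_small _ (q2 / 2) ltac:(lra).
pose k := maxn N2 (maxn N3 N4); pose n := phi (psi k).
have pk : (k <= psi k)%N by exact: increasing_seq_ge.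
have h3 : (psi k).+1%:R^-1 <= v by apply: N3P; apply: leq_trans pk; rewrite /k !leq_max leqnn !orbT.
have h4 : (psi k).+1%:R^-1 <= q2 / 2 by apply: N4P; apply: leq_trans pk; rewrite /k !leq_max leqnn !orbT.
have h5 := h2 k ltac:(by rewrite /k leq_max leqnn).
have : Pr P [set w | v * a n < partial_sum Ys n w] <= q2 / 2.
  apply: le_trans (le_trans (phiP (psi k)) h4); apply: le_Pr; do ?exact: measurable_partial_sum_gt.
  by move=> w /=; apply: le_lt_trans; rewrite ler_pM2r.
rewrite /n; lra.
Qed.

Lemma feller_tight q : 0 < q -> exists M N, 0 < M /\ forall n, (N <= n)%N ->
  Pr P [set w | M * a n < partial_sum Ys n w] <= q.
Proof.
move=> q0; apply: contrapT => H.
have [k N|phi incphi phiP] := @increasing_subsequence (fun k n =>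
    q <= Pr P [set w | k.+1%:R * a n < partial_sum Ys n w]).
  apply: contrapT => H'; apply: H; exists k.+1%:R, N; split => //.
  by move=> n Nn; rewrite leNgt; apply/negP => /ltW h; apply: H'; exists n.
have [psi [incpsi [u [v [uv _ _ h]]]]] := feller_subsequence incphi.
have [M [N [M0 h2]]] := h (q / 2) ltac:(lra).
have [N' N'P] := ceil_nat M; pose k := maxn N N'.
have pk : (k <= psi k)%N by exact: increasing_seq_ge.
have := h2 k (leq_maxl _ _); have := phiP (psi k).
set n := phi (psi k) => h3 h4.
have : Pr P [set w | (psi k).+1%:R * a n < partial_sum Ys n w] <= Pr P [set w | M * a n < partial_sum Ys n w].
  apply: le_Pr; do ?exact: measurable_partial_sum_gt.
  move=> w /=; apply: le_lt_trans; rewrite ler_pM2r//; apply: le_trans N'P _.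
  by rewrite ler_nat ltnW// ltnS (leq_trans _ pk)// leq_maxr.
lra.
Qed.

(** P(S_n > x) >= kap/4 exceeds the mass kap/8 allowed beyond M a_n, so x < M a_n; P(S_n > e x) <= 3
    kap is below q, so v a_n < e x. Together v < e M, against e <= v / M. *)
Lemma feller_not_heavy_jumps : ~ heavy_jumps Y.
Proof.
move=> hj; have [v [q [N1 [v0 q0 h1]]]] := feller_nonvanishing.
pose kap := Num.min (1 / 4) (q / 6).
have k0 : 0 < kap by rewrite /kap lt_min; apply/andP; split; lra.
have k1 : kap <= 1 / 4 by rewrite /kap ge_min lexx.
have k2 : kap <= q / 6 by rewrite /kap ge_min lexx orbT.
have [M [N2 [M0 h2]]] := @feller_tight (kap / 8) ltac:(lra).
pose e := Num.min (1 / 2) (v / M).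
have e0 : 0 < e by rewrite /e lt_min; apply/andP; split; [lra|exact: divr_gt0].
have e1 : e <= 1 / 2 by rewrite /e ge_min lexx.
have eM : e * M <= v by rewrite -ler_pdivlMr// /e ge_min lexx orbT.
have [n [x [Nn x0 _ h3 h4]]] := heavy_jumps_sum ndY Y_ge0 iidY Ys_ge0 (maxn N1 N2) hj k0 k1 e0 e1.
have N1n : (N1 <= n)%N by apply: leq_trans Nn; exact: leq_maxl.
have N2n : (N2 <= n)%N by apply: leq_trans Nn; exact: leq_maxr.
have g1 := h1 n N1n; have g2 := h2 n N2n.
have mS := measurable_partial_sum_gt n.
have x1 : x < M * a n.
  rewrite ltNge; apply/negP => Mx.
  have : Pr P [set w | x < partial_sum Ys n w] <= Pr P [set w | M * a n < partial_sum Ys n w].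
    by apply: le_Pr => // w /=; exact: le_lt_trans.
  lra.
have x2 : v * a n < e * x.
  rewrite ltNge; apply/negP => ev.
  have : Pr P [set w | v * a n < partial_sum Ys n w] <= Pr P [set w | e * x < partial_sum Ys n w].
    by apply: le_Pr => // w /=; exact: le_lt_trans.
  lra.
have : e * x <= e * (M * a n) by rewrite ler_pM2l// ltW.
have : e * M * a n <= v * a n by rewrite ler_pM2r.
rewrite mulrA; lra.
Qed.

Lemma feller_not_light_jumps : ~ light_jumps Y.
Proof.
move=> lj.
(* The tolerance 1/(k+2) is at most 1/2 already at k = 0, as [light_jumps_sum] requires. *)
pose good k n := exists2 x, 0 < x &
  Pr P [set w | k.+2%:R^-1 * x < `|partial_sum Ys n w - x|] <= k.+2%:R^-1.
have mbad e n x : measurable [set w | e * x < `|partial_sum Ys n w - x|] by apply: measurable_dist_gt; exact: measurable_partial_sum.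
have [k N|phi incphi phiP] := @increasing_subsequence good.
  have e1 : k.+2%:R^-1 <= 1 / 2 :> R by rewrite div1r lef_pV2 ?posrE// ler_nat.
  have [n [x [Nn x0 [dl [dl0 _ _ _ h]]]]] :=
    light_jumps_sum ndY Y_ge0 iidY Ys_ge0 N lj (ltac:(by rewrite invr_gt0) : 0 < k.+2%:R^-1) e1.
  exists n => //; exists x => //; apply: le_trans h; apply: le_Pr => //.
    apply: measurableU => //; apply: measurable_set_le; first exact: measurable_cst.
    exact: (bdd_exceedances _ _ _).1.
have [psi [incpsi [u [v [uv [q1 [N1 [q10 h1]]] [q2 [N2 [q20 h2]]] _]]]]] := feller_subsequence incphi.
(* The terms q1/2 and q2/2 keep the exceptional probability ek below the masses at u and v, which
   forces (1 - ek) x <= u a_n and v a_n < (1 + ek) x. Then v - u < ek (u + v), which the last term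
   excludes. *)
pose e := Num.min (Num.min (q1 / 2) (q2 / 2)) (Num.min (1 / 2) ((v - u) / (2 * (`|u| + `|v| + 1)))).
have uv0 : 0 < 2 * (`|u| + `|v| + 1) by have := normr_ge0 u; have := normr_ge0 v; lra.
have e0 : 0 < e.
  rewrite /e !lt_min; do !(apply/andP; split); try lra.
  by rewrite divr_gt0//; lra.
have [N3 N3P] := inv_succ_small e0.
pose k := maxn N3 (maxn N1 N2); pose n := phi (psi k); pose ek : R := (psi k).+2%:R^-1.
have ek0 : 0 < ek by rewrite invr_gt0.
have eke : ek <= e.
  rewrite /ek; apply: N3P; apply: leqW; apply: leq_trans (increasing_seq_ge k incpsi).
  by rewrite /k leq_maxl.
move: eke; rewrite /e !le_min => /andP[/andP[eq1 eq2] /andP[e12 euv]].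
have [x x0 bad] := phiP (psi k).
have g1 := h1 k ltac:(by rewrite /k !leq_max leqnn !orbT).
have g2 := h2 k ltac:(by rewrite /k !leq_max leqnn !orbT).
rewrite -/n -/ek in bad g1 g2.
have mS := measurable_partial_sum_gt n.
have a_gt0 := a0 n.
have l1 : (1 - ek) * x <= u * a n.
  rewrite leNgt; apply/negP => h.
  have : Pr P (~` [set w | u * a n < partial_sum Ys n w]) <= ek.
    apply: le_trans bad; apply: le_Pr => //; first exact: measurableC.
    move=> w /= /negP; rewrite -leNgt => Su.
    by rewrite distrC; apply: lt_le_trans (ler_norm _); lra.
  by rewrite Pr_setC//; lra.
have l2 : v * a n < (1 + ek) * x.
  rewrite ltNge; apply/negP => h.
  have : Pr P [set w | v * a n < partial_sum Ys n w] <= ek.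
    apply: le_trans bad; apply: le_Pr => //.
    by move=> w /= Sv; apply: lt_le_trans (ler_norm _); lra.
  lra.
have u0 : 0 < u.
  rewrite -(pmulr_lgt0 _ a_gt0); apply: lt_le_trans l1.
  by rewrite mulr_gt0//; lra.
have v0 : 0 < v by exact: lt_trans uv.
have l3 : v * ((1 - ek) * x) <= v * (u * a n) by rewrite ler_pM2l.
have l4 : u * (v * a n) < u * ((1 + ek) * x) by rewrite ltr_pM2l.
have l5 : v * (1 - ek) < u * (1 + ek).
  rewrite -(ltr_pM2r x0) -!mulrA; apply: le_lt_trans l3 _.
  by rewrite mulrCA.
move: euv; rewrite ler_pdivlMr// !gtr0_norm// => euv.
have := mulr_gt0 ek0 u0; have := mulr_gt0 ek0 v0; lra.
Qed.

End feller_consequences.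

(** * Existence of independent sequences *)

Section halfline_extension.
Context d (T : measurableType d) d' (T' : measurableType d') (R : realType).
Variables (P : probability T R) (P' : probability T' R).

(** Half-lines generate the Borel sets, so Dynkin's theorem extends the identity. For A the whole
    space it identifies laws by distribution functions; in general it extends the independence of A
    and U from half-lines to Borel sets. *)
Lemma halfline_extension (U : {RV P >-> R}) (V : {RV P' >-> R}) (A : set T) (c : R) :
  measurable A -> 0 <= c -> Pr P A = c ->
  (forall x, Pr P (A `&` [set w | U w <= x]) = c * rcdf V x) ->
  forall B, measurable B -> Pr P (A `&` U @^-1` B) = c * Pr P' (V @^-1` B).
Proof.
move=> mA c0 Ac H B mB.
have mU C : measurable C -> measurable (A `&` U @^-1` C).
  by move=> mC; apply: measurableI => //; exact: measurable_RV_preimage.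
have compl C : measurable C -> Pr P (A `&` U @^-1` (~` C)) = c - Pr P (A `&` U @^-1` C).
  move=> mC; rewrite -Ac.
  have -> : A `&` U @^-1` (~` C) = A `\` (A `&` U @^-1` C).
    by apply/seteqP; split => w /=; [move=> [Aw nC]; split => // -[]|move=> [Aw nC]; split => // ?; exact: nC].
  apply/EFin_inj; rewrite EFinB !EFin_Pr//; do ?exact: mU; last by apply: measurableD => //; exact: mU.
  rewrite measureD//; [|exact: mU|by apply: le_lt_trans (probability_le1 P mA) _; exact: ltry].
  by rewrite setIA setIid.
have ME : @measurable _ R = <<s @RGenOInfty.G R >> by exact: RGenOInfty.measurableE.
apply: (@dynkin_induction _ _ (@RGenOInfty.G R) (fun B => Pr P (A `&` U @^-1` B) = c * Pr P' (V @^-1` B))) => //.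
- move=> _ _ [x ->] [y ->]; exists (Num.max x y).
  apply/seteqP; split => z /=; rewrite !in_itv/= !andbT gt_max.
    by move=> [-> ->].
  by move=> /andP[].
- by rewrite !preimage_setT setIT Pr_setT mulr1.
- move=> _ [x ->]; have -> : `]x, +oo[%classic = ~` [set z : R | z <= x].
    by apply/seteqP; split => z /=; rewrite in_itv/= andbT ltNge => /negP.
  have mx : measurable [set z : R | z <= x].
    by apply: measurable_set_le; [exact: measurable_id|exact: measurable_cst].
  rewrite compl// (H x) -[V @^-1` _]/(~` [set w | V w <= x]) Pr_setC; last exact: measurable_RV_le.
  by rewrite mulrBr mulr1.
- move=> C mC HC; rewrite compl// HC -[V @^-1` (~` C)]/(~` (V @^-1` C)) Pr_setC; last exact: measurable_RV_preimage.
  by rewrite mulrBr mulr1.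
- move=> F mF tF HF; apply/EFin_inj; rewrite EFinM.
  have mV C : measurable C -> measurable (V @^-1` C) by exact: measurable_RV_preimage.
  have mcF : measurable (\bigcup_k F k) by exact: bigcup_measurable.
  rewrite (EFin_Pr _ (mU _ mcF)) (EFin_Pr _ (mV _ mcF)) !preimage_bigcup setI_bigcupr.
  rewrite !measure_bigcup//=.
  + rewrite -nneseriesZl//; apply: eq_eseriesr => k _.
    by rewrite -(EFin_Pr _ (mU _ (mF k))) -(EFin_Pr _ (mV _ (mF k))) HF EFinM.
  + by move=> k _; exact: mV.
  + by move=> j k _ _ [w [/= h1 h2]]; apply: tF => //; exists (V w).
  + by move=> k _; exact: mU.
  + by move=> j k _ _ [w [/= [_ h1] [_ h2]]]; apply: tF => //; exists (U w).
- by rewrite -ME.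
Qed.

Lemma rcdf_same_distribution (U : {RV P >-> R}) (V : {RV P' >-> R}) :
  rcdf U = rcdf V -> same_distribution U V.
Proof.
move=> UV B mB; rewrite /distribution /pushforward.
have := @halfline_extension U V setT 1 measurableT ler01 (Pr_setT P) _ B mB.
rewrite setTI mul1r => h; rewrite -(EFin_Pr P (measurable_RV_preimage U mB)).
rewrite -(EFin_Pr P' (measurable_RV_preimage V mB)) h// => x.
by rewrite setTI mul1r -UV.
Qed.

End halfline_extension.

Section independent_iteration.
Context d (T : measurableType d) (R : realType) (P : probability T R).
Variables (f : {RV P >-> R}) (g : T -> T).
Hypothesis mg : measurable_fun [set: T] g.
Hypothesis Pg : forall B, measurable B -> Pr P (g @^-1` B) = Pr P B.
Hypothesis Pfg : forall A B, measurable A -> measurable B ->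
  Pr P (f @^-1` A `&` g @^-1` B) = Pr P (f @^-1` A) * Pr P B.

(** When w splits into an independent pair (f w, g w) and g preserves the measure, g w can be split
    again. This yields an independent sequence with no infinite product space. *)
Definition iterate_RV (j : nat) (w : T) : R := f (iter j g w).

Lemma measurable_iter j : measurable_fun [set: T] (iter j g).
Proof. by elim: j => [|j IH] /=; [exact: measurable_id|exact: measurableT_comp]. Qed.

Lemma measurable_iterate_RV j : measurable_fun [set: T] (iterate_RV j).
Proof. by apply: measurableT_comp => //; exact: measurable_iter. Qed.

HB.instance Definition _ j :=
  isMeasurableFun.Build _ _ _ _ (iterate_RV j) (measurable_iterate_RV j).

Lemma Pr_iterate_RV j A : measurable A -> Pr P (iterate_RV j @^-1` A) = Pr P (f @^-1` A).
Proof.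
move=> mA; elim: j => // j IH; rewrite -IH -(Pg (measurable_RV_preimage (iterate_RV j : {RV P >-> R}) mA)).
by congr Pr; apply/seteqP; split => w; rewrite /preimage /= /iterate_RV iterSr.
Qed.

Lemma iterate_RV_independent :
  mutually_independent (fun j => iterate_RV j : {RV P >-> R}).
Proof.
apply: (@cylinder_mutually_independent _ _ _ _ _ id) => // n A mA.
under eq_bigr do rewrite Pr_iterate_RV//.
elim: n A mA => [|n IH] A mA.
  rewrite big_ord0 (_ : cylinder _ _ _ = setT) ?Pr_setT//.
  by apply/seteqP; split => w.
rewrite big_ord_recl -(IH (fun i => A i.+1))// -Pfg//; last exact: measurable_cylinder.
congr Pr; apply/seteqP; split => w /=.
  move=> h; split; first exact: (h 0).
  by move=> i /= ni; have := h i.+1 ni; rewrite /preimage/= /iterate_RV iterSr.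
move=> [h0 h] [|i] //= ni.
by have := h i ni; rewrite /preimage/= /iterate_RV -iterSr.
Qed.

Lemma exists_iterates : exists2 V : nat -> {RV P >-> R}, mutually_independent V &
  forall j A, measurable A -> Pr P (V j @^-1` A) = Pr P (f @^-1` A).
Proof.
exists (fun j => iterate_RV j : {RV P >-> R}); first exact: iterate_RV_independent.
exact: Pr_iterate_RV.
Qed.

End independent_iteration.

(** [capf 1] is also the distribution function of the uniform law on [0, 1], and serves as such from
    here on. *)
Lemma capf1_le0 (R : realType) (x : R) : x <= 0 -> capf 1 x = 0.
Proof. by move=> x0; rewrite /capf max_r// min_l. Qed.

Lemma capf1_ge1 (R : realType) (x : R) : 1 <= x -> capf 1 x = 1.
Proof. by move=> x1; rewrite /capf max_l ?min_r// (le_trans _ x1). Qed.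

Lemma capf1_id (R : realType) (x : R) : 0 <= x -> x <= 1 -> capf 1 x = x.
Proof. by move=> x0 x1; rewrite /capf max_l ?min_l. Qed.

Section binary_digits.
Context d (T : measurableType d) (R : realType) (P : probability T R).
Variables (b : T -> bool) (s : T -> T).
Hypothesis mb : measurable [set w | b w].
Hypothesis ms : measurable_fun [set: T] s.
Hypothesis bs1 : forall B, measurable B -> Pr P ([set w | b w] `&` s @^-1` B) = Pr P B / 2.
Hypothesis bs0 : forall B, measurable B -> Pr P ([set w | ~~ b w] `&` s @^-1` B) = Pr P B / 2.

Let ms_preimage B : measurable B -> measurable (s @^-1` B).
Proof. by move=> mB; rewrite -[X in measurable X]setTI; exact: ms. Qed.

Let mnb : measurable [set w | ~~ b w].
Proof.
rewrite (_ : [set w | _] = ~` [set w | b w]); first exact: measurableC.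
by apply/seteqP; split => w /= /negP.
Qed.

(** The digit [b w] is a fair coin independent of the shifted point [s w], which again has law P;
    the event is conditioned on this first digit. *)
Lemma Pr_digit_split A A1 A0 : measurable A -> measurable A1 -> measurable A0 ->
  (forall w, b w -> A w <-> A1 (s w)) -> (forall w, ~~ b w -> A w <-> A0 (s w)) ->
  Pr P A = (Pr P A1 + Pr P A0) / 2.
Proof.
move=> mA mA1 mA0 E1 E0; rewrite mulrDl -bs1// -bs0//.
have m1 : measurable ([set w | b w] `&` s @^-1` A1) by apply: measurableI => //; exact: ms_preimage.
have m0 : measurable ([set w | ~~ b w] `&` s @^-1` A0) by apply: measurableI => //; exact: ms_preimage.
have -> : A = ([set w | b w] `&` s @^-1` A1) `|` ([set w | ~~ b w] `&` s @^-1` A0).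
  apply/seteqP; split => w /=.
    by have [bw|bw] := boolP (b w) => Aw; [left|right]; split => //; [exact/E1|exact/E0].
  by move=> [[bw]|[bw]] h; [exact/(E1 _ bw)|exact/(E0 _ bw)].
apply: Pr_setU_disjoint => //; apply/seteqP; split => w //= [[bw _] [/negP]].
by [].
Qed.

Lemma Pr_shift B : measurable B -> Pr P (s @^-1` B) = Pr P B.
Proof.
move=> mB; rewrite (@Pr_digit_split _ B B)//; last exact: ms_preimage.
lra.
Qed.

Let partial (m : nat) (w : T) : R := \sum_(k < m) (b (iter k.*2 s w))%:R / 2 ^+ k.+1.

Let partial_rec m w : partial m.+1 w = ((b w)%:R + partial m (s (s w))) / 2.
Proof.
rewrite /partial big_ord_recl/= expr1 mulrDl; congr (_ + _).
rewrite mulr_suml; apply: eq_bigr => i _.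
by rewrite /bump/= add0n !add1n -!iterSr exprSr invfM mulrA.
Qed.

Let partial_ge0 m w : 0 <= partial m w.
Proof. by apply: sumr_ge0 => k _; rewrite divr_ge0// exprn_ge0. Qed.

Let partial_le1 m w : partial m w <= 1.
Proof.
elim: m w => [|m IH] w; first by rewrite /partial big_ord0.
by rewrite partial_rec; have := IH (s (s w)); case: (b w) => /=; lra.
Qed.

Let partial_cvg w : cvgn (partial ^~ w).
Proof.
apply: nondecreasing_is_cvgn.
  apply/nondecreasing_seqP => m; rewrite /partial big_ord_recr /= lerDl.
  by rewrite divr_ge0// exprn_ge0.
by exists 1 => _ [m _ <-]; exact: partial_le1.
Qed.

(* The number whose binary digits are the even ones of the expansion generated by [b] and [s];
   its composition with [s] collects the odd ones. *)
Definition even_digits (w : T) : R := limn (partial ^~ w).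

Lemma even_digits_ge0 w : 0 <= even_digits w.
Proof. by apply: limr_ge => //; apply: nearW => m; exact: partial_ge0. Qed.

Lemma even_digits_le1 w : even_digits w <= 1.
Proof. by apply: limr_le => //; apply: nearW => m; exact: partial_le1. Qed.

Lemma even_digits_rec w : even_digits w = ((b w)%:R + even_digits (s (s w))) / 2.
Proof.
apply: cvg_lim => //; rewrite -(cvg_shiftn 1)/=.
under eq_fun do rewrite addn1 partial_rec.
by apply: cvgMl; apply: cvgD; [exact: cvg_cst|exact: partial_cvg].
Qed.

Lemma measurable_even_digits : measurable_fun [set: T] even_digits.
Proof.
apply: (@measurable_fun_cvg _ _ _ _ partial); last by move=> w _; exact: partial_cvg.
move=> m; apply: measurable_sum => k; apply: measurable_funM; last exact: measurable_cst.
apply: measurable_natr_bool; rewrite -[X in measurable X]setTI.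
rewrite (_ : [set w | _] = iter k.*2 s @^-1` [set w | b w])//.
exact: (measurable_iter ms).
Qed.

HB.instance Definition _ :=
  isMeasurableFun.Build _ _ _ _ even_digits measurable_even_digits.

Let f : {RV P >-> R} := even_digits.

Let mle x : measurable [set w | f w <= x].
Proof. exact: measurable_RV_le. Qed.

Let mles x : measurable [set w | f (s w) <= x].
Proof. exact: (ms_preimage (mle x)). Qed.

Let c (x : R) : R := capf 1 x.

Let c0 (x : R) : x <= 0 -> c x = 0. Proof. exact: capf1_le0. Qed.

Let c1 (x : R) : 1 <= x -> c x = 1. Proof. exact: capf1_ge1. Qed.

Let cid (x : R) : 0 <= x -> x <= 1 -> c x = x. Proof. exact: capf1_id. Qed.

Let c_ge0 x : 0 <= c x. Proof. exact: capf_ge0. Qed.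

Let c_le1 x : c x <= 1. Proof. exact: capf_le. Qed.

Let c_rec x : c x = (c (2 * x - 1) + c (2 * x)) / 2.
Proof.
have [x0|x0] := leP x 0; first by rewrite !c0 ?addr0 ?mul0r//; lra.
have [x1|x1] := leP 1 x; first by rewrite !c1 ?divff//; lra.
rewrite cid//; try lra.
have [h|h] := leP x (1 / 2).
  by rewrite (@c0 (2 * x - 1)) ?(@cid (2 * x)); lra.
by rewrite (@c1 (2 * x)) ?(@cid (2 * x - 1)); lra.
Qed.

Let contraction (D : R) : (forall m, `|D| <= 2 ^- m) -> D = 0.
Proof.
move=> H; apply/eqP; rewrite -normr_eq0 eq_le normr_ge0 andbT; apply/ler_addgt0Pl => e e0.
rewrite addr0; have [N NP] := ceil_nat e^-1; apply: le_trans (H N) _.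
rewrite -[leRHS]invrK lef_pV2 ?posrE ?invr_gt0 ?exprn_gt0//; apply: le_trans NP _.
by rewrite -natrX ler_nat ltnW// ltn_expl.
Qed.

Let f_digit x w : (b w -> f w <= x <-> f (s (s w)) <= 2 * x - 1) /\
  (~~ b w -> f w <= x <-> f (s (s w)) <= 2 * x).
Proof. by split => bw; rewrite /f /= even_digits_rec ?bw ?(negbTE bw)/=; split; lra. Qed.

Let f_rcdf_rec x : rcdf f x = (rcdf f (2 * x - 1) + rcdf f (2 * x)) / 2.
Proof.
rewrite {1}/rcdf (@Pr_digit_split _ (s @^-1` [set w | f w <= 2 * x - 1]) (s @^-1` [set w | f w <= 2 * x])).
- by rewrite !Pr_shift.
- exact: mle.
- exact: mles.
- exact: mles.
- by move=> w; exact: (f_digit x w).1.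
- by move=> w; exact: (f_digit x w).2.
Qed.

Let f_rcdf0 (x : R) : x < 0 -> rcdf f x = 0.
Proof.
move=> x0; rewrite /rcdf (_ : [set w | _] = set0) ?Pr_set0//.
by apply/seteqP; split => w //=; apply/negP; rewrite -ltNge (lt_le_trans x0)// even_digits_ge0.
Qed.

Let f_rcdf1 (x : R) : 1 <= x -> rcdf f x = 1.
Proof.
move=> x1; rewrite /rcdf (_ : [set w | _] = setT) ?Pr_setT//.
by apply/seteqP; split => w //= _; apply: le_trans x1; exact: even_digits_le1.
Qed.

(* Both distribution functions satisfy the same self-similarity equation, and at each point of [0, 1)
   one of its two terms is known: the difference is contracted by 1/2. *)
Lemma rcdf_even_digits x : rcdf f x = capf 1 x.
Proof.
apply/eqP; rewrite -subr_eq0; apply/eqP/contraction => m.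
elim: m x => [|m IH] x.
  rewrite expr0 invr1; have := c_ge0 x; have := c_le1 x; have := rcdf_ge0 f x; have := rcdf_le1 f x.
  by rewrite /c ler_norml => *; apply/andP; split; lra.
have [x0|x0] := ltP x 0.
  by rewrite f_rcdf0// [capf _ _](c0 (ltW x0)) subrr normr0 invr_ge0 exprn_ge0.
have [x1|x1] := leP 1 x.
  by rewrite f_rcdf1// [capf _ _](c1 x1) subrr normr0 invr_ge0 exprn_ge0.
rewrite f_rcdf_rec [capf _ _]c_rec -mulrBl normrM exprS invfM mulrC (@ger0_norm _ 2^-1) ?invr_ge0//.
rewrite ler_pM2l ?invr_gt0//.
have [h|h] := ltP x (1 / 2).
  rewrite [rcdf f (2 * x - 1)]f_rcdf0; last by lra.
  by rewrite (@c0 (2 * x - 1)) ?add0r; [exact: IH|lra].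
rewrite [rcdf f (2 * x)]f_rcdf1; last by lra.
rewrite (@c1 (2 * x)); last by lra.
rewrite opprD addrACA subrr addr0; exact: IH.
Qed.

Let H x y := Pr P ([set w | f (s w) <= y] `&` [set w | f w <= x]).

Let mH x y : measurable ([set w | f (s w) <= y] `&` [set w | f w <= x]).
Proof. by apply: measurableI; [exact: mles|exact: mle]. Qed.

(** The first digit of w changes x and leaves the pair (s w, s (s w)), in which x and y have
    exchanged roles; the next digit changes y and restores the order. [A] is the event halfway. *)
Let H_rec x y : H x y =
  ((H (2 * x - 1) (2 * y - 1) + H (2 * x - 1) (2 * y)) / 2 +
   (H (2 * x) (2 * y - 1) + H (2 * x) (2 * y)) / 2) / 2.
Proof.
pose A x' := s @^-1` [set w | f w <= x'] `&` [set w | f w <= y].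
have mA x' : measurable (A x') by apply: measurableI; [exact: mles|exact: mle].
rewrite /H (@Pr_digit_split _ (A (2 * x - 1)) (A (2 * x))) => //; first last.
- by move=> w bw; rewrite /A /=; have := (f_digit x w).2 bw; tauto.
- by move=> w bw; rewrite /A /=; have := (f_digit x w).1 bw; tauto.
have E x' : Pr P (A x') = (H x' (2 * y - 1) + H x' (2 * y)) / 2.
  rewrite (@Pr_digit_split _ ([set w | f (s w) <= 2 * y - 1] `&` [set w | f w <= x'])
     ([set w | f (s w) <= 2 * y] `&` [set w | f w <= x'])) => //.
  - by move=> w bw; rewrite /A /=; have := (f_digit y w).1 bw; tauto.
  - by move=> w bw; rewrite /A /=; have := (f_digit y w).2 bw; tauto.
by rewrite !E.
Qed.

Let H_boundary (x y : R) : (x < 0 \/ 1 <= x) \/ (y < 0 \/ 1 <= y) -> H x y = c x * c y.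
Proof.
have rs z : Pr P [set w | f (s w) <= z] = c z.
  by rewrite /c -rcdf_even_digits; exact: (Pr_shift (mle z)).
have H1 z : Pr P [set w | f w <= z] = c z by exact: rcdf_even_digits.
move=> [[x0|x1]|[y0|y1]].
- rewrite c0 ?(ltW x0)// mul0r /H (_ : _ `&` _ = set0) ?Pr_set0//.
  apply/seteqP; split => w //= [_]; apply/negP; rewrite -ltNge (lt_le_trans x0)//.
  exact: even_digits_ge0.
- rewrite (c1 x1) mul1r -rs; congr Pr; apply/seteqP; split => w /=; first by case.
  by split => //; apply: le_trans x1; exact: even_digits_le1.
- rewrite mulrC c0 ?(ltW y0)// mul0r /H (_ : _ `&` _ = set0) ?Pr_set0//.
  apply/seteqP; split => w //= [+ _]; apply/negP; rewrite -ltNge (lt_le_trans y0)//.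
  exact: even_digits_ge0.
- rewrite (c1 y1) mulr1 -H1; congr Pr; apply/seteqP; split => w /=; first by case.
  by split => //; apply: le_trans y1; exact: even_digits_le1.
Qed.

(* As above in two dimensions: for a point of [0, 1)^2, exactly one of the four rescaled
   points lies in [0, 1)^2, and the two sides agree at the other three. *)
Lemma Pr_even_digits_shift x y :
  Pr P ([set w | f (s w) <= y] `&` [set w | f w <= x]) = capf 1 x * capf 1 y.
Proof.
rewrite -/(H x y) -/(c x) -/(c y); apply/eqP; rewrite -subr_eq0; apply/eqP/contraction => m.
elim: m x y => [|m IH] x y.
  rewrite expr0 invr1; have h1 : 0 <= c x * c y by rewrite mulr_ge0.
  have h2 : c x * c y <= 1 by rewrite mulr_ile1.
  have h3 : 0 <= H x y by exact: Pr_ge0.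
  have h4 : H x y <= 1 by exact: Pr_le1.
  by rewrite ler_norml; apply/andP; split; lra.
have [bd|/not_orP[/not_orP[/negP + /negP +] /not_orP[/negP + /negP +]]] := pselect ((x < 0 \/ 1 <= x) \/ (y < 0 \/ 1 <= y)).
  by rewrite H_boundary// subrr normr0 invr_ge0 exprn_ge0.
rewrite -!leNgt -!ltNge => x0 x1 y0 y1.
have hm : 0 <= 2 ^- m :> R by rewrite invr_ge0 exprn_ge0.
have key : exists x' y', H x y - c x * c y = (H x' y' - c x' * c y') / 4.
  rewrite H_rec (c_rec x) (c_rec y).
  have [hx|hx] := ltP x (1 / 2); have [hy|hy] := ltP y (1 / 2).
  - exists (2 * x), (2 * y).
    rewrite (@H_boundary (2 * x - 1) (2 * y - 1)) 1?(@H_boundary (2 * x - 1) (2 * y)) 1?(@H_boundary (2 * x) (2 * y - 1)); do ?[field]; lra.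
  - exists (2 * x), (2 * y - 1).
    rewrite (@H_boundary (2 * x - 1) (2 * y - 1)) 1?(@H_boundary (2 * x - 1) (2 * y)) 1?(@H_boundary (2 * x) (2 * y)); do ?[field]; lra.
  - exists (2 * x - 1), (2 * y).
    rewrite (@H_boundary (2 * x - 1) (2 * y - 1)) 1?(@H_boundary (2 * x) (2 * y)) 1?(@H_boundary (2 * x) (2 * y - 1)); do ?[field]; lra.
  - exists (2 * x - 1), (2 * y - 1).
    rewrite (@H_boundary (2 * x) (2 * y - 1)) 1?(@H_boundary (2 * x) (2 * y)) 1?(@H_boundary (2 * x - 1) (2 * y)); do ?[field]; lra.
have [x' [y' ->]] := key; have := IH x' y'.
rewrite normrM exprS invfM (@ger0_norm _ 4^-1) ?invr_ge0//; set D : R := `|_|.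
by move=> Dq; rewrite mulrC ler_pM ?invr_ge0 ?normr_ge0// lef_pV2 ?posrE// ler_nat.
Qed.

End binary_digits.

Section uniform_digits.
Variable R : realType.
Local Open Scope measure_display_scope.

Lemma exists_uniform_RV : exists (P : probability (measurableTypeR R) R) (W : {RV P >-> R}),
  rcdf W = capf 1 /\ W =1 idfun.
Proof.
pose G : R -> R := capf 1.
have ndG : {homo G : x y / x <= y}.
  move=> x y xy; rewrite /G; have [x0|x0] := leP x 0; first by rewrite capf1_le0// capf_ge0.
  have [y1|y1] := leP 1 y; first by rewrite (capf1_ge1 y1) capf_le.
  by rewrite !capf1_id//; lra.
have cG : continuous G.
  move=> x; apply: (@continuous_min _ R (fun y => Num.max y 0) (cst 1)); last exact: cst_continuous.
  by apply: continuous_max; [exact: id|exact: cst_continuous].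
have rcG : right_continuous G by move=> x; apply: cvg_within_filter; exact: cG.
have GNy : G @ -oo --> (0 : R).
  apply/cvgrPdist_le => e e0; exists 0; split => // x x0.
  by rewrite /G /capf max_r ?min_l ?subrr ?normr0 ?ltW.
have Gy : G @ +oo --> (1 : R).
  apply/cvgrPdist_le => e e0; exists 1; split => // x x1.
  rewrite /G /capf max_l ?min_r ?subrr ?normr0; rewrite ?(ltW x1) ?(ltW e0)//.
  by rewrite (le_trans _ (ltW x1)).
pose m1 := isCumulative.Build R _ R G ndG rcG.
pose m2 := isCumulativeBounded.Build R 0 1 G GNy Gy.
pose GG : cumulativeBounded (0 : R) (1 : R) := HB.pack G m1 m2.
have [P [W [WG Wid]]] := exists_cumulative_RV GG.
by exists P, W.
Qed.

(** Doubling modulo 1, with first digit decided at 1/2, is the binary shift of the uniform law. f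
    collects the even digits and g the odd ones; they are independent and uniform, and as the sample
    space is the line itself, g is a measure-preserving map of it. *)
Lemma exists_uniform_splitting : exists (P : probability (measurableTypeR R) R)
    (f : {RV P >-> R}) (g : measurableTypeR R -> measurableTypeR R),
  [/\ rcdf f = capf 1, measurable_fun [set: measurableTypeR R] g,
    (forall B, measurable B -> Pr P (g @^-1` B) = Pr P B) &
    (forall A B, measurable A -> measurable B ->
       Pr P (f @^-1` A `&` g @^-1` B) = Pr P (f @^-1` A) * Pr P B)].
Proof.
have [P [W [WF Wid]]] := exists_uniform_RV.
pose b (w : measurableTypeR R) : bool := 1 / 2 < W w.
pose s (w : measurableTypeR R) : measurableTypeR R := 2 * W w - (b w)%:R.
have mb : measurable [set w | b w] by exact: measurable_RV_gt.
have ms : measurable_fun [set: measurableTypeR R] s.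
  apply: (@measurable_funB _ _ R setT (fun w => 2 * W w) (fun w => (b w)%:R)).
    by apply: measurable_funM; [exact: measurable_cst|exact: measurable_funPT].
  exact: measurable_natr_bool.
have WE x : Pr P [set w | W w <= x] = capf 1 x by rewrite -WF.
pose S0 : measurableTypeR R -> R := s.
pose mS := @isMeasurableFun.Build _ _ _ _ S0 ms.
pose S : {RV P >-> R} := HB.pack S0 mS.
have preW (B : set R) : W @^-1` B = B.
  by apply/seteqP; split => w; rewrite /preimage/= Wid.
have mbE : [set w | ~~ b w] = [set w | W w <= 1 / 2].
  by apply/seteqP; split => w; rewrite /b /= -leNgt.
have mnb : measurable [set w | ~~ b w] by rewrite mbE; exact: measurable_RV_le.
have bs0 B : measurable B -> Pr P ([set w | ~~ b w] `&` s @^-1` B) = Pr P B / 2.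
  move=> mB; rewrite -[in RHS](preW B) mulrC; apply: (@halfline_extension _ _ _ _ _ P P S W) => //.
  - by rewrite mbE WE capf1_id; lra.
  move=> x; rewrite WF /=.
  rewrite (_ : _ `&` _ = [set w | W w <= Num.min (1 / 2) (x / 2)]); last first.
    apply/seteqP; split => w; rewrite mbE /S /= /S0 /s /b le_min.
      by move=> [h]; rewrite ltNge h /= subr0; lra.
    by move=> /andP[h h2]; split => //; rewrite ltNge h /= subr0; lra.
  have [h|h] := leP x 0; first by rewrite WE !capf1_le0 ?mulr0// ge_min; apply/orP; right; lra.
  have [h1|h1] := leP 1 x.
    by rewrite WE (capf1_ge1 h1) min_l ?capf1_id; lra.
  by rewrite WE min_r ?capf1_id; lra.
have bs1 B : measurable B -> Pr P ([set w | b w] `&` s @^-1` B) = Pr P B / 2.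
  move=> mB; rewrite -[in RHS](preW B) mulrC; apply: (@halfline_extension _ _ _ _ _ P P S W) => //.
  - by rewrite Pr_gt WF /capf max_l ?min_l//; lra.
  move=> x; rewrite WF /=.
  have mx : measurable ([set w | b w] `&` [set w | S w <= x]).
    by apply: measurableI => //; exact: measurable_RV_le.
  (* On W > 1/2 the condition s w <= x reads W <= (x+1)/2. The maximum covers x <= 0, where no such
     point exists. *)
  have : Pr P [set w | W w <= Num.max (1 / 2) ((x + 1) / 2)] =
      Pr P [set w | W w <= 1 / 2] + Pr P ([set w | b w] `&` [set w | S w <= x]).
    rewrite -mbE -Pr_setU_disjoint//; last first.
      by apply/seteqP; split => w //= [/negP h [/h]].
    congr Pr; apply/seteqP; split => w; rewrite mbE /S /= /S0 /s /b le_max.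
      by have [h _|h /=] := leP (W w) (1 / 2); [left|move=> h2; right; split => //; lra].
    move=> [->//|[h]]; rewrite h /= => h2; apply/orP; right; lra.
  rewrite !WE => h; rewrite -[LHS](addKr (capf 1 (1/2))) -h.
  rewrite (@capf1_id _ (1 / 2)); try lra.
  have [h0|h0] := leP x 0; first by rewrite (capf1_le0 h0) max_l ?capf1_id; lra.
  have [h1|h1] := leP 1 x; first by rewrite (capf1_ge1 h1) max_r ?capf1_ge1; lra.
  by rewrite max_r ?(@capf1_id _ ((x + 1) / 2)) ?(@capf1_id _ x); lra.
pose f0 : measurableTypeR R -> R := even_digits R b s.
pose mf := @isMeasurableFun.Build _ _ _ _ f0 (measurable_even_digits mb ms).
pose f : {RV P >-> R} := HB.pack f0 mf.
have fs := Pr_even_digits_shift mb ms bs1 bs0.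
have fF : rcdf f = capf 1 by apply/funext => x; exact: (rcdf_even_digits mb ms bs1 bs0).
pose g : measurableTypeR R -> measurableTypeR R := f \o s.
have mg : measurable_fun [set: measurableTypeR R] g.
  by apply: measurableT_comp => //; exact: (measurable_funPT f).
pose G0 : measurableTypeR R -> R := g.
pose mG := @isMeasurableFun.Build _ _ _ _ G0 mg.
pose G : {RV P >-> R} := HB.pack G0 mG.
have GF : rcdf G = rcdf W.
  rewrite WF; apply/funext => x; rewrite -fF.
  exact: (Pr_shift mb ms bs1 bs0 (measurable_RV_le f x)).
have Gid B : measurable B -> Pr P (g @^-1` B) = Pr P B.
  by move=> mB; rewrite -[in RHS](preW B); exact: (same_distribution_Pr (rcdf_same_distribution GF) mB).
exists P, f, g; split => // A B mA mB.
have mfA := measurable_RV_preimage f mA.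
rewrite -[in RHS](preW B).
(* Independence is extended from half-lines in two rounds: first in the set for g with A fixed, then
   in the set for f with a half-line for g fixed. *)
apply: (@halfline_extension _ _ _ _ _ P P G W) => // [|y]; first exact: Pr_ge0.
have mGy := measurable_RV_le G y.
rewrite setIC WF mulrC; apply: (@halfline_extension _ _ _ _ _ P P f f _ (capf 1 y)) => //.
- exact: capf_ge0.
- by rewrite -WF -GF.
- by move=> x; rewrite fF mulrC; exact: fs.
Qed.

(* Iterating the splitting of one uniform variable into two independent ones. *)
Lemma exists_iid_uniform : exists (P : probability (measurableTypeR R) R) (V : nat -> {RV P >-> R}),
  mutually_independent V /\ forall i, rcdf (V i) = capf 1.
Proof.
have [P [f [g [fF mg Pg Pfg]]]] := exists_uniform_splitting.
have [V iV VP] := exists_iterates mg Pg Pfg.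
exists P, V; split => //.
move=> j; rewrite -fF; apply/funext => x.
have mx : measurable [set z : R | z <= x].
  by apply: measurable_set_le; [exact: measurable_id|exact: measurable_cst].
exact: (VP j _ mx).
Qed.

End uniform_digits.

Lemma mutually_independent_comp d (T : measurableType d) (R : realType) (P : probability T R)
    (V W : nat -> {RV P >-> R}) (h : R -> R) : measurable_fun [set: R] h ->
  (forall i w, W i w = h (V i w)) -> mutually_independent V -> mutually_independent W.
Proof.
move=> mh WV iV J A mA.
have mhA i : measurable (h @^-1` A i) by rewrite -[X in measurable X]setTI; exact: mh.
have E i : W i @^-1` A i = V i @^-1` (h @^-1` A i).
  by apply/seteqP; split => w; rewrite /preimage /= WV.
under eq_bigr do rewrite E; rewrite -(iV J _ mhA); congr (P _).
by apply: eq_bigcapr => i _; rewrite E.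
Qed.

(** * The quantile transform and copies of a given law *)

Section quantile.
Context d (T : measurableType d) (R : realType) (P : probability T R).
Variable Y : {RV P >-> R}.

(** Outside (0, 1) the set may be the whole line or empty, so a default value is used there; a
    uniform variable avoids these points almost surely. *)
Definition quantile (u : R) : R :=
  if (0 < u) && (u < 1) then inf [set x | u <= rcdf Y x] else 0.

(** Right-continuity of the distribution function makes the infimum attained. This equivalence gives
    both the measurability of the quantile function and the law of its values. *)
Lemma quantile_le (u x : R) : 0 < u -> u < 1 -> quantile u <= x <-> u <= rcdf Y x.
Proof.
move=> u0 u1; rewrite /quantile u0 u1 /=; set S := [set _ | _].
have [M MP] := @rcdf_cvgNy _ _ _ _ Y (u / 2) ltac:(lra).
have [M' M'P] := @rcdf_cvgy _ _ _ _ Y (1 - u) ltac:(lra).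
have lbS : lbound S M.
  move=> y Sy; rewrite leNgt; apply/negP => yM.
  by have := MP y (ltW yM); have : u <= rcdf Y y := Sy; lra.
have SM' : S M' by rewrite /S /=; have := M'P M' (lexx _); lra.
split; last by move=> ux; apply: ge_inf => //; exists M.
move=> Sx; apply/ler_addgt0Pl => e e0.
have [v xv Fv] := rcdf_right Y x e0.
have infS : has_inf S by split; [exists M'|exists M].
have [|y Sy yv] := @inf_adherent _ S (v - x) _ infS; first lra.
have : u <= rcdf Y y := Sy; have : rcdf Y y <= rcdf Y v by apply: rcdf_homo; apply: ltW; apply: lt_le_trans yv _; lra.
  lra.
Qed.

Lemma measurable_quantile : measurable_fun [set: R] quantile.
Proof.
apply: (measurability (@RGenOInfty.G R)); first exact: RGenOInfty.measurableE.
move=> _ [_ [x ->] <-]; rewrite setTI.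
have mle (z : R) : measurable [set u : R | u <= z].
  by apply: measurable_set_le; [exact: measurable_id|exact: measurable_cst].
have mlt (z : R) : measurable [set u : R | u < z].
  by apply: measurable_set_lt; [exact: measurable_id|exact: measurable_cst].
pose I := ~` [set u : R | u <= 0] `&` [set u : R | u < 1].
have mI : measurable I by apply: measurableI => //; exact: measurableC.
rewrite (_ : _ @^-1` _ = (I `&` ~` [set u : R | u <= rcdf Y x]) `|` (~` I `&` [set u : R | x < 0])).
  apply: measurableU; apply: measurableI; do ?exact: measurableC => //.
  - exact: mI.
  - by have [h|h] := ltP x 0; [rewrite (_ : [set _ | _] = setT)|rewrite (_ : [set _ | _] = set0)] => //;
    apply/seteqP; split => u //=.
apply/seteqP; split => u /=; rewrite in_itv/= andbT.
  have [[/= /negP u0 u1]|nI] := pselect (I u).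
    rewrite -ltNge in u0.
    move=> h; left; split; first by split => //=; apply/negP; rewrite -ltNge.
    by move=> /(quantile_le _ u0 u1); rewrite leNgt h.
  rewrite /quantile; case: ifPn => [/andP[u0 u1]|_ h]; last by right.
  by case: nI; split => //=; apply/negP; rewrite -ltNge.
move=> [[[/= /negP u0 u1] h]|[nI x0]].
  rewrite -ltNge in u0.
  by rewrite ltNge; apply/negP => /(quantile_le _ u0 u1).
rewrite /quantile; case: ifPn => [/andP[u0 u1]|//].
by case: nI; split => //=; apply/negP; rewrite -ltNge.
Qed.

Lemma quantile_same_distribution d' (T' : measurableType d') (P' : probability T' R)
    (V Q : {RV P' >-> R}) : rcdf V = capf 1 -> (forall w, Q w = quantile (V w)) ->
  same_distribution Q Y.
Proof.
move=> VF QV; apply: rcdf_same_distribution; apply/funext => x.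
have mN : measurable ([set w | V w <= 0] `|` [set w | 1 <= V w]).
  apply: measurableU; first exact: measurable_RV_le.
  by apply: measurable_set_le; [exact: measurable_cst|exact: measurable_funPT].
have N0 : Pr P' ([set w | V w <= 0] `|` [set w | 1 <= V w]) = 0.
  apply/eqP; rewrite eq_le Pr_ge0 andbT.
  have m1 : measurable [set w | 1 <= V w].
    by apply: measurable_set_le; [exact: measurable_cst|exact: measurable_funPT].
  apply: (le_trans (Pr_setU _ (measurable_RV_le V 0) m1)).
  have -> : Pr P' [set w | V w <= 0] = 0 by rewrite -[LHS]/(rcdf V 0) VF capf1_le0.
  rewrite add0r; apply/ler_addgt0Pl => e e0; rewrite addr0.
  have : Pr P' [set w | 1 <= V w] <= Pr P' [set w | 1 - e < V w].
    apply: le_Pr => //; first exact: measurable_RV_gt.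
    by move=> w /=; apply: lt_le_trans; lra.
  rewrite Pr_gt VF; have [h|h] := leP (1 - e) 0; first by rewrite capf1_le0 //; lra.
  by rewrite capf1_id; lra.
have -> : rcdf Y x = rcdf V (rcdf Y x) by rewrite VF capf1_id ?rcdf_ge0 ?rcdf_le1.
apply: (Pr_eq_off_null _ _ mN N0); do ?exact: measurable_RV_le.
move=> w /= nN; rewrite QV.
have [V0|V0] := leP (V w) 0; first by case: nN; left.
have [V1|V1] := leP 1 (V w); first by case: nN; right.
exact: quantile_le.
Qed.

Lemma exists_iid_copies : exists (P' : probability (measurableTypeR R) R) (Ys : nat -> {RV P' >-> R}),
  iid_copies Ys Y.
Proof.
have [P' [V [iV VF]]] := exists_iid_uniform R.
pose Z i : measurableTypeR R -> R := quantile \o V i.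
have mZ i : measurable_fun [set: measurableTypeR R] (Z i).
  by apply: measurableT_comp; [exact: measurable_quantile|exact: measurable_funPT].
pose Ys i : {RV P' >-> R} := HB.pack (Z i) (isMeasurableFun.Build _ _ _ _ (Z i) (mZ i)).
exists P', Ys; split.
  exact: (@mutually_independent_comp _ _ _ _ V Ys quantile measurable_quantile).
by move=> i; apply: (quantile_same_distribution (VF i)).
Qed.

End quantile.

(** * Means with irregular weights *)

Lemma exists_iid_coins (R : realType) : exists (P : probability (measurableTypeR R) R)
    (Xs : nat -> {RV P >-> R}),
  [/\ iid_copies Xs (Xs 0), forall i w, Xs i w = 0 \/ Xs i w = 1 &
      forall i, Pr P [set w | 0 < Xs i w] = 1 / 2].
Proof.
have [P [V [iV VF]]] := exists_iid_uniform R.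
have mg := (bdd_gtf (1 / 2 : R)).1.
pose Z i : measurableTypeR R -> R := gtf (1 / 2) \o V i.
have mZ i : measurable_fun [set: measurableTypeR R] (Z i).
  by apply: measurableT_comp => //; exact: measurable_funPT.
pose Xs i : {RV P >-> R} := HB.pack (Z i) (isMeasurableFun.Build _ _ _ _ (Z i) (mZ i)).
have X01 i w : Xs i w = 0 \/ Xs i w = 1.
  by rewrite /Xs /= /Z /= /gtf; case: (_ < _)%R; [right|left].
exists P, Xs; split => //.
  split; first exact: (@mutually_independent_comp _ _ _ _ V Xs (gtf (1 / 2)) mg).
  move=> i A mA; have := @rcdf_same_distribution _ _ _ _ _ _ _ (V i) (V 0) _ _ (_ : measurable (gtf (1 / 2) @^-1` A)).
  apply; first by rewrite !VF.
  by rewrite -[X in measurable X]setTI; exact: mg.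
move=> i; rewrite -[LHS]/(Pr P [set w | 0 < gtf (1 / 2) (V i w)]).
rewrite (_ : [set w | _] = [set w | 1 / 2 < V i w]).
  by rewrite Pr_gt VF capf1_id; lra.
by apply/seteqP; split => w /=; rewrite /gtf; case: (_ < V i w)%R => //=; rewrite ltxx.
Qed.

Lemma sigma_algebra_of_comp d (T : measurableType d) d' (T' : measurableType d')
    (R : realType) (P : probability T R) (P' : probability T' R)
    (Z : nat -> {RV P >-> R}) (Z' : nat -> {RV P' >-> R}) (g : T -> T') (E : set T) :
  (forall i w, Z i w = Z' i (g w)) -> sigma_algebra_of Z E ->
  exists2 E' : set T', measurable E' & E = g @^-1` E'.
Proof.
move=> ZZ'; move: E; apply: smallest_sub.
  split; first by exists set0 => //; rewrite preimage_set0.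
    move=> _ [A mA ->]; exists (~` A); first exact: measurableC.
    by rewrite setTD preimage_setC.
  move=> G GP; exists (\bigcup_i (sval (cid2 (GP i)))).
    by apply: bigcup_measurable => i _; case: cid2.
  by rewrite preimage_bigcup; apply: eq_bigcupr => i _; case: cid2.
move=> _ [i _ [A mA <-]]; exists (Z' i @^-1` A); first exact: measurable_RV_preimage.
by rewrite setTI; apply/seteqP; split => w; rewrite /preimage /= ZZ'.
Qed.

Lemma iid_comp d (T : measurableType d) d' (T' : measurableType d') (R : realType)
    (P : probability T R) (P' : probability T' R) (g : T -> T')
    (Z : nat -> {RV P >-> R}) (Z' : nat -> {RV P' >-> R})
    d0 (T0 : measurableType d0) (P0 : probability T0 R) (X : {RV P0 >-> R}) :
  (forall A, measurable A -> P (g @^-1` A) = P' A) -> (forall i w, Z i w = Z' i (g w)) ->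
  iid_copies Z' X -> iid_copies Z X.
Proof.
move=> Pg ZZ' [iZ ZX].
have ZE i A : Z i @^-1` A = g @^-1` (Z' i @^-1` A).
  by apply/seteqP; split => w; rewrite /preimage /= ZZ'.
have PZ i A : measurable A -> P (Z i @^-1` A) = P' (Z' i @^-1` A).
  by move=> mA; rewrite ZE Pg//; exact: measurable_RV_preimage.
split=> [J A mA|i A mA]; last by apply: etrans (PZ i A mA) _; exact: ZX.
rewrite (eq_bigr (fun i => P' (Z' i @^-1` A i))) => [|i _]; last exact: PZ.
rewrite -(iZ J A mA) -Pg; last first.
  by apply: fin_bigcap_measurable => // i _; exact: measurable_RV_preimage.
by congr (P _); apply/seteqP; split => w h i iJ; have := h i iJ; rewrite ZE.
Qed.

Section lifted_sequences.
Context d1 (T1 : measurableType d1) d2 (T2 : measurableType d2) (R : realType).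
Variables (P1 : probability T1 R) (P2 : probability T2 R).
Variables (Xs : nat -> {RV P1 >-> R}) (Ys : nat -> {RV P2 >-> R}).

Definition lift_fst_seq i : {RV (P1 \x P2)%E >-> R} := lift_fst (Xs i).
Definition lift_snd_seq i : {RV (P1 \x P2)%E >-> R} := lift_snd (Ys i).

Let P_fst (A : set T1) : measurable A -> (P1 \x P2)%E (fst @^-1` A) = P1 A.
Proof.
by move=> mA; rewrite -!EFin_Pr ?Pr_prod_fst//; exact: measurable_preimage_fst.
Qed.

Let P_snd (A : set T2) : measurable A -> (P1 \x P2)%E (snd @^-1` A) = P2 A.
Proof.
by move=> mA; rewrite -!EFin_Pr ?Pr_prod_snd//; exact: measurable_preimage_snd.
Qed.

Lemma iid_lift_fst d (T : measurableType d) (P : probability T R) (X : {RV P >-> R}) :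
  iid_copies Xs X -> iid_copies lift_fst_seq X.
Proof. exact: iid_comp P_fst _. Qed.

Lemma iid_lift_snd d (T : measurableType d) (P : probability T R) (Y : {RV P >-> R}) :
  iid_copies Ys Y -> iid_copies lift_snd_seq Y.
Proof. exact: iid_comp P_snd _. Qed.

Lemma independent_lift : independent_sequences lift_fst_seq lift_snd_seq.
Proof.
move=> E F sE sF.
have [|E0 mE0 ->] := @sigma_algebra_of_comp _ _ _ _ _ _ P1 lift_fst_seq Xs fst E _ sE; first by [].
have [|F0 mF0 ->] := @sigma_algebra_of_comp _ _ _ _ _ _ P2 lift_snd_seq Ys snd F _ sF; first by [].
apply: etrans (product_measure1E P1 P2 mE0 mF0) _.
by congr (_ * _)%E; apply/esym; [exact: P_fst|exact: P_snd].
Qed.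

End lifted_sequences.

(** Some interval (u, v] around t has small mass under W; by convergence at its endpoints, a ball
    inside it has small mass for all late terms. *)
Lemma continuous_limit_small_ball d (T : measurableType d) d' (T' : measurableType d')
    (R : realType) (P : probability T R) (Q : probability T' R)
    (U : nat -> {RV P >-> R}) (W : {RV Q >-> R}) (t tau : R) :
  cvg_in_distribution U W -> continuous_distribution W -> 0 < tau ->
  exists (e : R) (N : nat), 0 < e /\ forall k, (N <= k)%N ->
    Pr P [set w | `|U k w - t| <= e] <= tau.
Proof.
move=> UW cW tau0.
have cF x : {for x, continuous (rcdf W)} by apply/cdf_continuousP; exact: cW.
have [u [v [ut tv Fuv]]] := (nondecreasing_continuousP t (@rcdf_homo _ _ _ _ W)).1 (cF t) (tau / 2) ltac:(lra).
have [N1 N1P] := cvg_in_distributionP UW (cF u) (e := tau / 4) ltac:(lra).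
have [N2 N2P] := cvg_in_distributionP UW (cF v) (e := tau / 4) ltac:(lra).
pose e := Num.min (t - u) (v - t) / 2.
have [e1 e2] : 2 * e <= t - u /\ 2 * e <= v - t.
  by rewrite /e mulrCA divff// mulr1; split; rewrite ge_min lexx ?orbT.
have e0 : 0 < e by rewrite divr_gt0// lt_min !subr_gt0 ut.
exists e, (maxn N1 N2); split => // k; rewrite geq_max => /andP[/N1P + /N2P].
have : Pr P [set w | `|U k w - t| <= e] <= rcdf (U k) v - rcdf (U k) u.
  rewrite lerBrDl; have mB : measurable [set w | `|U k w - t| <= e].
    apply: measurable_set_le; last exact: measurable_cst.
    by apply: measurableT_comp => //; apply: measurable_funB => //; exact: measurable_cst.
  have mu := measurable_RV_le (U k) u.
  have -> : rcdf (U k) u + Pr P [set w | `|U k w - t| <= e] =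
      Pr P ([set w | U k w <= u] `|` [set w | `|U k w - t| <= e]).
    apply/esym/Pr_setU_disjoint => //; apply/seteqP; split => w //= [wu].
    by rewrite ler_norml => /andP[]; lra.
  apply: le_Pr; [exact: measurableU|exact: measurable_RV_le|].
  by move=> w /= [wu|]; [|rewrite ler_norml => /andP[]]; lra.
by rewrite !ler_norml; set p := Pr _ _ => ? /andP[? ?] /andP[? ?]; lra.
Qed.

Section irregular_means.
Context d1 (T1 : measurableType d1) d2 (T2 : measurableType d2) (R : realType).
Variables (P1 : probability T1 R) (P2 : probability T2 R).
Variables (Xs : nat -> {RV P1 >-> R}) (Ys : nat -> {RV P2 >-> R}).
Hypothesis iidX : iid_copies Xs (Xs 0).
Hypothesis X01 : forall i w, Xs i w = 0 \/ Xs i w = 1.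
Hypothesis PrX : forall i, Pr P1 [set w | 0 < Xs i w] = 1 / 2.
Context d0 (T0 : measurableType d0) (P0 : probability T0 R).
Variable Y : {RV P0 >-> R}.
Hypothesis ndY : non_degenerate Y.
Hypothesis Y_ge0 : forall w, 0 <= Y w.
Hypothesis iidY : iid_copies Ys Y.
Hypothesis Ys_ge0 : forall i w, 0 <= Ys i w.

Let P := (P1 \x P2)%E.
Let mean n : {RV P >-> R} := weighted_mean (lift_fst_seq P2 Xs) (lift_snd_seq P1 Ys) n.

Let meanE n w : mean n w = (\sum_(i < n) Xs i w.1 * Ys i w.2) / partial_sum Ys n w.2.
Proof. by []. Qed.

Let mM n t a : measurable [set w | `|mean n w - t| <= a].
Proof. by apply: measurable_dist_le; exact: measurable_funPT. Qed.

Lemma weighted_mean_range n w : 0 <= mean n w <= 1.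
Proof.
rewrite meanE; have S0 := partial_sum_ge0 Ys_ge0 n w.2.
have XY0 : 0 <= \sum_(i < n) Xs i w.1 * Ys i w.2.
  by apply: sumr_ge0 => i _; case: (X01 i w.1) => ->; rewrite ?mul0r ?mul1r.
rewrite divr_ge0//=.
have XYS : \sum_(i < n) Xs i w.1 * Ys i w.2 <= partial_sum Ys n w.2.
  by apply: ler_sum => i _; case: (X01 i w.1) => ->; rewrite ?mul0r ?mul1r.
have [->|S1] := eqVneq (partial_sum Ys n w.2) 0; first by rewrite invr0 mulr0.
by rewrite ler_pdivrMr ?mul1r// lt_def S1.
Qed.

Let bX i : bounded_measurable (Xs i).
Proof.
split; first exact: measurable_funPT.
by exists 1 => w; case: (X01 i w) => ->; rewrite ?normr0 ?normr1.
Qed.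

Lemma Ex_coin i : Ex P1 (Xs i) = 1 / 2.
Proof.
rewrite -(PrX i) -Ex_indic; last exact: measurable_RV_gt.
congr Ex; apply/funext => w; rewrite indicE.
case: (X01 i w) => h; case: (boolP (w \in _)); rewrite ?inE /= h ?ltxx ?ltr01//.
by move=> /negP; rewrite in_setE /= h.
Qed.

Lemma Ex_coin_pair i j : i != j -> Ex P1 (fun w => Xs i w * Xs j w) = 1 / 4.
Proof.
move=> ij; have bc := bdd_capf (@ler01 R).
have E k w : Xs k w = capf 1 (Xs k w).
  by case: (X01 k w) => ->; rewrite /capf ?maxxx ?min_l ?max_l.
rewrite (_ : (fun w => _) = (fun w => capf 1 (Xs i w) * capf 1 (Xs j w))); last first.
  by apply/funext => w; rewrite -!E.
rewrite (mutually_independent_Ex iidX.1 ij bc bc).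
rewrite (_ : capf 1 \o Xs i = Xs i :> (T1 -> R)); last by apply/funext => w /=; rewrite -E.
rewrite (_ : capf 1 \o Xs j = Xs j :> (T1 -> R)); last by apply/funext => w /=; rewrite -E.
by rewrite !Ex_coin; lra.
Qed.

(** The coins are fair, take values 0 and 1 and are independent of the weights, so they halve the
    mean and do not increase the second moments. *)
Lemma Pr_coin_sum z n (a : R) : 0 <= z -> 0 < a ->
  Pr P [set w | a <= `|\sum_(i < n) Xs i w.1 * truncf z (Ys i w.2) - n%:R * truncm Y z / 2|]
  <= n%:R * (z * truncm Y z) / a ^+ 2.
Proof.
move=> z0 a0; have bt := bdd_truncf z0.
pose Z i (w : T1 * T2) := Xs i w.1 * truncf z (Ys i w.2).
have btY i : bounded_measurable (fun w => truncf z (Ys i w)) by exact: (bdd_comp (Ys i) bt).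
have bZ i : bounded_measurable (Z i).
  exact: (bddM (bdd_fst T2 (bX i)) (bdd_snd T1 (btY i))).
have EZ i : Ex P (Z i) = truncm Y z / 2.
  by rewrite /P /Z (Ex_prod _ _ (bX i) (btY i)) Ex_coin (Ex_copy iidY i bt) mulrC /truncm; lra.
have EZZ i j : i != j -> Ex P (fun w => Z i w * Z j w) = Ex P (Z i) * Ex P (Z j).
  move=> ij; rewrite !EZ.
  rewrite (_ : (fun w => _) = (fun w => (Xs i w.1 * Xs j w.1) *
      (truncf z (Ys i w.2) * truncf z (Ys j w.2)))); last first.
    by apply/funext => w; rewrite /Z mulrACA.
  rewrite /P (@Ex_prod _ _ _ _ _ P1 P2 (fun w => Xs i w * Xs j w)
     (fun w => truncf z (Ys i w) * truncf z (Ys j w)) (bddM (bX i) (bX j)) (bddM (btY i) (btY j))).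
  by rewrite Ex_coin_pair// (Ex_copy2 iidY bt ij) !(Ex_copy iidY _ bt) /truncm; field.
have := chebyshev_sum n bZ EZZ a0.
have -> : \sum_(i < n) Ex P (Z i) = n%:R * truncm Y z / 2.
  by under eq_bigr do rewrite EZ; rewrite sumr_const card_ord -[_ *+ n]mulr_natl mulrA.
move=> h; apply: le_trans h _.
rewrite ler_pM2r ?invr_gt0 ?exprn_gt0//.
have bsq i : bounded_measurable (fun w => truncf z (Ys i w) ^+ 2).
  exact: bdd_sqr.
have : forall i, Ex P (fun w => Z i w ^+ 2) <= z * truncm Y z.
  move=> i; apply: (@le_trans _ _ (Ex P (fun w => 1 * truncf z (Ys i w.2) ^+ 2))).
    apply: le_Ex.
    - exact: bdd_sqr.
    - by apply: bddM; [exact: bdd_cst|exact: (bdd_snd T1 (bsq i))].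
    - move=> w; rewrite /Z; case: (X01 i w.1) => ->; rewrite ?mul0r ?mul1r// expr0n/=.
      exact: sqr_ge0.
  rewrite /P (Ex_prod P1 P2 (bdd_cst _ 1) (bsq i)) Ex_cst mul1r.
  apply: le_trans (truncm_sqr Y z0).
  by rewrite (Ex_copy iidY i (f := fun y => truncf z y ^+ 2))//; exact: bdd_sqr.
move=> h; apply: (@le_trans _ _ (\sum_(i < n) z * truncm Y z)); first by apply: ler_sum => i _; exact: h.
by rewrite sumr_const card_ord mulr_natl.
Qed.

Lemma light_jumps_mean (e : R) (N : nat) : light_jumps Y -> 0 < e -> e <= 1 / 4 ->
  exists2 n, (N <= n)%N & 1 - 2 * e <= Pr P [set w | `|mean n w - 1 / 2| <= 3 * e].
Proof.
move=> lj e0 e1; have [n [x [Nn x0 [dl [dl0 dle h1 h2 h3]]]]] :=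
  light_jumps_sum ndY Y_ge0 iidY Ys_ge0 N lj e0 (ltac:(lra) : e <= 1 / 2).
exists n => //; pose z := dl * x.
have z0 : 0 < z by exact: mulr_gt0.
have e2 : 0 < e ^+ 2 by exact: exprn_gt0.
have dle2 : dl <= e * e ^+ 2 / 16 by rewrite -exprS.
have dlle : dl <= e by nra.
pose B1 := [set w | 1 <= exceedances Ys z n w] `|` [set w | e * x < `|partial_sum Ys n w - x|].
pose V (w : T1 * T2) := \sum_(i < n) Xs i w.1 * truncf z (Ys i w.2).
pose B2 := [set w | e * x / 2 <= `|V w - n%:R * truncm Y z / 2|].
have mB1 : measurable B1.
  apply: measurableU.
    by apply: measurable_set_le; [exact: measurable_cst|exact: (bdd_exceedances _ _ _).1].
  apply: measurable_dist_gt.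
  exact: measurable_partial_sum.
have mB1' : measurable (snd @^-1` B1 : set (T1 * T2)).
  exact: measurable_preimage_snd.
have mV : measurable_fun [set: T1 * T2] V.
  apply: measurable_sum => i; apply: measurable_funM.
    exact: (measurableT_comp (measurable_funPT (Xs i)) measurable_fst).
  have [mt _] := bdd_truncf (ltW z0).
  exact: (measurableT_comp (measurableT_comp mt (measurable_funPT (Ys i))) measurable_snd).
have mB2 : measurable B2.
  apply: measurable_set_le; first exact: measurable_cst.
  by apply: measurableT_comp => //; apply: measurable_funB => //; exact: measurable_cst.
have PB1 : Pr P (snd @^-1` B1) <= e by rewrite /P Pr_prod_snd.
have PB2 : Pr P B2 <= e.
  have a0 : 0 < e * x / 2 by rewrite divr_gt0// mulr_gt0.
  apply: le_trans (Pr_coin_sum n (ltW z0) a0) _.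
  rewrite ler_pdivrMr ?exprn_gt0//; apply: le_trans h2 _.
  have -> : e * (e * x / 2) ^+ 2 = (e * e ^+ 2 / 4) * x ^+ 2 by field.
  by rewrite ler_pM2r ?exprn_gt0//; lra.
have mBB : measurable (snd @^-1` B1 `|` B2) by exact: measurableU.
apply: (@le_trans _ _ (Pr P (~` (snd @^-1` B1 `|` B2)))).
  by rewrite Pr_setC//; have := Pr_setU P mB1' mB2; lra.
apply: le_Pr; [exact: measurableC|exact: mM|].
move=> w /= /not_orP[/not_orP[/negP + /negP +] /negP].
rewrite -!ltNge -leNgt => g1 g2 g3; rewrite meanE.
have VE : \sum_(i < n) Xs i w.1 * Ys i w.2 = V w.
  apply: eq_bigr => i _; congr (_ * _); rewrite /truncf Ys_ge0/=; case: ifP => // /negbT.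
  rewrite -ltNge => zY; move: g1; apply: contraTeq => _; rewrite -leNgt.
  rewrite /exceedances (bigD1 i)//= {1}/gtf zY lerDl.
  by apply: sumr_ge0 => j _; rewrite ler0n.
rewrite VE; set S := partial_sum Ys n w.2 in g2 *.
have ex : 0 < e * x by exact: mulr_gt0.
have dlx : z <= e * x by rewrite ler_pM2r.
have ex4 : e * x <= 1 / 4 * x by rewrite ler_pM2r.
move: g2 g3 h1; rewrite -/z !ler_norml ltr_norml => /andP[s1 s2] /andP[v1 v2] /andP[m1 m2].
have S0 : 0 < S by lra.
(* The numerator differs from S/2 by at most 3 e x / 2, from three errors of e x / 2, and S >= 3 x /
   4. So the quotient is within 2e of 1/2. *)
have eS : 3 / 4 * (e * x) <= e * S by rewrite mulrCA ler_pM2l//; lra.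
have -> : V w / S - 1 / 2 = (V w - S / 2) / S by field; rewrite gt_eqF.
rewrite ler_pdivlMr// ler_pdivrMr// -!mulrA; apply/andP; split; lra.
Qed.

(** When one weight exceeds x and the others sum to less than e x, the mean is within e of the coin
    attached to that weight, hence near 0 or near 1. The value 1/32 is kap/8 at kap = 1/4. *)
Lemma heavy_jumps_mean (e : R) (N : nat) : heavy_jumps Y -> 0 < e -> e <= 1 / 4 ->
  exists2 n, (N <= n)%N &
    1 / 32 <= Pr P [set w | `|mean n w| <= e] + Pr P [set w | `|mean n w - 1| <= e].
Proof.
move=> hj e0 e1; have [n [x [Nn x0 h1 _ _]]] :=
  heavy_jumps_sum ndY Y_ge0 iidY Ys_ge0 N hj (ltac:(lra) : 0 < 1 / 4 :> R) (lexx _) e0 (ltac:(lra) : e <= 1 / 2).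
exists n => //.
have mM0 : measurable [set w | `|mean n w| <= e].
  by have := mM n 0 e; under eq_set do rewrite subr0.
pose B := [set w | exceedances Ys x n w = 1] `&` [set w | truncated_sum Ys x n w < e * x].
have mB : measurable B.
  have [mE _] := bdd_exceedances Ys x n; have [mS _] := bdd_truncated_sum Ys n (ltW x0).
  apply: measurableI; last by apply: measurable_set_lt => //; exact: measurable_cst.
  rewrite -[X in measurable X]setTI; exact: (mE measurableT _ (measurable_set1 1)).
have mB' : measurable (snd @^-1` B : set (T1 * T2)).
  exact: measurable_preimage_snd.
have : 1 / 32 <= Pr P (snd @^-1` B) by rewrite /P Pr_prod_snd//; apply: le_trans h1; lra.
move=> h; apply: (le_trans h); apply: (le_trans _ (Pr_setU _ mM0 (mM n 1 e))).
apply: le_Pr => //; first by apply: measurableU; [exact: mM0|exact: mM].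
move=> w [/= wE wS].
have [i Yi] : exists i : 'I_n, x < Ys i w.2.
  apply: contrapT => nY; move: wE; rewrite /exceedances big1 => [/eqP|i _].
    by rewrite eq_sym oner_eq0.
  rewrite /gtf; case: ltP => // ?; by case: nY; exists i.
have Yj j : j != i -> Ys j w.2 <= x.
  move=> ji; rewrite leNgt; apply/negP => Yj; move: wE; apply/eqP; rewrite gt_eqF//.
  rewrite /exceedances (bigD1 i)//= (bigD1 j)//= /gtf Yi Yj.
  rewrite ltrDl ltr_wpDr//; by apply: sumr_ge0 => k _; rewrite ler0n.
pose r := \sum_(j < n | j != i) Ys j w.2.
pose q := \sum_(j < n | j != i) Xs j w.1 * Ys j w.2.
have rE : r <= truncated_sum Ys x n w.2.
  rewrite /truncated_sum (bigD1 i)//= {1}/truncf (leNgt (Ys i w.2)) Yi andbF add0r.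
  by apply: ler_sum => j ji; rewrite /truncf Ys_ge0 Yj.
have q0 : 0 <= q by apply: sumr_ge0 => j _; case: (X01 j w.1) => ->; rewrite ?mul0r ?mul1r.
have qr : q <= r by apply: ler_sum => j _; case: (X01 j w.1) => ->; rewrite ?mul0r ?mul1r.
have SE : partial_sum Ys n w.2 = Ys i w.2 + r by rewrite /partial_sum (bigD1 i).
have ME : mean n w = (Xs i w.1 * Ys i w.2 + q) / (Ys i w.2 + r) by rewrite meanE SE (bigD1 i).
have S0 : 0 < Ys i w.2 + r by lra.
have eS : e * x <= e * (Ys i w.2 + r) by rewrite ler_pM2l//; lra.
case: (X01 i w.1) => Xi; [left|right]; rewrite /mkset ME Xi.
  by rewrite mul0r add0r ger0_norm ?divr_ge0// ?ler_pdivrMr//; lra.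
have -> : (1 * Ys i w.2 + q) / (Ys i w.2 + r) - 1 = - ((r - q) / (Ys i w.2 + r)).
  by field; rewrite gt_eqF.
by rewrite normrN ger0_norm ?divr_ge0 ?ler_pdivrMr//; lra.
Qed.

Hypothesis continuous_limits : forall d3 (T3 : measurableType d3) (Q : probability T3 R)
  (W : {RV Q >-> R}), subsequential_limit mean W -> continuous_distribution W.

(** A failure would persist along a subsequence with balls shrinking to t. The means lie in [0, 1],
    so Helly's theorem gives a limit along a further subsequence; it is continuous by hypothesis,
    against [continuous_limit_small_ball]. *)
Lemma mean_small_ball (t tau : R) : 0 < tau -> exists (e : R) (N : nat), 0 < e /\
  forall n, (N <= n)%N -> Pr P [set w | `|mean n w - t| <= e] <= tau.
Proof.
move=> tau0; apply: contrapT => H.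
have [k N|phi incphi phiP] := @increasing_subsequence (fun k n =>
    tau < Pr P [set w | `|mean n w - t| <= k.+1%:R^-1]).
  apply: contrapT => H'; apply: H; exists k.+1%:R^-1, N; split; first by rewrite invr_gt0.
  by move=> n Nn; rewrite leNgt; apply/negP => h; apply: H'; exists n.
have [|psi incpsi [d3 [T3 [Q [W TW]]]]] := @helly_RV _ _ _ _ (mean \o phi).
  move=> e e0; exists 1, 0 => k _; split.
    rewrite /rcdf (_ : [set w | _] = set0) ?Pr_set0; first exact: ltW.
    apply/seteqP; split => w //=; apply/negP; rewrite -ltNge.
    by have /andP[m0 _] := weighted_mean_range (phi k) w; apply: lt_le_trans m0; lra.
  rewrite /rcdf (_ : [set w | _] = setT) ?Pr_setT; first lra.
  by apply/seteqP; split => w //= _; have /andP[] := weighted_mean_range (phi k) w.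
have cW : continuous_distribution W.
  by apply: continuous_limits; exists (phi \o psi) => //; exact: increasing_seq_comp.
have [e [N [e0 NP]]] := continuous_limit_small_ball t TW cW tau0.
have [N' N'P] := inv_succ_small e0; pose k := maxn N N'.
have := NP k (leq_maxl _ _); apply/negP; rewrite -ltNge.
apply: (lt_le_trans (phiP (psi k))).
apply: le_Pr; [exact: mM|exact: mM|].
move=> w /= h; apply: le_trans h _; apply: N'P.
by apply: leq_trans (increasing_seq_ge k incpsi); exact: leq_maxr.
Qed.

Lemma continuous_limits_regular : ~ light_jumps Y /\ ~ heavy_jumps Y.
Proof.
split.
  (* Light jumps put mass at least 1 - 2 e' >= 1/2 near 1/2, above the permitted 1/4. Heavy jumps
     put at least 1/32 near 0 and 1 together, above 1/128 + 1/128. *)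
  move=> lj; have [e [N [e0 NP]]] := @mean_small_ball (1 / 2) (1 / 4) ltac:(lra).
  pose e' := Num.min (e / 3) (1 / 4).
  have e'0 : 0 < e' by rewrite lt_min divr_gt0//; lra.
  have e'1 : e' <= 1 / 4 by rewrite ge_min lexx orbT.
  have e'e : 3 * e' <= e by have : e' <= e / 3 by [rewrite ge_min lexx]; lra.
  have [n Nn h] := light_jumps_mean N lj e'0 e'1; have := NP n Nn.
  have : Pr P [set w | `|mean n w - 1 / 2| <= 3 * e'] <= Pr P [set w | `|mean n w - 1 / 2| <= e].
    by apply: le_Pr; [exact: mM|exact: mM|move=> w /= h'; apply: le_trans h' _].
  lra.
have num : 1 / 128 + 1 / 128 < 1 / 32 :> R by lra.
move=> hj; have [e [N [e0 NP]]] := @mean_small_ball 0 (1 / 128) ltac:(lra).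
have [e2 [N2 [e20 N2P]]] := @mean_small_ball 1 (1 / 128) ltac:(lra).
pose e' := Num.min (Num.min e e2) (1 / 4).
have e'0 : 0 < e' by rewrite !lt_min e0 e20/=; lra.
have e'1 : e' <= 1 / 4 by rewrite ge_min lexx orbT.
have e'e : e' <= e by rewrite !ge_min lexx.
have e'e2 : e' <= e2 by rewrite !ge_min lexx orbT.
have [n] := heavy_jumps_mean (maxn N N2) hj e'0 e'1; rewrite geq_max => /andP[/NP g1 /N2P g2].
have l1 : Pr P [set w | `|mean n w| <= e'] <= Pr P [set w | `|mean n w - 0| <= e].
  apply: le_Pr; [by have := mM n 0 e'; under eq_set do rewrite subr0|exact: mM|].
  by move=> w /= h; rewrite subr0; apply: le_trans h _.
have l2 : Pr P [set w | `|mean n w - 1| <= e'] <= Pr P [set w | `|mean n w - 1| <= e2].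
  by apply: le_Pr; [exact: mM|exact: mM|move=> w /= h; apply: le_trans h _].
move=> h; have := le_trans h (lerD (le_trans l1 g1) (le_trans l2 g2)).
by rewrite leNgt num.
Qed.

End irregular_means.

(** * Invariance under equality in law, and the equivalence *)

Section same_law_reduction.
Context d (T : measurableType d) d' (T' : measurableType d') (R : realType).
Variables (P : probability T R) (P' : probability T' R).
Variables (Y : {RV P >-> R}) (Y' : {RV P' >-> R}).
Hypothesis YY' : same_distribution Y Y'.

Lemma iid_copies_law d1 (T1 : measurableType d1) (P1 : probability T1 R)
    (Ys : nat -> {RV P1 >-> R}) : iid_copies Ys Y <-> iid_copies Ys Y'.
Proof.
split=> -[iY YsY]; split => // i A mA; have := YsY i A mA; have := YY' mA.
  by move=> <-.
by move=> ->.
Qed.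

Lemma centered_feller_class_law : centered_feller_class Y <-> centered_feller_class Y'.
Proof.
by split=> -[a [a0 ainf H]]; exists a; split => // d1 T1 P1 Ys /iid_copies_law; exact: H.
Qed.

Lemma non_degenerate_law : non_degenerate Y -> non_degenerate Y'.
Proof.
by move=> ndY [c Yc]; apply: ndY; exists c; rewrite -Yc; exact: (YY' (measurable_set1 c)).
Qed.

End same_law_reduction.

Theorem theorem1 (R : realType) (d : measure_display) (T : measurableType d)
    (P : probability T R) (Y : {RV P >-> R})
    (Y_ge0 : {ae P, forall w, 0 <= Y w})
    (Y_nondeg : non_degenerate Y) :
  (forall (d1 : measure_display) (T1 : measurableType d1)
      (P1 : probability T1 R) (X : {RV P1 >-> R}),
    non_degenerate X -> ('E_P1[(fun w => `|X w|)%R] < +oo)%E ->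
    forall (d2 : measure_display) (T2 : measurableType d2)
      (P2 : probability T2 R) (Xs Ys : nat -> {RV P2 >-> R}),
    iid_copies Xs X -> iid_copies Ys Y -> independent_sequences Xs Ys ->
    forall (d3 : measure_display) (T3 : measurableType d3)
      (Q : probability T3 R) (W : {RV Q >-> R}),
    subsequential_limit (fun n => weighted_mean Xs Ys n : {RV P2 >-> R}) W ->
    continuous_distribution W)
  <-> centered_feller_class Y.
Proof.
have YY0 := pos_part_same_distribution Y_ge0.
have iidE := iid_copies_law YY0.
rewrite (centered_feller_class_law YY0).
have ndY := non_degenerate_law YY0 Y_nondeg.
have Y0_ge0 := pos_part_ge0 Y; move: YY0 iidE ndY Y0_ge0.
set Y0 : {RV P >-> R} := pos_part Y => YY0 iidE ndY Y0_ge0.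
(* A regular tail gives both statements and an irregular one refutes both. *)
have [reg|irreg] := pselect (exists x0 c rho, regular_tail Y0 x0 c rho).
  have [x0 [c [rho regY]]] := reg.
  split => [_|_]; first exact: (regular_tail_feller ndY Y0_ge0 regY).
  move=> d1 T1 P1 X ndX _ d2 T2 P2 Xs Ys iidX /iidE iidY iXY d3 T3 Q W.
  exact: (regular_tail_continuous ndY Y0_ge0 regY ndX iidX iidY iXY).
have [P2 [Ys0 iidY0]] := exists_iid_copies Y0.
have iidY := iid_pos_seq Y0_ge0 iidY0.
have Ys_ge0 := @pos_seq_ge0 _ _ _ _ Ys0.
split; last first.
  move=> [a fellerY]; have [lj|hj] := irregular_tail_cases irreg.
    by case: (feller_not_light_jumps ndY Y0_ge0 iidY Ys_ge0 fellerY lj).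
  by case: (feller_not_heavy_jumps ndY Y0_ge0 iidY Ys_ge0 fellerY hj).
move=> H; have [P1 [Xs [iidX X01 PrX]]] := exists_iid_coins R.
have ndX : non_degenerate (Xs 0).
  move=> [c Xc]; have mc := measurable_RV_preimage (Xs 0) (measurable_set1 c).
  have hc : Pr P1 (Xs 0 @^-1` [set c]) = 1 by rewrite /Pr Xc.
  have hp := PrX 0; have mp := measurable_RV_gt (Xs 0) 0.
  have [c0|c0] := ltP 0 c.
    suff : Pr P1 (Xs 0 @^-1` [set c]) <= Pr P1 [set w | 0 < Xs 0 w] by rewrite hc hp; lra.
    by apply: le_Pr => // w /= ->.
  suff : Pr P1 (Xs 0 @^-1` [set c]) <= Pr P1 (~` [set w | 0 < Xs 0 w]) by rewrite hc Pr_setC// hp; lra.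
  apply: le_Pr => //; first exact: measurableC.
  by move=> w /= ->; apply/negP; rewrite -leNgt.
have EX : ('E_P1[(fun w => `|Xs 0 w|)%R] < +oo)%E.
  have bX : bounded_measurable (Xs 0).
    split; first exact: measurable_funPT.
    by exists 1 => w; case: (X01 0 w) => ->; rewrite ?normr0 ?normr1.
  have /integrableP[_] := bdd_integrable P1 bX.
  by rewrite unlock.
have l1 := iid_lift_fst P2 iidX.
have l2 := (iidE _ _ _ _).2 (iid_lift_snd P1 iidY).
have cl := H _ _ P1 (Xs 0) ndX EX _ _ (P1 \x P2)%E _ _ l1 l2 (@independent_lift _ _ _ _ _ P1 P2 Xs (pos_seq Ys0)).
have [nl nh] := continuous_limits_regular iidX X01 PrX ndY Y0_ge0 iidY Ys_ge0 cl.
by have [/nl|/nh] := irregular_tail_cases irreg.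
Qed.
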